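(* Let $1\le s,t\le M$ and $u=\min(s,t)$. Let $X,Y\in\mathbb{C}[a,b]$ be the polynomials determined by $R^{s,t}_{a,b}(v^{(s)}\otimes v^{(t)})=X\,v^{(s)}\otimes v^{(t)}$ and $R^{s,t}_{a,b}(v_\kappa^{\otimes (s+t)})=Y\,v_\kappa^{\otimes (s+t)}$. Set $$\mathcal N=\prod_{j=1}^u\bigl(a-bq^{-2(t-u+j)}\bigr),\qquad \mathcal D=\prod_{j=1}^u\bigl(a-bq^{2(s-u+j)}\bigr).$$ Then $\frac{X}{Y}$ is equal to $\frac{\mathcal N}{\mathcal D}$ up to a non-zero complex scalar. Moreover, $\mathcal N$ (resp. $\mathcal D$) is, up to a non-zero scalar, the denominator of the $\mathrm{End}(V_s^+\otimes V_t^+)$-valued rational function $\frac1X R^{s,t}_{a,b}|_{V_s^+\otimes V_t^+}$ (resp. $\frac1Y R^{s,t}_{a,b}|_{V_s^+\otimes V_t^+}$).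
   Context: Fix integers $M,N\ge 1$ and $q\in\mathbb{C}^\times$ not a root of unity. Put $\kappa=M+N$, $I=\{1,\dots,\kappa\}$; for $i\le M$ set $|i|=\bar 0,\ d_i=1$; for $i>M$ set $|i|=\bar 1,\ d_i=-1$; $q_i=q^{d_i}$. All vector spaces, algebras and modules are $\mathbb{Z}_2$-graded over $\mathbb{C}$, and tensor products of algebras and of maps obey the Koszul sign rule. Let $\mathbf V=\bigoplus_{i\in I}\mathbb{C}v_i$ with $|v_i|=|i|$, $E_{ij}\in\mathrm{End}(\mathbf V)$, $E_{ij}v_k=\delta_{jk}v_i$, and let $$R(z,w)=\sum_{i}(zq_i-wq_i^{-1})E_{ii}\otimes E_{ii}+(z-w)\sum_{i\ne j}E_{ii}\otimes E_{jj}+z\sum_{i<j}(q_i-q_i^{-1})E_{ji}\otimes E_{ij}+w\sum_{i<j}(q_j-q_j^{-1})E_{ij}\otimes E_{ji}.$$ The quantum affine superalgebra $U_q(\widehat{\mathfrak g})$, $\mathfrak g=\mathfrak{gl}(M,N)$, is generated by $s_{ij}^{(n)},t_{ij}^{(n)}$ ($i,j\in I$, $n\ge0$) of parity $|i|+|j|$ with relations, for $s_{ij}(z)=\sum_n s_{ij}^{(n)}z^n$, $t_{ij}(z)=\sum_n t_{ij}^{(n)}z^{-n}$, $S(z)=\sum s_{ij}(z)\otimes E_{ij}$, $T(z)=\sum t_{ij}(z)\otimes E_{ij}$: $R_{23}(z,w)A_{12}(z)B_{13}(w)=B_{13}(w)A_{12}(z)R_{23}(z,w)$ for $(A,B)\in\{(T,T),(S,S),(T,S)\}$,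 $t_{ij}^{(0)}=s_{ji}^{(0)}=0$ for $i<j$, $t_{ii}^{(0)}s_{ii}^{(0)}=1=s_{ii}^{(0)}t_{ii}^{(0)}$. It is a Hopf superalgebra with $\Delta(s_{ij}^{(n)})=\sum_{m=0}^n\sum_{k}(-1)^{(|i|+|k|)(|k|+|j|)}s_{ik}^{(m)}\otimes s_{kj}^{(n-m)}$ and the same formula for $t$. $U_q(\mathfrak g)$ is the sub-Hopf-superalgebra generated by $s_{ij}:=s_{ij}^{(0)}$, $t_{ij}:=t_{ij}^{(0)}$. $\mathbf V$ is a $U_q(\mathfrak g)$-module via $s_{ii}\mapsto q_iE_{ii}+\sum_{j\ne i}E_{jj}$, $t_{ii}\mapsto$ its inverse, and for $i<j$: $s_{ij}\mapsto(q_i-q_i^{-1})E_{ij}$, $t_{ji}\mapsto-(q_i-q_i^{-1})E_{ji}$. For $1\le s\le M$, $V_s^+$ is the sub-$U_q(\mathfrak g)$-module of $\mathbf V^{\otimes s}$ generated by $v_\kappa^{\otimes s}$; it contains the highest weight vector $v^{(s)}=\sum_{\sigma\in\mathfrak S_s}(-q)^{l(\sigma)}v_{\sigma(1)}\otimes\cdots\otimes v_{\sigma(s)}$, $l(\sigma)$ being the length of $\sigma$. Put $R^{s,t}_{a,b}=F_tF_{t-1}\cdots F_1\in\mathrm{End}(\mathbf V^{\otimes(s+t)})$, where $F_j=R(aq^{-2},bq^{-2j})_{1,s+j}R(aq^{-4},bq^{-2j})_{2,s+j}\cdots R(aq^{-2s},bq^{-2j})_{s,s+j}$; the subscripts $i,s+j$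 indicate the tensor factors acted on. This operator preserves $V_s^+\otimes V_t^+\subseteq\mathbf V^{\otimes(s+t)}$, and $v^{(s)}\otimes v^{(t)}$ and $v_\kappa^{\otimes(s+t)}$ are eigenvectors with eigenvalues polynomial in $a,b$. The denominator of an operator-valued rational function $R(a,b)$ is a homogeneous polynomial $D(a,b)$ of minimal degree such that $D(a,b)R(a,b)$ is polynomial in $a,b$; it is well-defined up to a non-zero scalar. *)

(* Defs.v *)
From HB Require Import structures.
From mathcomp Require Import all_boot all_order all_fingroup all_algebra.
From mathcomp Require Import fraction mpoly.

Set Implicit Arguments.
Unset Strict Implicit.
Unset Printing Implicit Defensive.

Import GRing.Theory.

Local Open Scope ring_scope.

(* Index sets are 0-based: the index i of {1, ..., M + N} is the element       *)
(* i - 1 of 'I_(M + N).  Tensor factors keep their 1-based numbering.          *)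

Section TensorPowers.

Variables M N : nat.

Definition par (i : 'I_(M + N)) : nat := (M <= i)%N.

Definition mindex (n : nat) := {ffun 'I_n -> 'I_(M + N)}.

Definition mpar n (w : mindex n) : nat := (\sum_(p < n) par (w p))%N.

Definition mtail n (w : mindex n.+1) : mindex n := [ffun p => w (lift ord0 p)].

Section OverRing.

Variable K : comNzRingType.

(* The n-th tensor power of V over K, by coordinates in the basis              *)
(* v_{w 0} (x) ... (x) v_{w (n-1)}.                                            *)
Definition tpow (n : nat) := {ffun mindex n -> K^o}.

Definition tbase n (w : mindex n) : tpow n := [ffun u => (u == w)%:R].

(* v_{f 0} (x) ... (x) v_{f (n-1)} for a sequence f of (0-based) indices; used *)
(* only when all the f p are smaller than M + N.                               *)
Definition tvec n (f : 'I_n -> nat) : tpow n :=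
  [ffun w : mindex n => [forall p, w p == f p :> nat]%:R].

Definition tprod m n (x : tpow m) (y : tpow n) : tpow (m + n) :=
  [ffun w : mindex (m + n) =>
    x [ffun p => w (lshift n p)] * y [ffun p => w (rshift m p)]].

Definition opfun n (k : mindex n -> mindex n -> K) (x : tpow n) : tpow n :=
  [ffun u => \sum_(w : mindex n) k u w * x w].

Definition opker n (k : mindex n -> mindex n -> K) : 'End(tpow n) :=
  linfun (opfun k).

Lemma opkerE n (k : mindex n -> mindex n -> K) x u :
  opker k x u = \sum_(w : mindex n) k u w * x w.
Proof.
have lin_k : linear (opfun k).
  move=> a y z; apply/ffunP => v; rewrite !ffunE /= scaler_sumr -big_split /=.
  apply: eq_bigr => w _; rewrite !ffunE /= mulrDr; congr (_ + _).
  by rewrite /GRing.scale /= mulrCA.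
pose f := GRing.isLinear.Build _ _ _ _ (opfun k) lin_k.
pose F : {linear tpow n -> tpow n} := HB.pack (opfun k) f.
by rewrite /opker -[opfun k]/(F : _ -> _) lfunE /= ffunE.
Qed.

(* The operator x (x) B on V (x) V^{(x) n}.  The sign is the Koszul rule       *)
(* (x (x) B)(v (x) v') = (-1)^{|B||v|} x v (x) B v'; the component of B from   *)
(* the line of v_{w'} to the line of v_{u'} has parity |u'| + |w'|, so the     *)
(* formula is also valid for inhomogeneous B.                                  *)
Definition tcons n (x : 'M[K]_(M + N)) (B : 'End(tpow n)) : 'End(tpow n.+1) :=
  opker (fun u w =>
    (-1) ^+ ((mpar (mtail u) + mpar (mtail w)) * par (w ord0))
    * x (u ord0) (w ord0) * B (tbase (mtail w)) (mtail u)).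

(* x 0 (x) x 1 (x) ... (x) x (n - 1) *)
Fixpoint tensop (n : nat) (x : nat -> 'M[K]_(M + N)) : 'End(tpow n) :=
  if n is n'.+1 then tcons (x 0%N) (tensop n' (fun p => x p.+1)) else \1%VF.

(* E_{ab} in the r-th and E_{cd} in the r'-th tensor factor, r < r' *)
Definition EE n (r r' : nat) (a b c d : 'I_(M + N)) : 'End(tpow n) :=
  tensop n (fun p => if p.+1 == r then delta_mx a b
                     else if p.+1 == r' then delta_mx c d else 1%:M).

End OverRing.

Section Module.

Variables (F : fieldType) (q : F).

Definition qi (i : 'I_(M + N)) : F := if (M <= i)%N then q^-1 else q.

Inductive Uq_sort := Uq_s | Uq_t.

(* The action of s_{ij} and t_{ij} on V; the s_{ij} with i > j and the t_{ij}  *)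
(* with i < j vanish.                                                          *)
Definition Uq_vec (g : Uq_sort) (i j : 'I_(M + N)) : 'M[F]_(M + N) :=
  match g with
  | Uq_s =>
      if i == j then qi i *: delta_mx i i + \sum_(l | l != i) delta_mx l l
      else if (i < j)%N then (qi i - (qi i)^-1) *: delta_mx i j else 0
  | Uq_t =>
      if i == j then (qi i)^-1 *: delta_mx i i + \sum_(l | l != i) delta_mx l l
      else if (j < i)%N then - (qi j - (qi j)^-1) *: delta_mx i j else 0
  end.

(* The action of s_{ij} and t_{ij} on V^{(x) n}, through the iterated          *)
(* coproduct; V^{(x) 0} is the trivial module (counit).                        *)
Fixpoint Uq_act (n : nat) (g : Uq_sort) (i j : 'I_(M + N)) : 'End(tpow F n) :=
  if n is n'.+1 then
    \sum_(k < M + N) (-1) ^+ ((par i + par k) * (par k + par j))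
      *: tcons (Uq_vec g i k) (Uq_act n' g k j)
  else (i == j)%:R *: \1%VF.

Definition is_submodule n (U : {vspace tpow F n}) : Prop :=
  forall g i j, (Uq_act n g i j @: U <= U)%VS.

Definition Uq_step n (U : {vspace tpow F n}) : {vspace tpow F n} :=
  (U + \sum_(k : 'I_(M + N) * 'I_(M + N))
         (Uq_act n Uq_s k.1 k.2 @: U + Uq_act n Uq_t k.1 k.2 @: U))%VS.

(* The submodule generated by v: the span of the words of length at most       *)
(* dim V^{(x) n} in the generators, applied to v.  The three lemmas below say  *)
(* that it is the smallest submodule containing v.                             *)
Definition generated n (v : tpow F n) : {vspace tpow F n} :=
  iter (\dim {:tpow F n}) (@Uq_step n) <[v]>%VS.

Lemma Uq_step_sub n (U : {vspace tpow F n}) : (U <= Uq_step U)%VS.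
Proof. exact: addvSl. Qed.

Lemma generated_mem n (v : tpow F n) : v \in generated v.
Proof.
rewrite /generated; elim: (\dim _) => [|m IHm]; first exact: memv_line.
exact: subvP (Uq_step_sub _) _ IHm.
Qed.

Lemma generated_sub n (v : tpow F n) (U : {vspace tpow F n}) :
  is_submodule U -> v \in U -> (generated v <= U)%VS.
Proof.
move=> stU vU; rewrite /generated; elim: (\dim _) => [|m IHm] //=.
rewrite subv_add IHm /=; apply/subv_sumP => k _.
by rewrite subv_add; apply/andP; split;
  apply: subv_trans (limgS _ IHm) (stU _ _ _).
Qed.

Lemma generated_submodule n (v : tpow F n) : is_submodule (generated v).
Proof.
set U := fun m => iter m (@Uq_step n) <[v]>%VS.
have fixU m : Uq_step (U m) = U m \/ (m <= \dim (U m))%N.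
  elim: m => [|m [IHm|IHm]]; [by right | by left; rewrite /= IHm |].
  have [eqU|neqU] := eqVneq (\dim (U m)) (\dim (U m.+1)).
    left; rewrite /= ; suff <- : U m = Uq_step (U m).
      by apply/esym/eqP; rewrite eqEdim Uq_step_sub /= eqU.
    by apply/eqP; rewrite eqEdim Uq_step_sub /= eqU.
  right; apply: leq_ltn_trans IHm _.
  by rewrite ltn_neqAle neqU dimvS // Uq_step_sub.
have fixd : Uq_step (generated v) = generated v.
  have [//|led] := fixU (\dim {:tpow F n}).
  have -> : generated v = fullv.
    by apply/eqP; rewrite eqEdim subvf.
  by apply/eqP; rewrite eqEsubv subvf Uq_step_sub.
move=> g i j; rewrite -{2}fixd /Uq_step.
apply: subv_trans (addvSr _ _).
apply: subv_trans (@sumv_sup _ _ _ (i, j) _ _ _ isT (subvv _)).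
by case: g; [apply: addvSl | apply: addvSr].
Qed.

Definition vlow (s : nat) : tpow F s := tvec F (fun _ => (M + N).-1).

Definition Vplus (s : nat) : {vspace tpow F s} := generated (vlow s).

(* Length of a permutation = number of inversions *)
Definition plength s (g : 'S_s) : nat :=
  #|[set ij : 'I_s * 'I_s | (ij.1 < ij.2)%N && (g ij.2 < g ij.1)%N]|.

Definition vhigh (s : nat) : tpow F s :=
  \sum_(g : 'S_s) (- q) ^+ plength g *: tvec F (fun p => g p : nat).

Definition tensv m n (U : {vspace tpow F m}) (W : {vspace tpow F n}) :
    {vspace tpow F (m + n)} :=
  <<[seq tprod x y | x <- vbasis U, y <- vbasis W]>>%VS.

Definition Vplus2 (s t : nat) := tensv (Vplus s) (Vplus t).

Definition pa : {mpoly F[2]} := 'X_ord0.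
Definition pb : {mpoly F[2]} := 'X_ord_max.

(* R(z, w) acting on the r-th and r'-th factors of V^{(x) n}, r < r' *)
Definition Rop n (r r' : nat) (z w : {mpoly F[2]}) :
    'End(tpow {mpoly F[2]} n) :=
  \sum_(i < M + N) (qi i *: z - (qi i)^-1 *: w) *: EE _ n r r' i i i i
  + (z - w) *: (\sum_(i < M + N) \sum_(j < M + N | i != j)
      EE _ n r r' i i j j)
  + z *: (\sum_(i < M + N) \sum_(j < M + N | (i < j)%N)
      (qi i - (qi i)^-1)%:MP *: EE _ n r r' j i i j)
  + w *: (\sum_(i < M + N) \sum_(j < M + N | (i < j)%N)
      (qi j - (qi j)^-1)%:MP *: EE _ n r r' i j j i).

Definition Rfactor (s t j : nat) : 'End(tpow {mpoly F[2]} (s + t)) :=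
  \big[@comp_lfun _ _ _ _ / \1%VF]_(1 <= i < s.+1)
    Rop (s + t) i (s + j) (q ^- (2 * i) *: pa) (q ^- (2 * j) *: pb).

(* F_t \o ... \o F_1 *)
Definition Rst (s t : nat) : 'End(tpow {mpoly F[2]} (s + t)) :=
  \big[@comp_lfun _ _ _ _ / \1%VF]_(j <- rev (iota 1 t)) Rfactor s t j.

Definition tpoly n (x : tpow F n) : tpow {mpoly F[2]} n :=
  [ffun w => (x w)%:MP].

(* X^{-1} A restricted to W, a W-valued rational function of (a, b) for each   *)
(* vector of W, by coordinates in the tensor power containing W.               *)
Definition restr_div n (W : {vspace tpow F n}) (X : {mpoly F[2]})
    (A : 'End(tpow {mpoly F[2]} n)) (x : subvs_of W) (w : mindex n) :
    {fraction {mpoly F[2]}} :=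
  (tofrac X)^-1 * tofrac (A (tpoly (vsval x)) w : {mpoly F[2]}).

(* f is an End(W)-valued polynomial: sum of X^m B_m with B_m in End(W) *)
Definition is_op_polynomial n (W : {vspace tpow F n})
    (f : subvs_of W -> mindex n -> {fraction {mpoly F[2]}}) : Prop :=
  exists d (B : 'X_{1..2 < d} -> 'End(subvs_of W)), forall x w,
    f x w = tofrac (\sum_(m : 'X_{1..2 < d})
                      (vsval (B m x) w : F) *: 'X_[m] : {mpoly F[2]}).

Definition clears n (W : {vspace tpow F n})
    (f : subvs_of W -> mindex n -> {fraction {mpoly F[2]}})
    (D : {mpoly F[2]}) : Prop :=
  [/\ D != 0, exists d, D \is d.-homog
    & is_op_polynomial (fun x w => tofrac D * f x w)].

(* D is a denominator of f; this is invariant under multiplication of D by a   *)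
(* non-zero scalar.  msize is the total degree plus one.                       *)
Definition is_denominator n (W : {vspace tpow F n})
    (f : subvs_of W -> mindex n -> {fraction {mpoly F[2]}})
    (D : {mpoly F[2]}) : Prop :=
  clears f D /\ forall D', clears f D' -> (msize D <= msize D')%N.

End Module.

End TensorPowers.

(* Main.v *)
Require Import Defs.
From HB Require Import structures.
From mathcomp Require Import all_boot all_order all_fingroup all_algebra.
From mathcomp Require Import reals complex fraction mpoly.
From mathcomp Require Import ring zify.

(** A vector x of a tensor power is handled through its coordinates x u at the
    words u, and R(z,w) acting on two factors replaces x u by a combination of
    x u and of the coordinate at u with two letters exchanged (Rop_Rloc).

    The submodule V_n^+ consists of the q-antisymmetric tensors, those killed
    by R_{k,k+1}(q^2,1) for all k (VplusP, with qalt_ker and ker_qalt).  These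
    tensors form a submodule containing the lowest weight vector; conversely
    such a tensor is determined by its coordinates at the admissible words,
    whose weights are distinct, and raising letters one at a time leads from
    the lowest weight vector to each of these weights, the coefficients met on
    the way being q-integers.  By the Yang-Baxter equation every row
    R_{1,s+j} ... R_{s,s+j} of the fused operator preserves antisymmetry in the
    first block, every column preserves it in the second block, and rows may be
    traded for columns (Rst_rows, Rst_cols).

    R(w,w) is a multiple of the signed flip, which conjugates R_{k,c} into
    R_{k,k+1}.  Hence R_{k,c}(q^2 z,w) R_{k+1,c}(z,w), on tensors antisymmetric
    in the factors k and k+1, vanishes at z = w and is divisible by z - w
    (Rmat_fuse_l, Rmat_fuse_r).  A row is therefore divisible by s - 1 pairwise
    coprime linear forms and a column by t - 1 (chain_divides).  Using rows if
    t <= s and columns if s <= t, the fused operator on V_s^+ (x) V_t^+ is G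
    times an operator polynomial in a and b, for a product G of st - u forms.

    The scalars X and Y are each read off from one coordinate.  For Y all the
    letters are equal.  For X the eigenvalue of a row is found at a word whose
    first letter is the letter at the auxiliary factor: there only the diagonal
    terms of R contribute, all others involving a repeated even letter
    (chain_eigen).  Up to scalars X = N G and Y = D G, which gives X / Y.

    So N and D clear the denominators of R / X and R / Y.  They are minimal
    because N and D are coprime, q not being a root of unity: if D' clears
    R / X, the lowest weight vector shows that N divides D' D, hence D'; the
    highest weight vector plays the same part for D (denominators). *)

Set Implicit Arguments.
Unset Strict Implicit.
Unset Printing Implicit Defensive.

Import GRing.Theory.

Local Open Scope ring_scope.

(** * Three letters: the local form of the R-matrix *)

Section Local.

Variables (M N : nat) (K : comNzRingType) (Q : K).
Local Notation I := 'I_(M + N).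

Definition is_odd (i : I) : bool := (M <= i)%N.

Definition bsign (b : bool) : K := (-1) ^+ b.

(** The coordinate of q R(z,w) x at a word with letters i and j at the two
    factors, where X and Y are the coordinates of x at this word and at the
    word with i and j exchanged, and b is the parity of the letters between.
    The factor q leaves only polynomials in Q, so that identities between such
    operators hold in every commutative ring. *)
Definition Rloc (z w : K) (b : bool) (i j : I) (X Y : K) : K :=
  if i == j then (if is_odd i then z - Q ^+ 2 * w else Q ^+ 2 * z - w) * X
  else Q * (z - w) * X
       + (Q ^+ 2 - 1) * (if (j < i)%N then z else w)
         * bsign ((is_odd i && is_odd j) (+) ((is_odd i (+) is_odd j) && b)) * Y.

(** In the operators on two of three factors, b12 and b23 are the parities of
    the letters strictly between consecutive factors; an exchange of the outer
    letters also crosses the middle one. *)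
Definition Rloc12 z w b12 (f : I -> I -> I -> K) i j k :=
  Rloc z w b12 i j (f i j k) (f j i k).
Definition Rloc13 z w b12 b23 (f : I -> I -> I -> K) i j k :=
  Rloc z w (b12 (+) is_odd j (+) b23) i k (f i j k) (f k j i).
Definition Rloc23 z w b23 (f : I -> I -> I -> K) i j k :=
  Rloc z w b23 j k (f i j k) (f i k j).

Lemma Rloc_eq z w b i X Y :
  Rloc z w b i i X Y = (if is_odd i then z - Q ^+ 2 * w else Q ^+ 2 * z - w) * X.
Proof. by rewrite /Rloc eqxx. Qed.

Lemma Rloc_lt z w b (i j : I) X Y : (i < j)%N ->
  Rloc z w b i j X Y = Q * (z - w) * X
       + (Q ^+ 2 - 1) * w * bsign ((is_odd i && is_odd j) (+) ((is_odd i (+) is_odd j) && b)) * Y.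
Proof. by move=> h; rewrite /Rloc ltnNge (ltnW h) /= -val_eqE /= (ltn_eqF h). Qed.

Lemma Rloc_gt z w b (i j : I) X Y : (j < i)%N ->
  Rloc z w b i j X Y = Q * (z - w) * X
       + (Q ^+ 2 - 1) * z * bsign ((is_odd i && is_odd j) (+) ((is_odd i (+) is_odd j) && b)) * Y.
Proof. by move=> h; rewrite /Rloc h /= -val_eqE /= (gtn_eqF h). Qed.

Lemma bsign_addb a b : bsign (a (+) b) = bsign a * bsign b.
Proof. by rewrite /bsign signr_addb. Qed.

Lemma bsignK b : bsign b * bsign b = 1.
Proof. by rewrite /bsign -signr_addb addbb. Qed.

Lemma bsign0 : bsign false = 1. Proof. by []. Qed.
Lemma bsign1 : bsign true = -1. Proof. by []. Qed.

Ltac locsimp :=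
  rewrite ?Rloc_eq;
  repeat match goal with
  | h : is_true (nat_of_ord ?i < nat_of_ord ?j)%N |- context [Rloc _ _ _ ?i ?j _ _] =>
      rewrite (@Rloc_lt _ _ _ i j _ _ h)
  | h : is_true (nat_of_ord ?j < nat_of_ord ?i)%N |- context [Rloc _ _ _ ?i ?j _ _] =>
      rewrite (@Rloc_gt _ _ _ i j _ _ h)
  end.

Ltac locring b12 b23 :=
  repeat (match goal with |- context [is_odd ?a] => case: (is_odd a) => /= end);
  rewrite ?addTb ?addFb ?andbT ?andbF ?bsign_addb ?bsign0 ?bsign1;
  first [ring | case: b12; case: b23; rewrite /= ?bsign0 ?bsign1; ring].

Lemma I3_cases (P : I -> I -> I -> Prop) :
  (forall i, P i i i) ->
  (forall i j : I, i < j -> P i i j)%N -> (forall i j : I, j < i -> P i i j)%N ->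
  (forall i j : I, i < j -> P i j i)%N -> (forall i j : I, j < i -> P i j i)%N ->
  (forall i j : I, i < j -> P j i i)%N -> (forall i j : I, j < i -> P j i i)%N ->
  (forall i j k : I, (i < j -> j < k -> i < k ->
   [/\ P i j k, P i k j, P j i k, P j k i & P k i j /\ P k j i])%N) ->
  forall i j k, P i j k.
Proof.
move=> h0 h1 h2 h3 h4 h5 h6 h i j k.
case: (ltngtP i j) => [ij|ij|/val_inj ij]; case: (ltngtP j k) => [jk|jk|/val_inj jk];
 case: (ltngtP i k) => [ik|ik|/val_inj ik]; subst; auto; try (exfalso; lia).
- by case: (h i j k) => //.
- by case: (h i k j) => //.
- by case: (h k i j) => // _ _ _ ? _.
- by case: (h j i k) => // _ _ ? _.
- by case: (h j k i) => // _ _ _ _ [].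
- by case: (h k j i) => // _ _ _ _ [].
Qed.

Ltac three_letters b12 b23 :=
  apply: I3_cases => [?|? ? ?|? ? ?|? ? ?|? ? ?|? ? ?|? ? ?|? ? ? ? ? ?];
  last split; try split; locsimp; locring b12 b23.

(** Only the six rearrangements of the three letters occur, so that for each
    relative order of the letters this is a polynomial identity. *)
Lemma yang_baxter_loc z w y b12 b23 f i j k :
  Rloc12 z w b12 (Rloc13 z y b12 b23 (Rloc23 w y b23 f)) i j k =
  Rloc23 w y b23 (Rloc13 z y b12 b23 (Rloc12 z w b12 f)) i j k.
Proof. by rewrite /Rloc12 /Rloc13 /Rloc23; move: i j k; three_letters b12 b23. Qed.

(** R(w,w) is a multiple of the signed flip, and conjugation by the flip of the
    factors 2 and 3 carries R_13 to R_12. *)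
Lemma degenerate_loc1 z w b12 b23 f i j k :
  Rloc13 z w b12 b23 (Rloc23 w w b23 f) i j k =
  Rloc23 w w b23 (Rloc12 z w b12 f) i j k.
Proof. by rewrite /Rloc12 /Rloc13 /Rloc23; move: i j k; three_letters b12 b23. Qed.

Lemma degenerate_loc2 z w b12 b23 f i j k :
  Rloc13 z w b12 b23 (Rloc12 z z b12 f) i j k =
  Rloc12 z z b12 (Rloc23 z w b23 f) i j k.
Proof. by rewrite /Rloc12 /Rloc13 /Rloc23; move: i j k; three_letters b12 b23. Qed.

End Local.

(** * Tensor products of elementary operators on words *)

Section TensorOperators.

Variables (M N : nat) (K : comNzRingType).
Local Notation I := 'I_(M + N).
Local Notation word := (mindex M N).
Local Notation tpw := (tpow M N K).

Lemma parE (i : I) : par i = is_odd i :> nat. Proof. by []. Qed.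

Lemma tpow_sum n (y : tpw n) : y = \sum_(w : word n) y w *: tbase K w.
Proof.
apply/ffunP => u; rewrite sum_ffunE (bigD1 u) //= big1 => [|w wu].
  by rewrite !ffunE eqxx addr0 /GRing.scale /= mulr1.
by rewrite !ffunE eq_sym (negbTE wu) /GRing.scale /= mulr0.
Qed.

(** The exponent of the Koszul sign in a matrix coefficient of a tensor product
    of operators: the component at the factor y has parity |u y| + |w y| and is
    moved past the letter w x of every earlier factor. *)
Definition ksgn n (u w : word n) : nat :=
  (\sum_(y < n) \sum_(x < n | (x < y)%N) (par (u y) + par (w y)) * par (w x))%N.

Lemma ksgn_cons n (u w : word n.+1) :
  ksgn u w = ((mpar (mtail u) + mpar (mtail w)) * par (w ord0)
              + ksgn (mtail u) (mtail w))%N.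
Proof.
rewrite /ksgn big_ord_recl big_pred0 // add0n.
rewrite /mpar -big_split big_distrl -big_split /=; apply: eq_bigr => y _.
rewrite big_mkcond big_ord_recl /= -big_mkcond /= !ffunE; congr addn.
by apply: eq_bigr => x _; rewrite !ffunE.
Qed.

Lemma tensop_base n (x : nat -> 'M[K]_(M + N)) (w u : word n) :
  tensop n x (tbase K w) u
  = (-1) ^+ ksgn u w * \prod_(y < n) x y (u y) (w y).
Proof.
elim: n => [|n IHn] in x w u *.
  rewrite /= id_lfunE ffunE /ksgn !big_ord0 mulr1.
  by rewrite (_ : u = w) ?eqxx //; apply/ffunP => -[].
rewrite [tensop _ _]/= opkerE (bigD1 w) //= big1 => [|v vw]; last first.
  by rewrite ffunE (negbTE vw) mulr0.
rewrite ffunE eqxx mulr1 addr0 IHn ksgn_cons exprD big_ord_recl /=.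
rewrite -!mulrA; congr (_ * _); rewrite mulrCA; congr (_ * (_ * _)).
by apply: eq_bigr => y _; rewrite !ffunE.
Qed.

Definition swap_at n (p p' : 'I_n) (u : word n) : word n := [ffun x => u (tperm p p' x)].

Definition between_odd n (p p' : 'I_n) (u : word n) : bool :=
  odd (\sum_(x < n | (p < x < p')%N) par (u x)).

Lemma ksgn_diag n (u : word n) : ~~ odd (ksgn u u).
Proof.
rewrite /ksgn; elim/big_ind: _ => // [a b /negPf ha /negPf hb|y _].
  by rewrite oddD ha hb.
by elim/big_ind: _ => // [a b /negPf ha /negPf hb|x _];
  rewrite ?oddD ?ha ?hb // addnn oddM odd_double.
Qed.

(** Only the components at p and p' can be odd, and they have equal parity.  The
    letters before p are passed by both, which leaves the letter standing at p
    and the letters in between. *)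
Lemma ksgn_swap n (p p' : 'I_n) (u : word n) : (p < p')%N ->
  odd (ksgn u (swap_at p p' u)) =
  (is_odd (u p) (+) is_odd (u p')) && (is_odd (u p') (+) between_odd p p' u).
Proof.
move=> lt_pp; have neq_pp : p' != p by rewrite -val_eqE /= gtn_eqF.
set w := swap_at p p' u.
have wp : w p = u p' by rewrite ffunE tpermL.
have wp' : w p' = u p by rewrite ffunE tpermR.
have wx x : x != p -> x != p' -> w x = u x.
  by move=> h h'; rewrite ffunE tpermD // eq_sym.
pose S (y : 'I_n) := (\sum_(x < n | (x < y)%N) (par (u y) + par (w y)) * par (w x))%N.
have oddS y : y != p -> y != p' -> ~~ odd (S y).
  move=> h h'; rewrite /S -big_distrr /= oddM wx // addnn odd_double //.
have -> : ksgn u w = (\sum_(y < n) S y)%N by [].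
rewrite (bigD1 p) //= (bigD1 p') //= !oddD.
have -> : odd (\sum_(y < n | (y != p) && (y != p')) S y) = false.
  apply/negbTE; elim/big_ind: _ => // [a b /negPf ha /negPf hb|y /andP[h h']].
    by rewrite oddD ha hb.
  exact: oddS.
rewrite addbF /S -!big_distrr /= !oddM !oddD !wp !wp' !parE !oddb.
rewrite [in LHS](addbC (is_odd (u p'))) -andb_addr; congr (_ && _).
rewrite [X in _ (+) odd X](bigD1 p) //=.
rewrite [X in odd (_ + X)](bigID (fun x : 'I_n => (x < p)%N)) /=.
have -> : (\sum_(i < n | (i < p')%N && (i != p) && (i < p)%N) par (w i)
  = \sum_(i < n | (i < p)%N) par (w i))%N.
  apply: eq_bigl => x; rewrite -val_eqE /=; lia.
have -> : (\sum_(i < n | (i < p')%N && (i != p) && ~~ (i < p)%N) par (w i)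
  = \sum_(x < n | (p < x < p')%N) par (u x))%N.
  apply: eq_big => [x|x]; rewrite -?val_eqE /=; first lia.
  by move=> h; rewrite wx // -val_eqE /=; lia.
rewrite wp !oddD oddb /between_odd -/(is_odd (u p')); move: (is_odd _) (odd _) (odd _) => b1 b2 b3.
by case: b1; case: b2; case: b3.
Qed.

Lemma bsign_odd (n : nat) : (-1) ^+ n = bsign K (odd n).
Proof. by rewrite /bsign signr_odd. Qed.

Lemma EE_diag n (p p' : 'I_n) (a c : I) (x : tpw n) u : (p < p')%N ->
  EE K n p.+1 p'.+1 a a c c x u = ((u p == a) && (u p' == c))%:R * x u.
Proof.
move=> lt_pp; rewrite {1}(tpow_sum x) linear_sum sum_ffunE /=.
rewrite (bigD1 u) //= big1 => [|w wu].
  rewrite linearZ /= addr0 ffunE tensop_base bsign_odd (negbTE (ksgn_diag u)).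
  rewrite bsign0 mul1r /GRing.scale /= mulrC; congr (_ * _).
  rewrite (bigD1 p) //= (bigD1 p') ?big1 /=; last by rewrite -val_eqE /= gtn_eqF.
    rewrite mulr1 !eqSS eqxx (gtn_eqF lt_pp) eqxx !mxE !andbb.
    by rewrite -natrM mulnb.
  move=> y /andP[yp yp']; rewrite !eqSS !val_eqE (negbTE yp) (negbTE yp').
  by rewrite mxE eqxx.
rewrite linearZ /= ffunE tensop_base.
have [y uwy] : exists y, u y != w y.
  apply/existsP; apply: contraNT wu; rewrite negb_exists => /forallP h.
  by apply/eqP/ffunP => y; move: (h y); rewrite negbK => /eqP.
rewrite (bigD1 y) //= !eqSS !val_eqE.
have [yp|yp] := eqVneq y p.
  rewrite mxE (_ : (_ && _) = false) ?mul0r ?mulr0 /GRing.scale /= ?mulr0 //.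
  by apply/negP => /andP[/eqP h /eqP h']; rewrite h h' eqxx in uwy.
have [yp'|yp'] := eqVneq y p'.
  rewrite mxE (_ : (_ && _) = false) ?mul0r ?mulr0 /GRing.scale /= ?mulr0 //.
  by apply/negP => /andP[/eqP h /eqP h']; rewrite h h' eqxx in uwy.
by rewrite mxE (negbTE uwy) mul0r mulr0 /GRing.scale /= mulr0.
Qed.

Lemma EE_swap n (p p' : 'I_n) (a c : I) (x : tpw n) u : (p < p')%N -> a != c ->
  EE K n p.+1 p'.+1 a c c a x u = ((u p == a) && (u p' == c))%:R *
    bsign K ((is_odd a (+) is_odd c) && (is_odd c (+) between_odd p p' u)) * x (swap_at p p' u).
Proof.
move=> lt_pp ac; rewrite {1}(tpow_sum x) linear_sum sum_ffunE /=.
have neq_pp : p' != p by rewrite -val_eqE /= gtn_eqF.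
rewrite (bigD1 (swap_at p p' u)) //= big1 => [|w wu].
  rewrite linearZ /= addr0 ffunE tensop_base bsign_odd.
  rewrite /GRing.scale /= [LHS]mulrC; congr (_ * _).
  rewrite (bigD1 p) //= (bigD1 p') ?big1 //=; last first.
    move=> y /andP[yp yp']; rewrite !eqSS !val_eqE (negbTE yp) (negbTE yp').
    by rewrite mxE ffunE tpermD ?eqxx // eq_sym.
  rewrite mulr1 !eqSS eqxx (gtn_eqF lt_pp) eqxx !mxE !ffunE tpermL tpermR.
  rewrite ksgn_swap //.
  case: (eqVneq (u p) a) => [<-|_]; case: (eqVneq (u p') c) => [<-|_] //=;
    rewrite ?mul0r ?mulr0 ?mul1r ?mulr1 //.
rewrite linearZ /= ffunE tensop_base.
have [y uwy] : exists y, swap_at p p' u y != w y.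
  apply/existsP; apply: contraNT wu; rewrite negb_exists => /forallP h.
  by apply/eqP/ffunP => y; move: (h y); rewrite negbK => /eqP.
case: (boolP ((u p == a) && (u p' == c) && (w p == c) && (w p' == a))).
  move=> /andP[/andP[/andP[/eqP h1 /eqP h2] /eqP h3] /eqP h4].
  have yp : y != p.
    by apply: contraNneq uwy => ->; rewrite ffunE tpermL h2 h3.
  have yp' : y != p'.
    by apply: contraNneq uwy => ->; rewrite ffunE tpermR h1 h4.
  rewrite (bigD1 y) //= !eqSS !val_eqE (negbTE yp) (negbTE yp') mxE.
  have tpy : tperm p p' y = y by rewrite tpermD // eq_sym.
  rewrite ffunE tpy in uwy *.
  by rewrite (negbTE uwy) mul0r mulr0 /GRing.scale /= mulr0.
move=> h; rewrite (bigD1 p) //= (bigD1 p') //= !eqSS eqxx (gtn_eqF lt_pp) eqxx.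
rewrite !mxE mulrA -natrM mulnb.
by rewrite (_ : (_ && _) = false) ?mul0r ?mulr0 /GRing.scale /= ?mulr0 //;
  apply: contraNF h => /andP[/andP[-> ->] /andP[-> ->]].
Qed.

End TensorOperators.

(** * The R-matrix on words *)

Section OperatorEval.

Variables (M N : nat) (K : comNzRingType) (n : nat).
Implicit Types (A B : 'End(tpow M N K n)) (x : tpow M N K n) (u : mindex M N n).

Lemma ffunZE (c : K) x u : (c *: x) u = c * x u.
Proof. by rewrite ffunE. Qed.

Lemma evD A B x u : (A + B) x u = A x u + B x u.
Proof. by rewrite add_lfunE ffunE. Qed.

Lemma evZ (c : K) A x u : (c *: A) x u = c * A x u.
Proof. by rewrite scale_lfunE ffunZE. Qed.

Lemma ev_sum J (r : seq J) (Pr : pred J) (A : J -> 'End(tpow M N K n)) x u :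
  (\sum_(j <- r | Pr j) A j) x u = \sum_(j <- r | Pr j) A j x u.
Proof. by rewrite sum_lfunE sum_ffunE. Qed.

Lemma ev_comb A B C D (b c d : K) x u :
  (A + b *: B + c *: C + d *: D) x u
  = A x u + b * B x u + c * C x u + d * D x u.
Proof. by rewrite !evD !evZ. Qed.

Lemma ev_sumZ J (r : seq J) (Pr : pred J) (a : J -> K) (A : J -> 'End(tpow M N K n)) x u :
  (\sum_(j <- r | Pr j) a j *: A j) x u = \sum_(j <- r | Pr j) a j * A j x u.
Proof. by rewrite ev_sum; apply: eq_bigr => j _; rewrite evZ. Qed.

Lemma ev_sum2 J (r : seq J) (Pr : J -> pred J) (A : J -> J -> 'End(tpow M N K n)) x u :
  (\sum_(j <- r) \sum_(k <- r | Pr j k) A j k) x u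
  = \sum_(j <- r) \sum_(k <- r | Pr j k) A j k x u.
Proof. by rewrite ev_sum; apply: eq_bigr => j _; rewrite ev_sum. Qed.

Lemma ev_sumZ2 J (r : seq J) (Pr : J -> pred J) (a : J -> J -> K)
    (A : J -> J -> 'End(tpow M N K n)) x u :
  (\sum_(j <- r) \sum_(k <- r | Pr j k) a j k *: A j k) x u
  = \sum_(j <- r) \sum_(k <- r | Pr j k) a j k * A j k x u.
Proof.
by rewrite ev_sum; apply: eq_bigr => j _; rewrite ev_sumZ.
Qed.

End OperatorEval.

Section RMatrix.

Variables (M N : nat) (F : fieldType) (q : F).
Hypothesis q0 : q != 0.
Local Notation I := 'I_(M + N).
Local Notation word := (mindex M N).
Local Notation P := {mpoly F[2]}.

Lemma qiE (i : I) : qi q i = if is_odd i then q^-1 else q. Proof. by []. Qed.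

Lemma Rop_sum n (p p' : 'I_n) (z w : P) (x : tpow M N P n) u : (p < p')%N ->
  Rop M N q n p.+1 p'.+1 z w x u =
  \sum_(i < M + N) (qi q i *: z - (qi q i)^-1 *: w)
      * (((u p == i) && (u p' == i))%:R * x u)
  + (z - w) * (\sum_(i < M + N) \sum_(j < M + N | i != j)
      ((u p == i) && (u p' == j))%:R * x u)
  + z * (\sum_(i < M + N) \sum_(j < M + N | (i < j)%N)
      (qi q i - (qi q i)^-1)%:MP * (((u p == j) && (u p' == i))%:R *
    bsign P ((is_odd j (+) is_odd i) && (is_odd i (+) between_odd p p' u)) * x (swap_at p p' u)))
  + w * (\sum_(i < M + N) \sum_(j < M + N | (i < j)%N)
      (qi q j - (qi q j)^-1)%:MP * (((u p == i) && (u p' == j))%:R *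
    bsign P ((is_odd i (+) is_odd j) && (is_odd j (+) between_odd p p' u)) * x (swap_at p p' u))).
Proof.
move=> lt_pp; rewrite /Rop ev_comb; congr (_ + _ * _ + _ * _ + _ * _).
- transitivity (\sum_(i < M + N) (qi q i *: z - (qi q i)^-1 *: w)
     * EE P n p.+1 p'.+1 i i i i x u); first exact: ev_sumZ.
  by apply: eq_bigr => i _; congr (_ * _); apply: EE_diag.
- transitivity (\sum_(i < M + N) \sum_(j < M + N | i != j)
     EE P n p.+1 p'.+1 i i j j x u); first exact: ev_sum2.
  by apply: eq_bigr => i _; apply: eq_bigr => j _; apply: EE_diag.
- transitivity (\sum_(i < M + N) \sum_(j < M + N | (i < j)%N)
     (qi q i - (qi q i)^-1)%:MP * EE P n p.+1 p'.+1 j i i j x u).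
    exact: ev_sumZ2.
  apply: eq_bigr => i _; apply: eq_bigr => j ij; congr (_ * _).
  by apply: EE_swap => //; rewrite -val_eqE /= gtn_eqF.
- transitivity (\sum_(i < M + N) \sum_(j < M + N | (i < j)%N)
     (qi q j - (qi q j)^-1)%:MP * EE P n p.+1 p'.+1 i j j i x u).
    exact: ev_sumZ2.
  apply: eq_bigr => i _; apply: eq_bigr => j ij; congr (_ * _).
  by apply: EE_swap => //; rewrite -val_eqE /= ltn_eqF.
Qed.

(** The sign of q_j - q_j^-1 relative to q - q^-1 combines with the Koszul sign
    of E_ij (x) E_ji into a sign that is symmetric in the two letters. *)
Lemma Rop_Rloc n (p p' : 'I_n) (z w : P) (x : tpow M N P n) u : (p < p')%N ->
  q%:MP * Rop M N q n p.+1 p'.+1 z w x u =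
  Rloc q%:MP z w (between_odd p p' u) (u p) (u p') (x u) (x (swap_at p p' u)).
Proof.
move=> lt_pp; rewrite Rop_sum //.
have del2 (C : rel I) (f : I -> I -> P) k l :
    \sum_(i < M + N) \sum_(j < M + N | C i j) ((k == i) && (l == j))%:R * f i j
    = if C k l then f k l else 0.
  rewrite (bigD1 k) //= [X in _ + X]big1 => [|i ik]; last first.
    by rewrite big1 // => j _; rewrite [k == i]eq_sym (negbTE ik) mul0r.
  rewrite addr0; case: ifP => Ckl.
    rewrite (bigD1 l) //= !eqxx mul1r big1 ?addr0 // => j /andP[_ jl].
    by rewrite [l == j]eq_sym (negbTE jl) andbF mul0r.
  rewrite big1 // => j Ckj; case: (eqVneq l j) => [lj|]; last by rewrite andbF mul0r.
  by rewrite lj Ckj in Ckl.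
have -> : \sum_(i < M + N) (qi q i *: z - (qi q i)^-1 *: w)
      * (((u p == i) && (u p' == i))%:R * x u) =
    (u p == u p')%:R * ((qi q (u p) *: z - (qi q (u p))^-1 *: w) * x u).
  rewrite (bigD1 (u p)) //= eqxx [u p' == _]eq_sym mulrCA big1 ?addr0 // => i.
  by rewrite eq_sym => /negPf->; rewrite mul0r mulr0.
rewrite (del2 _ (fun _ _ => x u)).
under [X in _ + z * X]eq_bigr => i _ do
  under eq_bigr => j _ do rewrite andbC -mulrA mulrCA.
rewrite (del2 (fun i j => (i < j)%N) (fun i j => (qi q i - (qi q i)^-1)%:MP *
   (bsign P ((is_odd j (+) is_odd i) && (is_odd i (+) between_odd p p' u)) * x (swap_at p p' u)))).
under [X in _ + w * X]eq_bigr => i _ do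
  under eq_bigr => j _ do rewrite -mulrA mulrCA.
rewrite (del2 (fun i j => (i < j)%N) (fun i j => (qi q j - (qi q j)^-1)%:MP *
   (bsign P ((is_odd i (+) is_odd j) && (is_odd j (+) between_odd p p' u)) * x (swap_at p p' u)))).
rewrite /= !qiE; move: (between_odd p p' u) (x u) (x (swap_at p p' u)) (u p) (u p').
move=> b X Y i j.
have qq : q%:MP * (q^-1)%:MP = 1 :> P by rewrite -mpolyCM mulfV.
rewrite -!mul_mpolyC !mpolyCB.
have [Qv Qv1] : {Qv : P | q%:MP * Qv = 1 /\ Qv = (q^-1)%:MP} by exists (q^-1)%:MP.
move: Qv1 => [Qv1 QvE].
case: (ltngtP i j) => [ij|ij|/val_inj <-].
- rewrite Rloc_lt // -[X in _ ^+ 2 - X]Qv1 -val_eqE /= (ltn_eqF ij) /=.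
  case: (is_odd i); case: (is_odd j); rewrite ?invrK -?QvE /= ?addbF ?addbT ?bsign0 ?bsign1;
    move: b => [] /=; rewrite ?bsign0 ?bsign1; ring.
- rewrite Rloc_gt // -[X in _ ^+ 2 - X]Qv1 -val_eqE /= (gtn_eqF ij) /=.
  case: (is_odd i); case: (is_odd j); rewrite ?invrK -?QvE /= ?addbF ?addbT ?bsign0 ?bsign1;
    move: b => [] /=; rewrite ?bsign0 ?bsign1; ring.
rewrite Rloc_eq eqxx /=; case: (is_odd i); rewrite ?invrK -?QvE.
  transitivity ((q%:MP * Qv * z - q%:MP ^+ 2 * w) * X); first by ring.
  by rewrite Qv1 mul1r.
transitivity ((q%:MP ^+ 2 * z - q%:MP * Qv * w) * X); first by ring.
by rewrite Qv1 mul1r.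
Qed.

End RMatrix.

(** * Yang-Baxter equation, degeneration and commutation *)

Section LocalOperators.

Variables (M N : nat) (K : comNzRingType) (Q : K) (n : nat).
Local Notation I := 'I_(M + N).
Local Notation word := (mindex M N n).
Local Notation tpw := (tpow M N K n).
Implicit Types (u : word) (x : tpw) (p : 'I_n) (z w : K).

Definition Rmat p p' z w x : tpw :=
  [ffun u => Rloc Q z w (between_odd p p' u) (u p) (u p') (x u) (x (swap_at p p' u))].

Lemma RlocZ (c z w : K) b (i j : I) X Y :
  Rloc Q z w b i j (c * X) (c * Y) = c * Rloc Q z w b i j X Y.
Proof. by rewrite /Rloc; case: ifP => _; [case: ifP => _|]; ring. Qed.

Lemma RlocD (z w : K) b (i j : I) X Y X' Y' :
  Rloc Q z w b i j (X + X') (Y + Y') = Rloc Q z w b i j X Y + Rloc Q z w b i j X' Y'.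
Proof. by rewrite /Rloc; case: ifP => _; [case: ifP => _|]; ring. Qed.

Lemma RmatZ p p' z w c x : Rmat p p' z w (c *: x) = c *: Rmat p p' z w x.
Proof. by apply/ffunP => u; rewrite ffunE !ffunZE RlocZ ffunE. Qed.

Lemma RmatD p p' z w x (y : tpw) : Rmat p p' z w (x + y) = Rmat p p' z w x + Rmat p p' z w y.
Proof. by apply/ffunP => u; rewrite !ffunE RlocD. Qed.

Lemma Rmat0 p p' z w : Rmat p p' z w 0 = 0.
Proof. by rewrite -[0 in LHS](scale0r 0) RmatZ scale0r. Qed.

Lemma swap_atK p p' u : swap_at p p' (swap_at p p' u) = u.
Proof. by apply/ffunP => y; rewrite !ffunE tpermK. Qed.

Lemma swap_at_l p p' u : swap_at p p' u p = u p'. Proof. by rewrite ffunE tpermL. Qed.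
Lemma swap_at_r p p' u : swap_at p p' u p' = u p. Proof. by rewrite ffunE tpermR. Qed.
Lemma swap_at_x p p' u r : r != p -> r != p' -> swap_at p p' u r = u r.
Proof. by move=> h h'; rewrite ffunE tpermD // eq_sym. Qed.

Lemma swap_at_id p p' u : u p = u p' -> swap_at p p' u = u.
Proof.
move=> e; apply/ffunP => y.
have [->|yp] := eqVneq y p; first by rewrite swap_at_l.
by have [->|yp'] := eqVneq y p'; [rewrite swap_at_r | rewrite swap_at_x].
Qed.

Section ThreePositions.

Variables (p1 p2 p3 : 'I_n).
Hypotheses (h12 : (p1 < p2)%N) (h23 : (p2 < p3)%N).

Definition set3 u (i j k : I) : word :=
  [ffun y => if y == p1 then i else if y == p2 then j else if y == p3 then k
             else u y].

Let n21 : (p2 == p1) = false. Proof. by rewrite -val_eqE /= gtn_eqF. Qed.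
Let n32 : (p3 == p2) = false. Proof. by rewrite -val_eqE /= gtn_eqF. Qed.
Let n31 : (p3 == p1) = false.
Proof. by rewrite -val_eqE /= gtn_eqF // (ltn_trans h12). Qed.

Lemma set3_1 u i j k : set3 u i j k p1 = i. Proof. by rewrite ffunE eqxx. Qed.
Lemma set3_2 u i j k : set3 u i j k p2 = j.
Proof. by rewrite ffunE n21 eqxx. Qed.
Lemma set3_3 u i j k : set3 u i j k p3 = k.
Proof. by rewrite ffunE n31 n32 eqxx. Qed.

Lemma set3_id u : set3 u (u p1) (u p2) (u p3) = u.
Proof.
apply/ffunP => y; rewrite ffunE; case: (eqVneq y p1) => [->//|_].
by case: (eqVneq y p2) => [->//|_]; case: (eqVneq y p3) => [->|].
Qed.

Lemma set3_x u i j k (y : 'I_n) : y != p1 -> y != p2 -> y != p3 -> set3 u i j k y = u y.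
Proof. by rewrite ffunE => /negPf-> /negPf-> /negPf->. Qed.

Lemma word_ext3 (v w : word) : v p1 = w p1 -> v p2 = w p2 -> v p3 = w p3 ->
  (forall y, y != p1 -> y != p2 -> y != p3 -> v y = w y) -> v = w.
Proof.
move=> e1 e2 e3 e; apply/ffunP => y.
have [->//|y1] := eqVneq y p1; have [->//|y2] := eqVneq y p2.
by have [->//|y3] := eqVneq y p3; apply: e.
Qed.

Let m12 : p1 != p2. Proof. by rewrite eq_sym n21. Qed.
Let m21 : p2 != p1. Proof. by rewrite n21. Qed.
Let m13 : p1 != p3. Proof. by rewrite eq_sym n31. Qed.
Let m31 : p3 != p1. Proof. by rewrite n31. Qed.
Let m23 : p2 != p3. Proof. by rewrite eq_sym n32. Qed.
Let m32 : p3 != p2. Proof. by rewrite n32. Qed.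

Lemma swap12_set3 u i j k : swap_at p1 p2 (set3 u i j k) = set3 u j i k.
Proof.
apply: word_ext3 => [|||y y1 y2 y3];
  by rewrite ?swap_at_l ?swap_at_r ?swap_at_x ?set3_1 ?set3_2 ?set3_3 ?set3_x.
Qed.
Lemma swap13_set3 u i j k : swap_at p1 p3 (set3 u i j k) = set3 u k j i.
Proof.
apply: word_ext3 => [|||y y1 y2 y3];
  by rewrite ?swap_at_l ?swap_at_r ?swap_at_x ?set3_1 ?set3_2 ?set3_3 ?set3_x.
Qed.
Lemma swap23_set3 u i j k : swap_at p2 p3 (set3 u i j k) = set3 u i k j.
Proof.
apply: word_ext3 => [|||y y1 y2 y3];
  by rewrite ?swap_at_l ?swap_at_r ?swap_at_x ?set3_1 ?set3_2 ?set3_3 ?set3_x.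
Qed.

Lemma between12_set3 u i j k : between_odd p1 p2 (set3 u i j k) = between_odd p1 p2 u.
Proof.
congr odd; apply: eq_bigr => y h; rewrite ffunE.
by rewrite -!val_eqE /= !ifF //; lia.
Qed.
Lemma between23_set3 u i j k : between_odd p2 p3 (set3 u i j k) = between_odd p2 p3 u.
Proof.
congr odd; apply: eq_bigr => y h; rewrite ffunE.
by rewrite -!val_eqE /= !ifF //; lia.
Qed.
Lemma between13_set3 u i j k :
  between_odd p1 p3 (set3 u i j k) = between_odd p1 p2 u (+) is_odd j (+) between_odd p2 p3 u.
Proof.
rewrite -(between12_set3 u i j k) -(between23_set3 u i j k) /between_odd.
set v := set3 u i j k.
rewrite (bigD1 p2) ?h12 //= (bigID (fun y : 'I_n => (y < p2)%N)) /= !oddD.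
rewrite /v set3_2 -/v parE oddb addbCA addbA; congr (odd _ (+) _ (+) odd _);
  by apply: eq_bigl => y; rewrite -val_eqE /=; lia.
Qed.

Section Transport.
Variables (u : word) (x : tpw).
Let f i j k := x (set3 u i j k).

Lemma Rmat12_set3 z w i j k :
  Rmat p1 p2 z w x (set3 u i j k) = Rloc12 Q z w (between_odd p1 p2 u) f i j k.
Proof. by rewrite ffunE between12_set3 swap12_set3 set3_1 set3_2. Qed.
Lemma Rmat13_set3 z w i j k :
  Rmat p1 p3 z w x (set3 u i j k)
  = Rloc13 Q z w (between_odd p1 p2 u) (between_odd p2 p3 u) f i j k.
Proof. by rewrite ffunE between13_set3 swap13_set3 set3_1 set3_3. Qed.
Lemma Rmat23_set3 z w i j k :
  Rmat p2 p3 z w x (set3 u i j k) = Rloc23 Q z w (between_odd p2 p3 u) f i j k.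
Proof. by rewrite ffunE between23_set3 swap23_set3 set3_2 set3_3. Qed.
End Transport.

Lemma yang_baxter z w y x :
  Rmat p1 p2 z w (Rmat p1 p3 z y (Rmat p2 p3 w y x)) =
  Rmat p2 p3 w y (Rmat p1 p3 z y (Rmat p1 p2 z w x)).
Proof.
apply/ffunP => u; rewrite -(set3_id u); move: (u p1) (u p2) (u p3) => i j k.
have := yang_baxter_loc Q z w y (between_odd p1 p2 u) (between_odd p2 p3 u)
          (fun i j k => x (set3 u i j k)) i j k.
rewrite Rmat12_set3 Rmat23_set3 /Rloc12 /Rloc13 /Rloc23.
by rewrite !Rmat13_set3 /Rloc13 !Rmat12_set3 !Rmat23_set3.
Qed.

Lemma degenerate1 z w x :
  Rmat p1 p3 z w (Rmat p2 p3 w w x) = Rmat p2 p3 w w (Rmat p1 p2 z w x).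
Proof.
apply/ffunP => u; rewrite -(set3_id u); move: (u p1) (u p2) (u p3) => i j k.
have := degenerate_loc1 Q z w (between_odd p1 p2 u) (between_odd p2 p3 u)
          (fun i j k => x (set3 u i j k)) i j k.
rewrite Rmat13_set3 Rmat23_set3 /Rloc12 /Rloc13 /Rloc23.
by rewrite !Rmat12_set3 !Rmat23_set3.
Qed.

Lemma degenerate2 z w x :
  Rmat p1 p3 z w (Rmat p1 p2 z z x) = Rmat p1 p2 z z (Rmat p2 p3 z w x).
Proof.
apply/ffunP => u; rewrite -(set3_id u); move: (u p1) (u p2) (u p3) => i j k.
have := degenerate_loc2 Q z w (between_odd p1 p2 u) (between_odd p2 p3 u)
          (fun i j k => x (set3 u i j k)) i j k.
rewrite Rmat13_set3 Rmat12_set3 /Rloc12 /Rloc13 /Rloc23.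
by rewrite !Rmat12_set3 !Rmat23_set3.
Qed.

End ThreePositions.

Lemma odd_ord_sum (P1 P2 : pred 'I_n) (g : 'I_n -> nat) :
  odd (\sum_(y | P1 y) g y) (+) odd (\sum_(y | P2 y) g y)
  = odd (\sum_(y | P1 y (+) P2 y) g y).
Proof.
rewrite (big_mkcond P1) (big_mkcond P2) [in RHS]big_mkcond /= -oddD -big_split /=.
elim/big_rec2: _ => // y a b _ ab; rewrite !oddD ab -!oddD.
by case: (P1 y); case: (P2 y); rewrite //= ?addn0 // !oddD addbb.
Qed.

Lemma between_odd_swap (p p' r r' : 'I_n) u : r != r' ->
  between_odd p p' (swap_at r r' u) = between_odd p p' u (+)
    ((is_odd (u r) (+) is_odd (u r')) && ((p < r < p')%N (+) (p < r' < p')%N)).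
Proof.
move=> rr'; rewrite /between_odd.
have -> : (\sum_(y < n | (p < y < p')%N) par (swap_at r r' u y) =
   \sum_(y < n | (p < tperm r r' y < p')%N) par (u y))%N.
  rewrite [RHS](reindex_inj (@perm_inj _ (tperm r r'))) /=.
  by apply: eq_big => [y|y _]; rewrite ?tpermK // ffunE.
rewrite -(addbK (odd (\sum_(y < n | (p < y < p')%N) par (u y)))
  (odd (\sum_(y < n | (p < tperm r r' y < p')%N) par (u y)))).
rewrite [LHS]addbC; congr (_ (+) _); rewrite odd_ord_sum.
pose C (y : 'I_n) := (p < y < p')%N.
rewrite (eq_bigl (fun y => C (tperm r r' y) (+) C y)) // -/(C r) -/(C r').
have Cx y : y != r -> y != r' -> C (tperm r r' y) (+) C y = false.
  by move=> h h'; rewrite tpermD ?addbb // eq_sym.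
have [e|ne] := eqVneq (C r) (C r').
  rewrite big_pred0 ?e ?addbb ?andbF // => y.
  have [->|h] := eqVneq y r; first by rewrite tpermL e addbb.
  by have [->|h'] := eqVneq y r'; [rewrite tpermR e addbb | apply: Cx].
have Cr : C r (+) C r' by rewrite -negb_eqb ne.
rewrite (bigD1 r) /= ?tpermL 1?addbC // (bigD1 r') /=; last first.
  by rewrite tpermR Cr eq_sym.
rewrite big_pred0 => [|y]; first by rewrite addn0 oddD !parE !oddb Cr andbT addbC.
apply/negP => /andP[/andP[h1 h2] h3]; by rewrite Cx in h1.
Qed.

(** Interlacing of two pairs of positions is a symmetric relation. *)
Lemma crossing_even (p p' r r' : 'I_n) : (p < p')%N -> (r < r')%N ->
  p != r -> p != r' -> p' != r -> p' != r' ->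
  ((p < r < p')%N (+) (p < r' < p')%N) = ((r < p < r')%N (+) (r < p' < r')%N).
Proof. rewrite -!val_eqE /=; lia. Qed.

Lemma Rloc_comm z w z' w' b c e (i j k l : I) X00 X01 X10 X11 :
  Rloc Q z w b i j
    (Rloc Q z' w' c k l X00 X01)
    (Rloc Q z' w' (c (+) ((is_odd i (+) is_odd j) && e)) k l X10 X11) =
  Rloc Q z' w' c k l
    (Rloc Q z w b i j X00 X10)
    (Rloc Q z w (b (+) ((is_odd k (+) is_odd l) && e)) i j X01 X11).
Proof.
rewrite /Rloc; case: (eqVneq i j) => [->|ij]; case: (eqVneq k l) => [->|kl];
  rewrite ?addbb ?andFb ?addbF.
- by do 2 case: ifP => _; ring.
- by do 2 case: ifP => _; ring.
- by do 2 case: ifP => _; ring.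
move: (if (j < i)%N then _ else _) (if (l < k)%N then _ else _) => a a'.
rewrite !bsign_addb; case: (is_odd i); case: (is_odd j); case: (is_odd k); case: (is_odd l);
  rewrite /= ?addbF ?bsign0 ?bsign1; try ring; case: e; rewrite ?addbT ?addbF;
  case: b; case: c; rewrite /= ?bsign0 ?bsign1; ring.
Qed.

Lemma RmatE p p' z w x u : Rmat p p' z w x u =
  Rloc Q z w (between_odd p p' u) (u p) (u p') (x u) (x (swap_at p p' u)).
Proof. exact: ffunE. Qed.

(** Exchanging the letters of one pair changes the sign attached to the other
    pair only if the pairs interlace, and then both signs change alike. *)
Lemma Rmat_comm (p p' r r' : 'I_n) z w z' w' x : (p < p')%N -> (r < r')%N ->
  p != r -> p != r' -> p' != r -> p' != r' ->
  Rmat p p' z w (Rmat r r' z' w' x) = Rmat r r' z' w' (Rmat p p' z w x).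
Proof.
move=> hp hr h1 h2 h3 h4; apply/ffunP => u.
have np : p != p' by rewrite -val_eqE /= ltn_eqF.
have nr : r != r' by rewrite -val_eqE /= ltn_eqF.
have g1 : r != p by rewrite eq_sym.
have g2 : r' != p by rewrite eq_sym.
have g3 : r != p' by rewrite eq_sym.
have g4 : r' != p' by rewrite eq_sym.
have sw : swap_at r r' (swap_at p p' u) = swap_at p p' (swap_at r r' u).
  apply/ffunP => y.
  have [->|y1] := eqVneq y r; first by rewrite swap_at_l !(swap_at_x (p := p)) // swap_at_l.
  have [->|y2] := eqVneq y r'; first by rewrite swap_at_r !(swap_at_x (p := p)) // swap_at_r.
  rewrite [LHS]swap_at_x //.
  have [->|y3] := eqVneq y p; first by rewrite !swap_at_l swap_at_x.
  have [->|y4] := eqVneq y p'; first by rewrite !swap_at_r swap_at_x.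
  by rewrite !swap_at_x.
have cr := crossing_even hp hr h1 h2 h3 h4.
rewrite !RmatE -sw !between_odd_swap // !(swap_at_x (p := p)) // !(swap_at_x (p := r)) // cr.
exact: Rloc_comm.
Qed.

End LocalOperators.

(** * q-antisymmetric tensors *)

Section Antisymmetric.

Variables (M N : nat) (K : idomainType) (Q : K) (n : nat).
Local Notation I := 'I_(M + N).
Local Notation word := (mindex M N n).
Local Notation tpw := (tpow M N K n).
Implicit Types (u v : word) (x : tpw) (p : 'I_n) (z w : K).

(** The defining relations of the q-exterior power of the superspace: even
    letters anticommute and odd letters commute among themselves, up to powers
    of q. *)
Definition qalt p p' x : Prop := forall u,
  (u p = u p' -> ~~ is_odd (u p) -> x u = 0) /\
  ((u p < u p')%N -> x (swap_at p p' u) = - Q * bsign K (is_odd (u p) && is_odd (u p')) * x u).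

(** The factors concerned are those from a to b - 1. *)
Definition qalt_on (a b : nat) x : Prop :=
  forall p p', p' = p.+1 :> nat -> (a <= p)%N -> (p' < b)%N -> qalt p p' x.

Lemma qaltD p p' x (y : tpw) : qalt p p' x -> qalt p p' y -> qalt p p' (x + y).
Proof.
move=> hx hy u; have [hx1 hx2] := hx u; have [hy1 hy2] := hy u.
split=> [e o|l]; rewrite !ffunE; first by rewrite hx1 // hy1 // addr0.
by rewrite hx2 // hy2 // mulrDr.
Qed.

Lemma qaltZ p p' c x : qalt p p' x -> qalt p p' (c *: x).
Proof.
move=> hx u; have [hx1 hx2] := hx u.
split=> [e o|l]; rewrite !ffunZE; first by rewrite hx1 // mulr0.
by rewrite hx2 // mulrCA.
Qed.

Lemma qalt0 p p' : qalt p p' 0.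
Proof. by move=> u; split=> *; rewrite !ffunE // mulr0. Qed.

Lemma qaltZ_inv p p' c x : c != 0 -> qalt p p' (c *: x) -> qalt p p' x.
Proof.
move=> c0 hx u; have [hx1 hx2] := hx u; split=> [e o|l].
  by have /eqP := hx1 e o; rewrite ffunZE mulf_eq0 (negbTE c0) => /eqP.
by have := hx2 l; rewrite !ffunZE => h; apply: (mulfI c0); rewrite h mulrCA.
Qed.

Lemma bsign_neq0 b : bsign K b != 0.
Proof. by rewrite /bsign signr_eq0. Qed.

Lemma between_odd_adj p p' u : p' = p.+1 :> nat -> between_odd p p' u = false.
Proof. by move=> e; rewrite /between_odd big_pred0 // => y; rewrite e; lia. Qed.

Lemma qalt_ker p p' w x : p' = p.+1 :> nat ->
  qalt p p' x -> Rmat Q p p' (Q ^+ 2 * w) w x = 0.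
Proof.
move=> e hx; apply/ffunP => u; rewrite RmatE between_odd_adj // [RHS]ffunE.
case: (ltngtP (u p) (u p')) => [l|l|/val_inj el].
- rewrite Rloc_lt // (hx u).2 // andbF addbF.
  by case: (is_odd _ && is_odd _); rewrite ?bsign0 ?bsign1; ring.
- rewrite Rloc_gt // andbF addbF.
  have := (hx (swap_at p p' u)).2; rewrite swap_at_l swap_at_r swap_atK => /(_ l) ->.
  by rewrite [is_odd (u p) && _]andbC; case: (is_odd _ && is_odd _); rewrite ?bsign0 ?bsign1; ring.
rewrite el Rloc_eq; case: ifP => o; first by rewrite subrr mul0r.
by rewrite (hx u).1 ?mulr0 // el o.
Qed.

Lemma Rmat_affine p p' z w d x :
  Rmat Q p p' (z + d) w x = Rmat Q p p' z w x + d *: Rmat Q p p' 1 0 x.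
Proof.
apply/ffunP => u; rewrite [RHS]ffunE ffunZE !RmatE /Rloc.
by case: ifP => _; [case: ifP => _|case: ifP => _]; ring.
Qed.

(** At z = w the product equals R_{p',c}(w,w) R_{p,p'}(q^2 w,w), whose right
    factor kills x; the entries of R are affine in its arguments, so that
    z - w divides the difference. *)
Lemma Rmat_fuse_l p p' (c : 'I_n) z w x : p' = p.+1 :> nat -> (p' < c)%N ->
  qalt p p' x ->
  exists x', Rmat Q p c (Q ^+ 2 * z) w (Rmat Q p' c z w x) = (z - w) *: x'.
Proof.
move=> e hc hx.
exists (Rmat Q p c (Q ^+ 2 * w) w (Rmat Q p' c 1 0 x)
        + Q ^+ 2 *: Rmat Q p c 1 0 (Rmat Q p' c z w x)).
have -> : Q ^+ 2 * z = Q ^+ 2 * w + Q ^+ 2 * (z - w) by ring.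
rewrite Rmat_affine; have -> : Rmat Q p' c z w x = Rmat Q p' c w w x + (z - w) *: Rmat Q p' c 1 0 x.
  by rewrite -Rmat_affine addrC subrK.
rewrite !RmatD degenerate1 // ?e // qalt_ker // Rmat0 add0r !RmatZ.
by rewrite !scalerDr !scalerA [Q ^+ 2 * (z - w)]mulrC.
Qed.

Lemma Rmat_fuse_r p p' (c : 'I_n) z w x : p' = p.+1 :> nat -> (c < p)%N ->
  qalt p p' x ->
  exists x', Rmat Q c p' z w (Rmat Q c p z (Q ^+ 2 * w) x) = (z - Q ^+ 2 * w) *: x'.
Proof.
move=> e hc hx; set z0 := Q ^+ 2 * w.
exists (Rmat Q c p' z0 w (Rmat Q c p 1 0 x) + Rmat Q c p' 1 0 (Rmat Q c p z z0 x)).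
have zE : z = z0 + (z - z0) by rewrite addrC subrK.
rewrite [in LHS]zE Rmat_affine -zE.
have -> : Rmat Q c p z z0 x = Rmat Q c p z0 z0 x + (z - z0) *: Rmat Q c p 1 0 x.
  by rewrite -Rmat_affine -zE.
rewrite !RmatD degenerate2 // ?e // qalt_ker // Rmat0 add0r !RmatZ.
by rewrite !scalerDr.
Qed.

Lemma qalt_on_sub a b a' b' x : (a <= a')%N -> (b' <= b)%N ->
  qalt_on a b x -> qalt_on a' b' x.
Proof. by move=> ha hb hx p p' e hp hp'; apply: hx => //; lia. Qed.

Lemma swap_at_conj p p' (r : 'I_n) u : p != r -> p != p' -> r != p' ->
  swap_at p r (swap_at r p' (swap_at p r u)) = swap_at p p' u.
Proof.
move=> h1 h2 h3; have g1 : r != p by rewrite eq_sym.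
have g2 : p' != p by rewrite eq_sym. have g3 : p' != r by rewrite eq_sym.
apply/ffunP => y.
have [->|y1] := eqVneq y p; first by rewrite !swap_at_l swap_at_x.
have [->|y2] := eqVneq y r; first by rewrite [RHS]swap_at_x // swap_at_r swap_at_x // swap_at_l.
have [->|y3] := eqVneq y p'; first by rewrite swap_at_x // !swap_at_r.
by rewrite !swap_at_x.
Qed.

Section Vanishing.

Hypothesis Q0 : Q != 0.

Lemma qalt_swap0 p p' x u : qalt p p' x -> x u = 0 -> x (swap_at p p' u) = 0.
Proof.
move=> hx xu; case: (ltngtP (u p) (u p')) => [l|l|/val_inj e].
- by rewrite (hx u).2 // xu mulr0.
- have := (hx (swap_at p p' u)).2; rewrite swap_at_l swap_at_r swap_atK xu => /(_ l) /esym/eqP.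
  by rewrite !mulf_eq0 oppr_eq0 (negbTE Q0) (negbTE (bsign_neq0 _)) => /eqP.
by rewrite swap_at_id.
Qed.

(** A transposition within the block is a product of adjacent ones, each of
    which multiplies the coordinate by a non-zero scalar. *)
Lemma qalt_on_swap0 a b x p p' u : qalt_on a b x ->
  (a <= p)%N -> (p < p')%N -> (p' < b)%N -> x u = 0 -> x (swap_at p p' u) = 0.
Proof.
move=> hx; have [k] := ubnP (p' - p); elim: k => // k IHk in p p' u *.
move=> hk ap pp' bp' xu.
have [e|ne] := eqVneq (nat_of_ord p') p.+1.
  by apply: qalt_swap0 => //; apply: hx.
have rn : (p.+1 < n)%N by apply: leq_ltn_trans (ltn_ord p'); lia.
pose r := Ordinal rn.
rewrite -(swap_at_conj (r := r)) -?val_eqE /=; try by apply/eqP; lia.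
have qr : qalt p r x by apply: hx => //=; lia.
apply: qalt_swap0 => //; apply: IHk => //=; try lia.
exact: qalt_swap0.
Qed.

(** The second of the two equal letters is moved next to the first. *)
Lemma qalt_on_repeat a b x p p' u : qalt_on a b x ->
  (a <= p)%N -> (p < p')%N -> (p' < b)%N -> u p = u p' -> ~~ is_odd (u p) -> x u = 0.
Proof.
move=> hx ap pp' bp' e o.
have rn : (p.+1 < n)%N by apply: leq_ltn_trans (ltn_ord p'); lia.
pose r := Ordinal rn.
have [er|ne] := eqVneq r p'.
  by apply: (hx p p' _ _ _ u).1 => //; rewrite -er.
have pr : p != r by rewrite -val_eqE /=; apply/eqP; lia.
have pp : p != p' by rewrite -val_eqE /=; apply/eqP; lia.
rewrite -(swap_atK r p' u); apply: (qalt_on_swap0 hx) => //=; try by lia.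
  by move: ne; rewrite -val_eqE /= => /eqP; lia.
apply: (hx p r _ _ _ _).1 => //=; try lia.
  by rewrite swap_at_l swap_at_x.
by rewrite swap_at_x.
Qed.

End Vanishing.

Section Preservation.

Hypotheses (Q2 : Q ^+ 2 != 1) (Q4 : Q ^+ 4 != 1).

(** The entries of R_{p,p'}(q^2 w,w) have the non-zero factors q^4 - 1 at two
    equal even letters and q^2 - 1 at two different letters. *)
Lemma ker_qalt p p' w x : w != 0 -> p' = p.+1 :> nat ->
  Rmat Q p p' (Q ^+ 2 * w) w x = 0 -> qalt p p' x.
Proof.
move=> w0 e hx u; have := congr1 (fun y : tpw => y u) hx.
rewrite RmatE between_odd_adj // [RHS]ffunE; split=> [el o|l]; move: H.
  rewrite el Rloc_eq -el ifN // mulrA -exprD -[w in - w]mul1r -mulrBl => /eqP.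
  by rewrite !mulf_eq0 subr_eq0 (negbTE Q4) (negbTE w0) => /eqP.
rewrite Rloc_lt // andbF addbF => /eqP.
set S := bsign K _; have SS : S * S = 1 by apply: bsignK.
have -> : Q * (Q ^+ 2 * w - w) * x u + (Q ^+ 2 - 1) * w * S * x (swap_at p p' u)
  = ((Q ^+ 2 - 1) * w) * (Q * x u + S * x (swap_at p p' u)) by ring.
rewrite !mulf_eq0 subr_eq0 (negbTE Q2) (negbTE w0) /= => /eqP h.
transitivity (S * S * x (swap_at p p' u)); first by rewrite SS mul1r.
rewrite -mulrA [S * x _](_ : _ = - (Q * x u)); last first.
  by apply/eqP; rewrite -addr_eq0 addrC h.
by ring.
Qed.

Lemma qalt_Rmat_disjoint p p' (r r' : 'I_n) z w x : p' = p.+1 :> nat -> (r < r')%N ->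
  p != r -> p != r' -> p' != r -> p' != r' ->
  qalt p p' x -> qalt p p' (Rmat Q r r' z w x).
Proof.
move=> e hr h1 h2 h3 h4 hx; apply: (@ker_qalt _ _ 1); rewrite ?oner_neq0 //.
by rewrite Rmat_comm ?qalt_ker ?Rmat0 // e.
Qed.

(** The Yang-Baxter equation carries R_{p,p'}(q^2 z,z), which kills x, to the
    other side of the product. *)
Lemma qalt_Rmat2_l p p' (c : 'I_n) z w x : z != 0 -> p' = p.+1 :> nat -> (p' < c)%N ->
  qalt p p' x -> qalt p p' (Rmat Q p c (Q ^+ 2 * z) w (Rmat Q p' c z w x)).
Proof.
move=> z0 e hc hx; apply: (@ker_qalt _ _ z) => //.
by rewrite yang_baxter // ?e // qalt_ker ?Rmat0.
Qed.

Lemma qalt_Rmat2_r p p' (c : 'I_n) z w x : w != 0 -> p' = p.+1 :> nat -> (c < p)%N ->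
  qalt p p' x -> qalt p p' (Rmat Q c p' z w (Rmat Q c p z (Q ^+ 2 * w) x)).
Proof.
move=> w0 e hc hx; apply: (@ker_qalt _ _ w) => //.
by rewrite -yang_baxter // ?e // qalt_ker ?Rmat0.
Qed.

End Preservation.

End Antisymmetric.

(** * Ordered products of operators *)

Section Chains.

Variables (K : comNzRingType) (T : lmodType K).

Lemma scaler3CA (a b c : K) (x : T) : a *: (b *: (c *: x)) = c *: (a *: (b *: x)).
Proof. by rewrite !scalerA; congr (_ *: _); ring. Qed.

Lemma foldr_scale (A : Type) (L : A -> T -> T) (l : seq A) c x :
  (forall i y, L i (c *: y) = c *: L i y) ->
  foldr L (c *: x) l = c *: foldr L x l.
Proof. by move=> LZ; elim: l => //= i l ->. Qed.

Lemma foldr_exchange (A B : eqType) (L : A -> B -> T -> T) (la : seq A) (lb : seq B) x :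
  uniq la -> uniq lb ->
  (forall i i' j j' y, i \in la -> i' \in la -> j \in lb -> j' \in lb ->
     i != i' -> j != j' -> L i j (L i' j' y) = L i' j' (L i j y)) ->
  foldr (fun j y => foldr (fun i => L i j) y la) x lb
  = foldr (fun i y => foldr (L i) y lb) x la.
Proof.
elim: la => [|i la IHla] /= ula ulb comL.
  by elim: lb {ulb comL} => //= j lb ->.
move: ula => /andP[nila ula].
rewrite -IHla //; last first.
  by move=> i1 i2 j1 j2 y h1 h2; apply: comL; rewrite inE ?h1 ?h2 orbT.
elim: lb ulb comL {IHla} => //= j lb IHlb /andP[nj ulb] comL.
rewrite IHlb //; last first.
  move=> i1 i2 j1 j2 y hi1 hi2 h1 h2; apply: comL => //; by rewrite inE ?h1 ?h2 orbT.
congr (L i j _); set y := foldr _ x lb.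
have : {subset la <= la} by [].
elim: {1 3 4}la => [|i' l IHl] sl //=.
rewrite IHl; last by move=> a al; apply: sl; rewrite inE al orbT.
have i'la : i' \in la by apply: sl; rewrite mem_head.
set y' := foldr _ y l.
have : {subset lb <= lb} by [].
elim: {1 3 4}lb => [|j' l' IHl'] sl' //=.
have j'lb : j' \in lb by apply: sl'; rewrite mem_head.
rewrite comL ?inE ?eqxx ?i'la ?j'lb ?orbT //; first last.
- by apply: contraNneq nj => ->.
- by apply: contraNneq nila => <-.
by rewrite IHl' // => a al; apply: sl'; rewrite inE al orbT.
Qed.

(** The second hypothesis expresses that the scalars ell k are pairwise coprime
    in their action on T. *)
Lemma coprime_divides (ell : nat -> K) (r : seq nat) (y : T) : uniq r ->
  (forall k l (x x' : T), k \in r -> l \in r -> k != l ->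
     ell k *: x = ell l *: x' -> exists x'', x = ell l *: x'') ->
  (forall k, k \in r -> exists x, y = ell k *: x) ->
  exists x, y = (\prod_(k <- r) ell k) *: x.
Proof.
elim: r y => [|k r IHr] y /= ur cop div.
  by exists y; rewrite big_nil scale1r.
move: ur => /andP[kr ur].
have [x0 yx0] := div k (mem_head _ _).
have [||x x0x] := IHr x0 ur.
- by move=> k1 l1 x x' h1 h2; apply: cop; rewrite inE ?h1 ?h2 orbT.
- move=> l lr; have lkr : l \in k :: r by rewrite inE lr orbT.
  have [x' yx'] := div l lkr.
  apply: (cop k l x0 x') => //; first exact: mem_head.
    by apply: contraNneq kr => ->.
  by rewrite -yx0.
by exists x; rewrite big_cons -scalerA -x0x.
Qed.

Lemma foldr_divides (A : eqType) (O : A -> T -> T) (g : A -> K) (S : T -> Prop) (l : seq A) x :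
  (forall j c y, O j (c *: y) = c *: O j y) ->
  (forall j y, j \in l -> S y -> S (O j y)) ->
  (forall j y, j \in l -> S y -> exists y', O j y = g j *: y') ->
  (forall j y, j \in l -> S (g j *: y) -> S y) ->
  S x -> exists2 x', S x' & foldr O x l = (\prod_(j <- l) g j) *: x'.
Proof.
move=> OZ; elim: l => [|j l IHl] OS Og Sg Sx /=.
  by exists x => //; rewrite big_nil scale1r.
have [||| |y Sy ->] := IHl => //.
- by move=> j' y h; apply: OS; rewrite inE h orbT.
- by move=> j' y h; apply: Og; rewrite inE h orbT.
- by move=> j' y h; apply: Sg; rewrite inE h orbT.
have [y' yy'] := Og j y (mem_head _ _) Sy.
exists y'; last by rewrite OZ yy' big_cons scalerA mulrC.
by apply: (Sg j) (mem_head _ _) _; rewrite -yy'; apply: OS => //; apply: mem_head.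
Qed.

(** L 1, ..., L m stand for the R-matrices of a row or a column, C k for
    antisymmetry in its factors k and k + 1, and ell k for the linear form z - w
    in the arguments of the k-th R-matrix. *)
Section Fusion.

Variables (L : nat -> T -> T) (C : nat -> T -> Prop) (ell : nat -> K) (m : nat).
Hypothesis LZ : forall i c x, L i (c *: x) = c *: L i x.
Hypothesis LC : forall i k x, (0 < i <= m)%N -> (0 < k < m)%N -> i != k -> i != k.+1 ->
  C k x -> C k (L i x).
Hypothesis LCC : forall k x, (0 < k < m)%N -> C k x -> C k (L k (L k.+1 x)).
Hypothesis Lell : forall k x, (0 < k < m)%N -> C k x ->
  exists x', L k (L k.+1 x) = ell k.+1 *: x'.

Lemma chain_far (l : seq nat) k x : (0 < k < m)%N ->
  (forall i, i \in l -> [&& (0 < i <= m)%N, i != k & i != k.+1]) ->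
  C k x -> C k (foldr L x l).
Proof.
move=> hk; elim: l => //= i l IHl h Cx.
have /and3P[h1 h2 h3] := h i (mem_head _ _).
by apply: LC => //; apply: IHl => // j jl; apply: h; rewrite inE jl orbT.
Qed.

Lemma iota_split k : (0 < k < m)%N ->
  iota 1 m = iota 1 k.-1 ++ [:: k, k.+1 & iota k.+2 (m - k.+1)].
Proof.
move=> /andP[k0 km]; have {1}-> : m = (k.-1 + (m - k.+1).+2)%N by lia.
by rewrite iotaD /=; congr (_ ++ _); have -> : (1 + k.-1)%N = k by lia.
Qed.

Lemma chain_C k x : (0 < k < m)%N -> C k x -> C k (foldr L x (iota 1 m)).
Proof.
move=> hk Cx; rewrite (iota_split hk) foldr_cat /=.
apply: chain_far => // [i|]; first by rewrite mem_iota; lia.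
by apply: LCC => //; apply: chain_far => // i; rewrite mem_iota; lia.
Qed.

Lemma chain_ell k x : (0 < k < m)%N -> C k x ->
  exists x', foldr L x (iota 1 m) = ell k.+1 *: x'.
Proof.
move=> hk Cx; rewrite (iota_split hk) foldr_cat /=.
have [|x' ->] := Lell hk (x := foldr L x (iota k.+2 (m - k.+1))).
  by apply: chain_far => // i; rewrite mem_iota; lia.
by exists (foldr L x' (iota 1 k.-1)); rewrite foldr_scale.
Qed.

Lemma chain_divides x :
  (forall k l (y y' : T), (0 < k <= m)%N -> (0 < l <= m)%N -> k != l ->
     ell k *: y = ell l *: y' -> exists y'', y = ell l *: y'') ->
  (forall k, (0 < k < m)%N -> C k x) ->
  exists x', foldr L x (iota 1 m) = (\prod_(k <- iota 2 m.-1) ell k) *: x'.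
Proof.
move=> cop Cx; apply: coprime_divides; first exact: iota_uniq.
  by move=> k l y y'; rewrite !mem_iota => h1 h2; apply: cop; lia.
move=> k; rewrite mem_iota => hk; have {1}-> : k = k.-1.+1 by lia.
by apply: chain_ell; [lia|apply: Cx; lia].
Qed.

End Fusion.
End Chains.

(** The setting of Fusion, with sig k the factor met by L k besides the factor c
    common to the row or column, and al_e, al_d and be the entries of L k: equal
    letters, different letters, exchanged letters. *)
Section EigenChain.

Variables (M N : nat) (K : idomainType) (n : nat).
Local Notation word := (mindex M N n).
Local Notation tpw := (tpow M N K n).
Variables (L : nat -> tpw -> tpw) (C : nat -> tpw -> Prop) (m : nat).
Variables (sig : nat -> 'I_n) (c : 'I_n) (al_e al_d : nat -> K)
  (be : nat -> word -> K) (allowed : word -> Prop).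
Hypothesis m0 : (0 < m)%N.
Hypothesis LC : forall i k x, (0 < i <= m)%N -> (0 < k < m)%N -> i != k -> i != k.+1 ->
  C k x -> C k (L i x).
Hypothesis LCC : forall k x, (0 < k < m)%N -> C k x -> C k (L k (L k.+1 x)).
Hypothesis CB : forall k a x y, C k x -> C k y -> C k (x - a *: y).
Hypothesis sigc : forall k, (0 < k <= m)%N -> sig k != c.
Hypothesis sig1 : forall k, (1 < k <= m)%N -> sig k != sig 1.
Hypothesis LE_e : forall k x (u : word), (0 < k <= m)%N -> allowed u -> u (sig k) = u c ->
  L k x u = al_e k * x u.
Hypothesis LE_d : forall k x (u : word), (0 < k <= m)%N -> u (sig k) <> u c ->
  L k x u = al_d k * x u + be k u * x (swap_at (sig k) c u).
Hypothesis allowed_swap : forall p p' (u : word), allowed u -> allowed (swap_at p p' u).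
Hypothesis rep : forall i j g (u : word), (0 < i)%N -> (i < j <= m)%N -> allowed u ->
  (forall k, (i <= k < j)%N -> C k g) -> u (sig i) = u (sig j) -> g u = 0.
Hypothesis mv : forall g (u : word) i, (1 < i <= m)%N -> (forall k, (0 < k < m)%N -> C k g) ->
  g u = 0 -> g (swap_at (sig 1) (sig i) u) = 0.
Hypothesis pigeon : forall u : word, allowed u ->
  (exists i j, [/\ (0 < i)%N, (i < j <= m)%N & u (sig i) = u (sig j)]) \/
  (exists2 i, (0 < i <= m)%N & u (sig i) = u c).

(** Antisymmetry relates all rearrangements of a word within the block, so it is
    enough to consider words whose letter at sig 1 is the letter at c; words
    whose block does not contain that letter repeat another one.  At the former an
    exchange made by L k with k > 1 would repeat this letter at sig 1 and sig k,
    where the coordinate vanishes; only the diagonal entries remain. *)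
Lemma chain_eigen x u : (forall k, (0 < k < m)%N -> C k x) -> allowed u ->
  foldr L x (iota 1 m) u = al_e 1 * (\prod_(k <- iota 2 m.-1) al_d k) * x u.
Proof.
move=> Cx su; set f := (X in X * _).
pose y := foldr L x (iota 1 m) - f *: x.
have yE v : y v = foldr L x (iota 1 m) v - f * x v by rewrite !ffunE.
suff : y u = 0.
  by rewrite yE => /eqP; rewrite subr_eq0 => /eqP ->.
have Cy k : (0 < k < m)%N -> C k y.
  by move=> hk; apply: CB; [apply: (chain_C LC LCC) => //|]; apply: Cx.
have repy v : allowed v ->
    (exists i j, [/\ (0 < i)%N, (i < j <= m)%N & v (sig i) = v (sig j)]) -> y v = 0.
  move=> sv [i [j [hi hj e]]]; apply: (rep hi hj) => // k hk; apply: Cy; lia.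
have direct v : allowed v -> v (sig 1) = v c -> y v = 0.
  move=> sv v1; apply/eqP; rewrite yE subr_eq0; apply/eqP.
  rewrite -[m in iota 1 m](prednK m0) /= LE_e // /f -mulrA; congr (_ * _).
  suff tails b a : (1 < a)%N -> (a + b = m.+1)%N ->
      foldr L x (iota a b) v = (\prod_(k <- iota a b) al_d k) * x v.
    by apply: tails => //; lia.
  elim: b a => [|b IHb] a a2 eam /=.
    by rewrite big_nil mul1r.
  have [e|ne] := eqVneq (v (sig a)) (v c).
    have x0 : x v = 0.
      by apply: (@rep 1%N a) => //; [lia| move=> k hk; apply: Cx; lia | rewrite e].
    rewrite LE_e //; last lia.
    rewrite IHb; [|lia..]; by rewrite x0 !mulr0.
  rewrite LE_d; [|lia|exact/eqP].
  rewrite IHb; [|lia..]; rewrite big_cons -mulrA.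
  rewrite [X in be a v * X](_ : _ = 0) ?mulr0 ?addr0 //.
  apply: (@rep 1%N a) => //; first lia.
  - exact: allowed_swap.
  - move=> k hk; apply: (chain_far LC); [lia| |apply: Cx; lia].
    by move=> i; rewrite mem_iota; lia.
  by rewrite swap_at_l swap_at_x ?v1 // ?sigc ?[sig 1 == _]eq_sym ?sig1 //; lia.
have [rp|[i hi ui]] := pigeon su; first exact: repy.
have [i1|i1] := eqVneq i 1%N; first by apply: direct; rewrite // -i1.
have hi' : (1 < i <= m)%N by lia.
rewrite -(swap_atK (sig 1) (sig i) u); apply: mv => //.
apply: direct; first exact: allowed_swap.
by rewrite swap_at_l swap_at_x ?ui // [c == _]eq_sym sigc //; lia.
Qed.

End EigenChain.

(** * Linear forms in two variables *)

Section LinearForms.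

Variable F : fieldType.
Local Notation P := {mpoly F[2]}.

Lemma mpolyCXn (c : F) n : (c ^+ n)%:MP = c%:MP ^+ n :> P.
Proof. by elim: n => [|n IHn]; rewrite ?expr0 ?mpolyC1 // !exprS mpolyCM IHn. Qed.

Definition lform (al be : F) : P := al *: pa F - be *: pb F.

(** Restriction to the line a = c b. *)
Definition line (c : F) (p : P) : P :=
  p \mPo [tuple c *: pb F; pb F].

Lemma line_pa c : line c (pa F) = c *: pb F.
Proof. by rewrite /line /pa comp_mpolyXU. Qed.

Lemma line_pb c : line c (pb F) = pb F.
Proof. by rewrite /line /pb comp_mpolyXU. Qed.

Lemma lineM c p p' : line c (p * p') = line c p * line c p'.
Proof. by rewrite /line rmorphM. Qed.

Lemma line_lform c al be : line c (lform al be) = (al * c - be) *: pb F.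
Proof.
rewrite /line /lform comp_mpolyB !comp_mpolyZ -/(line c (pa F)) -/(line c (pb F)).
by rewrite line_pa line_pb scalerA scalerBl.
Qed.

Lemma pb_neq0 : pb F != 0.
Proof. by rewrite /pb -msize_poly_eq0 msizeX. Qed.

(** Replacing a by c b changes each monomial by a multiple of a - c b. *)
Lemma line_div c p : exists h, p - line c p = (pa F - c *: pb F) * h.
Proof.
pose ell := pa F - c *: pb F; pose D x := exists h, x = ell * h.
have D0 : D 0 by exists 0; rewrite mulr0.
have DD x y : D x -> D y -> D (x + y).
  by move=> [h ->] [h' ->]; exists (h + h'); rewrite mulrDr.
elim/mpolyind: p => [|a m p _ _ IHp].
  by exists 0; rewrite /line comp_mpoly0 subr0 mulr0.
rewrite -/(D _) in IHp *; have -> : a *: 'X_[m] + p - line c (a *: 'X_[m] + p)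
   = a *: ('X_[m] - line c 'X_[m]) + (p - line c p).
  by rewrite /line comp_mpolyD comp_mpolyZ scalerBr opprD addrACA.
apply: DD => //.
suff [h ->] : D ('X_[m] - line c 'X_[m]) by exists (a *: h); rewrite scalerAr.
rewrite /line comp_mpolyX mpolyXE_id !big_ord_recl !big_ord0 !mulr1 /=.
have -> : lift ord0 ord0 = ord_max :> 'I_2 by apply: val_inj.
rewrite -/(pa F) -/(pb F) -mulrBl subrXX -/ell /D -mulrA.
by eexists; reflexivity.
Qed.

Lemma lform_dvd al be p : al != 0 -> line (be / al) p = 0 ->
  exists h, p = lform al be * h.
Proof.
move=> al0 lp; have [h] := line_div (be / al) p.
rewrite lp subr0 => ->; exists (al^-1 *: h).
rewrite -scalerAr scalerAl; congr (_ * _).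
by rewrite /lform scalerBr !scalerA mulVf // scale1r mulrC.
Qed.

(** On the line where the second form vanishes the first one does not. *)
Lemma lform_coprime al be al' be' p p' : al' != 0 -> al * be' != al' * be ->
  lform al be * p = lform al' be' * p' -> exists h, p = lform al' be' * h.
Proof.
move=> al0 ne /(congr1 (line (be' / al'))); rewrite !lineM !line_lform.
rewrite [al' * _]mulrC divfK // subrr scale0r mul0r => /eqP.
rewrite mulf_eq0 => /orP[|/eqP]; last exact: lform_dvd.
rewrite -mul_mpolyC mulf_eq0 (negbTE pb_neq0) orbF mpolyC_eq0 subr_eq0 => /eqP e.
by case/eqP: ne; rewrite -e; field.
Qed.

Lemma lform_neq0 al be : al != 0 -> lform al be != 0.
Proof.
move=> al0; apply/eqP => /(congr1 (line ((be + 1) / al))); rewrite line_lform.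
rewrite /line comp_mpoly0 [al * _]mulrC divfK // addrC addKr scale1r => /eqP.
by rewrite (negbTE pb_neq0).
Qed.

Lemma lformZ c al be : c *: lform al be = lform (c * al) (c * be).
Proof. by rewrite /lform scalerBr !scalerA. Qed.

End LinearForms.

(** * Rows and columns of the fused R-matrix *)

Lemma pigeonhole_letters M N n m (sig : nat -> 'I_n) (c : 'I_n) (u : mindex M N n) :
  (forall p, (u p < m)%N) ->
  (exists i j, [/\ (0 < i)%N, (i < j <= m)%N & u (sig i) = u (sig j)]) \/
  (exists2 i, (0 < i <= m)%N & u (sig i) = u c).
Proof.
move=> um; pose g (a : 'I_m.+1) : 'I_(m) := Ordinal (um (if a == 0%N :> nat then c else sig a)).
have /injectivePn [x [y xy gxy]] : ~~ injectiveb g.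
  by apply/negP => /injectiveP /leq_card; rewrite !card_ord ltnn.
wlog lxy : x y xy gxy / (x < y)%N.
  move=> h; have : (x != y :> nat) by [].
  by rewrite neq_ltn => /orP[]; [apply: h|apply: (h y x); rewrite // eq_sym].
have y0 : (y == 0%N :> nat) = false by lia.
have le_y : (y <= m)%N by rewrite -ltnS.
have : u (if x == 0%N :> nat then c else sig x) = u (sig y).
  by apply: val_inj; have /(congr1 val) /= := gxy; rewrite y0.
case: ifP => x0 e; [right; exists (nat_of_ord y) | left; exists (nat_of_ord x), (nat_of_ord y)].
- lia.
- by [].
- split=> //; lia.
Qed.

Lemma rev_iota1 t : rev (iota 1 t) = [seq t.+1 - k | k <- iota 1 t]%N.
Proof.
apply: (@eq_from_nth _ 0%N) => [|i]; first by rewrite size_rev size_map.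
rewrite size_rev size_iota => ti.
rewrite nth_rev ?size_iota // (nth_map 0%N) ?size_iota // !nth_iota //; lia.
Qed.

Lemma foldr_rev_iota1 T (f : nat -> T -> T) x t :
  foldr f x (rev (iota 1 t)) = foldr (fun k => f (t.+1 - k)%N) x (iota 1 t).
Proof. by rewrite rev_iota1 foldr_map. Qed.

Section FusedOperator.

Variables (M N : nat) (F : fieldType) (q : F).
Hypothesis q0 : q != 0.
Hypothesis hq : forall n : nat, (0 < n)%N -> q ^+ n != 1.
Variables s t : nat.
Hypotheses (s0 : (0 < s)%N) (t0 : (0 < t)%N).

Local Notation P := {mpoly F[2]}.
Local Notation Q := (q%:MP : P).
Local Notation Qv := (q^-1%:MP : P).
Local Notation word := (mindex M N (s + t)).
Local Notation tpw := (tpow M N P (s + t)).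

Let Q0 : Q != 0. Proof. by rewrite mpolyC_eq0. Qed.
Let Qn n : (0 < n)%N -> Q ^+ n != 1.
Proof. by move=> n0; rewrite -subr_eq0 -mpolyCXn -mpolyC1 -mpolyCB mpolyC_eq0 subr_eq0 hq. Qed.
Let Q2 : Q ^+ 2 != 1. Proof. exact: Qn. Qed.
Let Q4 : Q ^+ 4 != 1. Proof. exact: Qn. Qed.
Let QvQ : Qv * Q = 1. Proof. by rewrite -mpolyCM mulVf. Qed.
(** R_{i,s+j} has the arguments za i and wb j in the fused operator. *)
Definition za i : P := q ^- (2 * i) *: pa F.
Definition wb j : P := q ^- (2 * j) *: pb F.

Let scaleS i (x : P) : q ^- (2 * i) *: x = Q ^+ 2 * (q ^- (2 * i.+1) *: x).
Proof.
rewrite -mpolyCXn mul_mpolyC scalerA mulnS exprD invfM mulrA mulfV ?mul1r //.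
by rewrite expf_neq0.
Qed.

(** Consecutive arguments have the ratio q^2 of the antisymmetry condition. *)
Lemma zaS i : za i = Q ^+ 2 * za i.+1. Proof. exact: scaleS. Qed.
Lemma wbS i : wb i = Q ^+ 2 * wb i.+1. Proof. exact: scaleS. Qed.

Lemma qX_neq0 k : q ^- k != 0. Proof. by rewrite invr_eq0 expf_neq0. Qed.

Lemma za_neq0 i : za i != 0.
Proof.
rewrite /za -mul_mpolyC mulf_neq0 ?mpolyC_eq0 ?qX_neq0 //.
by rewrite /pa -msize_poly_eq0 msizeX.
Qed.
Lemma wb_neq0 i : wb i != 0.
Proof. by rewrite /wb -mul_mpolyC mulf_neq0 ?mpolyC_eq0 ?qX_neq0 ?pb_neq0. Qed.

Lemma form_zw i j : za i - wb j = lform (q ^- (2 * i)) (q ^- (2 * j)).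
Proof. by []. Qed.

Lemma form_zw_neq0 i j : za i - wb j != 0.
Proof. by rewrite form_zw lform_neq0 // qX_neq0. Qed.

Lemma expr_inj (k l : nat) : q ^+ k = q ^+ l -> k = l.
Proof.
wlog kl : k l / (k <= l)%N.
  by move=> h e; case/orP: (leq_total k l) => kl; [|apply/esym]; apply: h.
move=> e; apply/eqP; rewrite eqn_leq kl leqNgt; apply/negP => lt.
have := hq (n := l - k); rewrite subn_gt0 => /(_ lt) /eqP; apply.
apply: (mulfI (expf_neq0 k q0)); rewrite -exprD subnKC // mulr1 -e //.
Qed.

Lemma zw_coprime i j i' j' p p' : (i + j' != i' + j)%N ->
  (za i - wb j) * p = (za i' - wb j') * p' -> exists h, p = (za i' - wb j') * h.
Proof.
move=> ne; rewrite !form_zw; apply: lform_coprime; first exact: qX_neq0.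
apply: contra ne => /eqP; rewrite -!invfM -!exprD => /invr_inj /expr_inj.
by move=> e; apply/eqP; lia.
Qed.

Lemma tpow_coprime i j i' j' (x y : tpw) : (i + j' != i' + j)%N ->
  (za i - wb j) *: x = (za i' - wb j') *: y -> exists x', x = (za i' - wb j') *: x'.
Proof.
move=> ne e.
have /fin_all_exists [h hh] u : exists h, x u = (za i' - wb j') * h.
  by apply: (zw_coprime ne (p' := y u)); rewrite -!ffunZE e.
by exists [ffun u => h u]; apply/ffunP => u; rewrite ffunZE ffunE.
Qed.

Let st0 : (0 < s + t)%N. Proof. by rewrite addn_gt0 s0. Qed.
(** Tensor factors are numbered from 1. *)
Definition pos (k : nat) : 'I_(s + t) := insubd (Ordinal st0) k.-1.

Lemma posE k : (0 < k <= s + t)%N -> pos k = k.-1 :> nat.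
Proof. by move=> h; rewrite /pos val_insubd ifT //; lia. Qed.

Definition Rij i j (x : tpw) : tpw := Rop M N q (s + t) i (s + j) (za i) (wb j) x.

Lemma RijE i j x : (0 < i <= s)%N -> (0 < j <= t)%N ->
  Rij i j x = Qv *: Rmat Q (pos i) (pos (s + j)) (za i) (wb j) x.
Proof.
move=> hi hj; have pi : pos i = i.-1 :> nat by apply: posE; lia.
have pj : pos (s + j) = (s + j).-1 :> nat by apply: posE; lia.
have ei : i = (pos i).+1 by lia.
have ej : (s + j)%N = (pos (s + j)).+1 by lia.
apply/ffunP => u; rewrite ffunZE RmatE /Rij {1}ei {1}ej -[LHS]mul1r -QvQ -mulrA.
by rewrite Rop_Rloc //; lia.
Qed.

Lemma RijZ i j c x : Rij i j (c *: x) = c *: Rij i j x.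
Proof. exact: linearZ. Qed.

Lemma big_comp_foldr n (r : seq nat) (A : nat -> 'End(tpow M N P n)) x :
  (\big[@comp_lfun _ _ _ _ / \1%VF]_(i <- r) A i) x = foldr (fun i y => A i y) x r.
Proof.
elim: r => [|i r IHr]; first by rewrite big_nil id_lfunE.
by rewrite big_cons comp_lfunE IHr.
Qed.

Definition row_op j x := foldr (fun i => Rij i j) x (iota 1 s).
Definition col_op i x := foldr (Rij i) x (rev (iota 1 t)).

Lemma Rst_rows x : Rst M N q s t x = foldr row_op x (rev (iota 1 t)).
Proof.
rewrite /Rst big_comp_foldr; elim: (rev _) => //= j r ->.
by rewrite /Rfactor big_comp_foldr /index_iota subn1.
Qed.

(** The pairs of factors are disjoint. *)
Lemma Rij_comm i i' j j' x : (0 < i <= s)%N -> (0 < i' <= s)%N ->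
  (0 < j <= t)%N -> (0 < j' <= t)%N -> i != i' -> j != j' ->
  Rij i j (Rij i' j' x) = Rij i' j' (Rij i j x).
Proof.
move=> hi hi' hj hj' ni nj.
rewrite (RijE _ hi hj) (RijE _ hi' hj') (RijE _ hi' hj') (RijE _ hi hj) !RmatZ.
apply: (congr1 (fun y => Qv *: (Qv *: y))); apply: Rmat_comm.
all: rewrite -?val_eqE /= ?posE; lia.
Qed.

(** Factors in different rows and columns commute. *)
Lemma Rst_cols x : Rst M N q s t x = foldr col_op x (iota 1 s).
Proof.
rewrite Rst_rows; apply: (foldr_exchange (L := Rij)).
- exact: iota_uniq.
- by rewrite rev_uniq iota_uniq.
move=> i i' j j' y; rewrite !mem_rev !mem_iota => h1 h2 h3 h4.
by apply: Rij_comm; lia.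
Qed.

Lemma pos_block_l (p : 'I_(s + t)) k : p.+1 = k -> p = pos k.
Proof. by move=> e; apply: val_inj; rewrite /= posE -e ?ltn_ord. Qed.

Section Row.
Variable j : nat.
Hypothesis hj : (0 < j <= t)%N.

Let C k (x : tpw) := qalt Q (pos k) (pos k.+1) x.

Lemma row_far i k x : (0 < i <= s)%N -> (0 < k < s)%N -> i != k -> i != k.+1 ->
  C k x -> C k (Rij i j x).
Proof.
move=> hi hk n1 n2 Cx; rewrite (RijE _ hi hj) /C; apply: qaltZ.
by apply: (qalt_Rmat_disjoint Q2 Q4); last exact: Cx;
  rewrite -?val_eqE /= ?posE; lia.
Qed.

Lemma row_near k x : (0 < k < s)%N -> C k x -> C k (Rij k j (Rij k.+1 j x)).
Proof.
move=> hk Cx; have [hk1 hk2] : (0 < k <= s)%N /\ (0 < k.+1 <= s)%N by lia.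
rewrite (RijE _ hk1 hj) (RijE _ hk2 hj) RmatZ zaS; do 2 apply: qaltZ.
apply: (qalt_Rmat2_l Q2 Q4); last exact: Cx.
- exact: za_neq0.
- by rewrite !posE; lia.
by rewrite !posE; lia.
Qed.

Lemma row_fuse k x : (0 < k < s)%N -> C k x ->
  exists x', Rij k j (Rij k.+1 j x) = (za k.+1 - wb j) *: x'.
Proof.
move=> hk Cx; have [hk1 hk2] : (0 < k <= s)%N /\ (0 < k.+1 <= s)%N by lia.
rewrite (RijE _ hk1 hj) (RijE _ hk2 hj) RmatZ zaS.
have e1 : pos k.+1 = (pos k).+1 :> nat by rewrite !posE; lia.
have e2 : (pos k.+1 < pos (s + j))%N by rewrite !posE; lia.
have [x' ->] := Rmat_fuse_l (za k.+1) (wb j) e1 e2 Cx.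
by exists (Qv *: (Qv *: x')); apply: scaler3CA.
Qed.

Lemma row_block x : qalt_on Q 0 s x <-> forall k, (0 < k < s)%N -> C k x.
Proof.
split=> [h k hk|h p p' e _ hp'].
  by apply: h; rewrite ?posE; lia.
rewrite (pos_block_l (erefl p.+1)) (pos_block_l (congr1 S e)).
by apply: h; lia.
Qed.

Lemma row_qalt x : qalt_on Q 0 s x -> qalt_on Q 0 s (row_op j x).
Proof.
rewrite !row_block => h k hk; apply: (chain_C row_far row_near) => //; exact: h.
Qed.

Lemma row_divides x : qalt_on Q 0 s x ->
  exists x', row_op j x = (\prod_(k <- iota 2 s.-1) (za k - wb j)) *: x'.
Proof.
rewrite row_block => Cx.
apply: (chain_divides (L := fun i => Rij i j) (C := C)) => //.
- by move=> *; apply: RijZ.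
- exact: row_far.
- exact: row_fuse.
by move=> k l y y' hk hl kl; apply: tpow_coprime; lia.
Qed.

Definition letters_below m (u : word) := forall p, (u p < m)%N.

Lemma row_eigen x u : (t <= s)%N -> (s <= M)%N -> qalt_on Q 0 s x -> letters_below s u ->
  row_op j x u = Qv * (Q ^+ 2 * za 1 - wb j)
             * (\prod_(k <- iota 2 s.-1) (za k - wb j)) * x u.
Proof.
move=> ts sM; rewrite row_block => Cx su.
apply: (@chain_eigen _ _ _ _ (fun i => Rij i j) C s pos (pos (s + j))
  (fun k => Qv * (Q ^+ 2 * za k - wb j)) (fun k => za k - wb j)
  (fun k u => Qv * ((Q ^+ 2 - 1) * (if (u (pos (s + j)) < u (pos k))%N then za k else wb j)
         * bsign P ((is_odd (u (pos k)) && is_odd (u (pos (s + j)))) (+)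
         ((is_odd (u (pos k)) (+) is_odd (u (pos (s + j))))
          && between_odd (pos k) (pos (s + j)) u))))
  (letters_below s)) => //.
- exact: row_far.
- exact: row_near.
- move=> k a y y' Cy Cy'; rewrite -scaleNr; apply: qaltD => //; exact: qaltZ.
- by move=> k hk; rewrite -val_eqE /= !posE; lia.
- by move=> k hk; rewrite -val_eqE /= !posE; lia.
- move=> k y v hk sv e; rewrite (RijE _ hk hj) ffunZE RmatE e Rloc_eq ifN ?mulrA //.
  by rewrite /is_odd -ltnNge (leq_trans (sv _)).
- move=> k y v hk ne; rewrite (RijE _ hk hj) ffunZE RmatE /Rloc ifN; last exact/eqP.
  by rewrite mulrDr !mulrA QvQ mul1r.
- by move=> p p' v sv r; rewrite ffunE.
- move=> a b g v a0 hb sv Cg e.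
  apply: (@qalt_on_repeat _ _ _ _ _ Q0 a.-1 b g (pos a) (pos b) v);
    rewrite ?posE //; try lia; last by rewrite /is_odd -ltnNge (leq_trans (sv _)).
  move=> p p' ep hp hp'; rewrite (pos_block_l (erefl p.+1)) (pos_block_l (congr1 S ep)).
  by apply: Cg; lia.
- move=> g v a ha Cg gv; apply: (qalt_on_swap0 Q0 (a := 0) (b := s)) => //.
  + by apply/row_block.
  + by rewrite !posE; lia.
  + by rewrite !posE; lia.
- by move=> v sv; apply: pigeonhole_letters.
Qed.

End Row.
(** A column is read from its last factor backwards: the k-th R-matrix involves
    the factor s + (t + 1 - k). *)
Section Column.
Variable i : nat.
Hypothesis hi : (0 < i <= s)%N.

Let C k (x : tpw) := qalt Q (pos (s + (t - k))) (pos (s + (t.+1 - k))) x.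
Let L k x := Rij i (t.+1 - k) x.

Lemma col_chain x : col_op i x = foldr L x (iota 1 t).
Proof. exact: (foldr_rev_iota1 (Rij i) x t). Qed.

Lemma col_far k' k x : (0 < k' <= t)%N -> (0 < k < t)%N -> k' != k -> k' != k.+1 ->
  C k x -> C k (L k' x).
Proof.
move=> hk' hk n1 n2 Cx; have hj : (0 < t.+1 - k' <= t)%N by lia.
rewrite /L (RijE _ hi hj) /C; apply: qaltZ.
by apply: (qalt_Rmat_disjoint Q2 Q4); last exact: Cx;
  rewrite -?val_eqE /= ?posE; lia.
Qed.

Let near_idx k : (0 < k < t)%N ->
  [/\ (0 < t - k <= t)%N, (0 < (t - k).+1 <= t)%N,
     pos (s + (t - k).+1) = (pos (s + (t - k))).+1 :> nat,
     (pos i < pos (s + (t - k)))%N & (t.+1 - k = (t - k).+1)%N].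
Proof. by move=> hk; split; rewrite ?posE; lia. Qed.

Lemma col_near k x : (0 < k < t)%N -> C k x -> C k (L k (L k.+1 x)).
Proof.
move=> hk Cx; have [h1 h2 h3 h4 h5] := near_idx hk.
move: Cx; rewrite /C /L subSS h5 => Cx.
rewrite (RijE _ hi h1) (RijE _ hi h2) RmatZ [wb (t - k)]wbS; do 2 apply: qaltZ.
have w0 := wb_neq0 (t - k).+1.
exact: (qalt_Rmat2_r Q2 Q4 (za i) w0 h3 h4 Cx).
Qed.

Lemma col_fuse k x : (0 < k < t)%N -> C k x ->
  exists x', L k (L k.+1 x) = (za i - wb (t.+1 - k.+1)) *: x'.
Proof.
move=> hk Cx; have [h1 h2 h3 h4 h5] := near_idx hk.
move: Cx; rewrite /C /L subSS h5 => Cx.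
rewrite (RijE _ hi h1) (RijE _ hi h2) RmatZ [wb (t - k)]wbS.
have [x' ->] := Rmat_fuse_r (za i) (wb (t - k).+1) h3 h4 Cx.
by exists (Qv *: (Qv *: x')); apply: scaler3CA.
Qed.

Lemma col_block x : qalt_on Q s (s + t) x <-> forall k, (0 < k < t)%N -> C k x.
Proof.
split=> [h k hk|h p p' e hp hp'].
  have [h1 h2 h3 h4 h5] := near_idx hk.
  by rewrite /C h5; apply: h => //; rewrite ?posE; lia.
rewrite (pos_block_l (erefl p.+1)) (pos_block_l (congr1 S e)).
have := h (s + t - p.+1)%N; rewrite /C.
have -> : (s + (t - (s + t - p.+1)) = p.+1)%N by lia.
have -> : (s + (t.+1 - (s + t - p.+1)) = p.+2)%N by lia.
by apply; lia.
Qed.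

Lemma col_qalt x : qalt_on Q s (s + t) x -> qalt_on Q s (s + t) (col_op i x).
Proof.
rewrite col_chain !col_block => h k hk.
by apply: (chain_C col_far col_near) => //; exact: h.
Qed.

Lemma col_divides x : qalt_on Q s (s + t) x ->
  exists x', col_op i x = (\prod_(k <- iota 2 t.-1) (za i - wb (t.+1 - k))) *: x'.
Proof.
rewrite col_block col_chain => Cx.
apply: (chain_divides (L := L) (C := C) (ell := fun k => za i - wb (t.+1 - k))) => //.
- by move=> *; apply: RijZ.
- exact: col_far.
- exact: col_fuse.
by move=> k l y y' hk hl kl; apply: tpow_coprime; lia.
Qed.

Lemma swap_atC n (p p' : 'I_n) (u : mindex M N n) : swap_at p p' u = swap_at p' p u.
Proof. by rewrite /swap_at tpermC. Qed.

Lemma col_eigen x u : (s <= t)%N -> (t <= M)%N -> qalt_on Q s (s + t) x -> letters_below t u ->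
  col_op i x u = Qv * (Q ^+ 2 * za i - wb t)
             * (\prod_(k <- iota 2 t.-1) (za i - wb (t.+1 - k))) * x u.
Proof.
move=> st tM; rewrite col_block col_chain => Cx su.
have -> : wb t = wb (t.+1 - 1) by rewrite subn1.
pose sig k := pos (s + (t.+1 - k)).
apply: (@chain_eigen _ _ _ _ L C t sig (pos i)
  (fun k => Qv * (Q ^+ 2 * za i - wb (t.+1 - k))) (fun k => za i - wb (t.+1 - k))
  (fun k u => Qv * ((Q ^+ 2 - 1) * (if (u (sig k) < u (pos i))%N then za i else wb (t.+1 - k))
         * bsign P ((is_odd (u (pos i)) && is_odd (u (sig k))) (+)
         ((is_odd (u (pos i)) (+) is_odd (u (sig k))) && between_odd (pos i) (sig k) u))))
  (letters_below t)) => //; rewrite /sig.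
- exact: col_far.
- exact: col_near.
- move=> k a y y' Cy Cy'; rewrite -scaleNr; apply: qaltD => //; exact: qaltZ.
- by move=> k hk; rewrite -val_eqE /= !posE; lia.
- by move=> k hk; rewrite -val_eqE /= !posE; lia.
- move=> k y v hk sv e; have hj : (0 < t.+1 - k <= t)%N by lia.
  rewrite /L (RijE _ hi hj) ffunZE RmatE e Rloc_eq ifN ?mulrA //.
  by rewrite /is_odd -ltnNge (leq_trans (sv _)).
- move=> k y v hk ne; have hj : (0 < t.+1 - k <= t)%N by lia.
  rewrite /L (RijE _ hi hj) ffunZE RmatE /Rloc ifN; last by apply/eqP => e; apply: ne.
  by rewrite mulrDr !mulrA QvQ mul1r [swap_at (pos i) _ _]swap_atC.
- by move=> p p' v sv r; rewrite ffunE.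
- move=> a b g v a0 hb sv Cg e.
  apply: (@qalt_on_repeat _ _ _ _ _ Q0 (s + t - b) (s + t - a).+1 g
     (pos (s + (t.+1 - b))) (pos (s + (t.+1 - a))) v);
    rewrite ?posE //; try lia; last by rewrite /is_odd -ltnNge (leq_trans (sv _)).
  move=> p p' ep hp hp'; rewrite (pos_block_l (erefl p.+1)) (pos_block_l (congr1 S ep)).
  have := Cg (s + t - p.+1)%N; rewrite /C.
  have -> : (s + (t - (s + t - p.+1)) = p.+1)%N by lia.
  have -> : (s + (t.+1 - (s + t - p.+1)) = p.+2)%N by lia.
  by apply; lia.
- move=> g v a ha Cg gv; rewrite swap_atC.
  apply: (qalt_on_swap0 Q0 (a := s) (b := s + t)) => //.
  + by apply/col_block.
  + by rewrite !posE; lia.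
  + by rewrite !posE; lia.
- by move=> v sv; apply: pigeonhole_letters.
Qed.

End Column.

Lemma Rst_qalt_l x : qalt_on Q 0 s x -> qalt_on Q 0 s (Rst M N q s t x).
Proof.
move=> Cx; rewrite Rst_rows.
have : {subset rev (iota 1 t) <= rev (iota 1 t)} by [].
elim: {1 3}(rev _) => //= j r IHr sr; apply: row_qalt.
  by have := sr j (mem_head _ _); rewrite mem_rev mem_iota; lia.
by apply: IHr => k kr; apply: sr; rewrite inE kr orbT.
Qed.

Lemma Rst_qalt_r x : qalt_on Q s (s + t) x -> qalt_on Q s (s + t) (Rst M N q s t x).
Proof.
move=> Cx; rewrite Rst_cols.
have : {subset iota 1 s <= iota 1 s} by [].
elim: {1 3}(iota _ _) => //= j r IHr sr; apply: col_qalt.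
  by have := sr j (mem_head _ _); rewrite mem_iota; lia.
by apply: IHr => k kr; apply: sr; rewrite inE kr orbT.
Qed.

End FusedOperator.

(** * Common factor and eigenvalues of the fused R-matrix *)

Section FusedOperatorProducts.

Variables (M N : nat) (F : fieldType) (q : F).
Hypothesis q0 : q != 0.
Hypothesis hq : forall n : nat, (0 < n)%N -> q ^+ n != 1.
Variables s t : nat.
Hypotheses (s0 : (0 < s)%N) (t0 : (0 < t)%N).

Local Notation P := {mpoly F[2]}.
Local Notation Q := (q%:MP : P).
Local Notation Qv := (q^-1%:MP : P).
Local Notation word := (mindex M N (s + t)).
Local Notation tpw := (tpow M N P (s + t)).
Local Notation za := (za q).
Local Notation wb := (wb q).

Lemma prod_forms_neq0 (r : seq nat) (f g : nat -> nat) :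
  \prod_(k <- r) (za (f k) - wb (g k)) != 0.
Proof.
elim/big_rec: _ => [|k x _ x0]; first exact: oner_neq0.
by rewrite mulf_neq0 // form_zw_neq0.
Qed.

Lemma qalt_on_Zinv a b (c : P) (x : tpw) : c != 0 ->
  qalt_on Q a b (c *: x) -> qalt_on Q a b x.
Proof. by move=> c0 h p p' e h1 h2; apply: (qaltZ_inv c0); apply: h. Qed.

(** Each of the t rows contributes s - 1 forms. *)
Lemma Rst_divides_l (x : tpw) : qalt_on Q 0 s x ->
  exists x', Rst M N q s t x
    = (\prod_(j <- iota 1 t) \prod_(k <- iota 2 s.-1) (za k - wb j)) *: x'.
Proof.
move=> Cx; rewrite (Rst_rows q x).
have [||||x' _ ->] := @foldr_divides P tpw nat (@row_op M N F q s t)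
  (fun j => \prod_(k <- iota 2 s.-1) (za k - wb j)) (qalt_on Q 0 s) (rev (iota 1 t)) x _ _ _ _ Cx.
- by move=> j c y; apply: foldr_scale => i z; apply: RijZ.
- move=> j y; rewrite mem_rev mem_iota => hj; apply: (row_qalt q0 hq s0 t0); lia.
- move=> j y; rewrite mem_rev mem_iota => hj; apply: (row_divides q0 hq s0 t0); lia.
- by move=> j y _; apply: qalt_on_Zinv; apply: prod_forms_neq0.
by exists x'; congr (_ *: _); apply: perm_big; rewrite perm_rev.
Qed.

(** Each of the s columns contributes t - 1 forms. *)
Lemma Rst_divides_r (x : tpw) : qalt_on Q s (s + t) x ->
  exists x', Rst M N q s t x
    = (\prod_(i <- iota 1 s) \prod_(k <- iota 2 t.-1) (za i - wb (t.+1 - k))) *: x'.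
Proof.
move=> Cx; rewrite (Rst_cols q0 hq s0 t0 x).
have [||||x' _ ->] := @foldr_divides P tpw nat (@col_op M N F q s t)
  (fun i => \prod_(k <- iota 2 t.-1) (za i - wb (t.+1 - k)))
  (qalt_on Q s (s + t)) (iota 1 s) x _ _ _ _ Cx.
- by move=> i c y; apply: foldr_scale => j z; apply: RijZ.
- move=> i y; rewrite mem_iota => hi; apply: (col_qalt q0 hq s0 t0); lia.
- move=> i y; rewrite mem_iota => hi; apply: (col_divides q0 hq s0 t0); lia.
- by move=> i y _; apply: qalt_on_Zinv; apply: prod_forms_neq0.
by exists x'.
Qed.

Lemma Rst_eigen_l (x : tpw) u : (t <= s)%N -> (s <= M)%N ->
  qalt_on Q 0 s x -> letters_below s u ->
  Rst M N q s t x u =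
  (\prod_(j <- iota 1 t) (Qv * (Q ^+ 2 * za 1 - wb j)
      * \prod_(k <- iota 2 s.-1) (za k - wb j))) * x u.
Proof.
move=> ts sM Cx su; rewrite (Rst_rows q x).
have pr : perm_eq (rev (iota 1 t)) (iota 1 t) by rewrite perm_rev.
rewrite -(perm_big _ pr) /=.
have : {subset rev (iota 1 t) <= rev (iota 1 t)} by [].
suff : forall r : seq nat, {subset r <= rev (iota 1 t)} ->
   qalt_on Q 0 s (foldr (@row_op M N F q s t) x r) /\ foldr (@row_op M N F q s t) x r u =
     (\prod_(j <- r) (Qv * (Q ^+ 2 * za 1 - wb j)
      * \prod_(k <- iota 2 s.-1) (za k - wb j))) * x u.
  by move=> h /h [].
elim=> [|j r IHr] sr; first by rewrite big_nil mul1r.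
have [|Cr rE] := IHr; first by move=> k kr; apply: sr; rewrite inE kr orbT.
have hj : (0 < j <= t)%N.
  by have := sr j (mem_head _ _); rewrite mem_rev mem_iota; lia.
split; first exact: (row_qalt q0 hq s0 t0).
rewrite [foldr _ _ _]/= (row_eigen q0 hq s0 t0 hj ts sM Cr su) rE big_cons.
by rewrite !mulrA.
Qed.

Lemma Rst_eigen_r (x : tpw) u : (s <= t)%N -> (t <= M)%N ->
  qalt_on Q s (s + t) x -> letters_below t u ->
  Rst M N q s t x u =
  (\prod_(i <- iota 1 s) (Qv * (Q ^+ 2 * za i - wb t)
      * \prod_(k <- iota 2 t.-1) (za i - wb (t.+1 - k)))) * x u.
Proof.
move=> st tM Cx su; rewrite (Rst_cols q0 hq s0 t0 x).
have : {subset iota 1 s <= iota 1 s} by [].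
suff : forall r : seq nat, {subset r <= iota 1 s} ->
   qalt_on Q s (s + t) (foldr (@col_op M N F q s t) x r) /\ foldr (@col_op M N F q s t) x r u =
     (\prod_(i <- r) (Qv * (Q ^+ 2 * za i - wb t)
      * \prod_(k <- iota 2 t.-1) (za i - wb (t.+1 - k)))) * x u.
  by move=> h /h [].
elim=> [|i r IHr] sr; first by rewrite big_nil mul1r.
have [|Cr rE] := IHr; first by move=> k kr; apply: sr; rewrite inE kr orbT.
have hi : (0 < i <= s)%N.
  by have := sr i (mem_head _ _); rewrite mem_iota; lia.
split; first exact: (col_qalt q0 hq s0 t0).
rewrite [foldr _ _ _]/= (col_eigen q0 hq s0 t0 hi st tM Cr su) rE big_cons.
by rewrite !mulrA.
Qed.

Lemma Rst_const_odd (x : tpw) (u : word) e : (forall p, u p = e) -> is_odd e ->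
  Rst M N q s t x u =
  (\prod_(j <- iota 1 t) \prod_(i <- iota 1 s) (Qv * (za i - Q ^+ 2 * wb j))) * x u.
Proof.
move=> ue off_coef; rewrite (Rst_rows q x).
have pr : perm_eq (rev (iota 1 t)) (iota 1 t) by rewrite perm_rev.
rewrite -(perm_big _ pr) /=.
have LLu i j y : (0 < i <= s)%N -> (0 < j <= t)%N ->
    @Rij M N F q s t i j y u = Qv * (za i - Q ^+ 2 * wb j) * y u.
  by move=> hi hj; rewrite (RijE q0 hq s0 t0 y hi hj) ffunZE RmatE !ue Rloc_eq off_coef mulrA.
have FFu j y : (0 < j <= t)%N ->
    @row_op M N F q s t j y u = (\prod_(i <- iota 1 s) (Qv * (za i - Q ^+ 2 * wb j))) * y u.
  move=> hj; have : {subset iota 1 s <= iota 1 s} by [].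
  rewrite /row_op; elim: {1 3 4}(iota 1 s) => [|i r IHr] sr; first by rewrite big_nil mul1r.
  rewrite [foldr _ _ _]/= LLu //; last by have := sr i (mem_head _ _); rewrite mem_iota; lia.
  rewrite IHr ?big_cons ?mulrA // => k kr; apply: sr; by rewrite inE kr orbT.
have : {subset rev (iota 1 t) <= rev (iota 1 t)} by [].
elim: {1 3 4}(rev _) => [|j r IHr] sr; first by rewrite big_nil mul1r.
rewrite [foldr _ _ _]/= FFu; last first.
  by have := sr j (mem_head _ _); rewrite mem_rev mem_iota; lia.
rewrite IHr ?big_cons ?mulrA // => k kr; apply: sr; by rewrite inE kr orbT.
Qed.

End FusedOperatorProducts.

(** * Comparison of the scalar factors *)

Section ScalarFactors.

Variables (F : fieldType) (q : F).
Hypothesis q0 : q != 0.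
Hypothesis hq : forall n : nat, (0 < n)%N -> q ^+ n != 1.

Local Notation P := {mpoly F[2]}.
Local Notation Q := (q%:MP : P).
Local Notation Qv := (q^-1%:MP : P).
Local Notation za := (za q).
Local Notation wb := (wb q).

Definition eq_upto (x y : P) := exists2 c : F, c != 0 & x = c *: y.

Lemma eq_upto_refl x : eq_upto x x.
Proof. by exists 1; rewrite ?oner_neq0 ?scale1r. Qed.

Lemma eq_upto_trans x y z : eq_upto x y -> eq_upto y z -> eq_upto x z.
Proof.
move=> [c c0 ->] [d d0 ->]; exists (c * d); first exact: mulf_neq0.
by rewrite scalerA.
Qed.

Lemma eq_uptoM x y x' y' : eq_upto x y -> eq_upto x' y' -> eq_upto (x * x') (y * y').
Proof.
move=> [c c0 ->] [d d0 ->]; exists (c * d); first exact: mulf_neq0.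
by rewrite -scalerAl -scalerAr scalerA.
Qed.

Lemma eq_upto_prod (r : seq nat) (f g : nat -> P) : (forall k, eq_upto (f k) (g k)) ->
  eq_upto (\prod_(k <- r) f k) (\prod_(k <- r) g k).
Proof.
move=> fg; elim/big_rec2: _ => [|k x y _ xy]; first exact: eq_upto_refl.
exact: eq_uptoM.
Qed.

Lemma eq_uptoC c x : c != 0 -> eq_upto (c%:MP * x) x.
Proof. by move=> c0; exists c; rewrite // mul_mpolyC. Qed.

Lemma eq_upto_lform al be : al != 0 -> eq_upto (lform al be) (lform 1 (be / al)).
Proof. by move=> a0; exists al; rewrite // lformZ mulr1 mulrC divfK. Qed.

Lemma iota_succ m n : iota m.+1 n = [seq k.+1 | k <- iota m n].
Proof. exact: (iotaDl 1 m n). Qed.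

Lemma prod_rev_iota (f : nat -> P) n :
  \prod_(k <- iota 1 n) f k = \prod_(k <- iota 1 n) f (n.+1 - k)%N.
Proof.
rewrite -(big_map (fun k => n.+1 - k)%N predT f) -rev_iota1.
by apply: perm_big; rewrite perm_sym perm_rev.
Qed.

Lemma cN_lform (u s t : nat) :
  \prod_(1 <= j < u.+1) (pa F - q ^- (2 * (t - u + j)) *: pb F)
  = \prod_(j <- iota 1 u) lform 1 (q ^- (2 * (t - u + j))).
Proof.
by rewrite /index_iota subn1; apply: eq_bigr => j _; rewrite /lform scale1r.
Qed.

Lemma cD_lform (u s t : nat) :
  \prod_(1 <= j < u.+1) (pa F - q ^+ (2 * (s - u + j)) *: pb F)
  = \prod_(j <- iota 1 u) lform 1 (q ^+ (2 * (s - u + j))).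
Proof.
by rewrite /index_iota subn1; apply: eq_bigr => j _; rewrite /lform scale1r.
Qed.

Let qe0 k : q ^+ k != 0. Proof. exact: expf_neq0. Qed.

Section Rows.
Variables s t : nat.
Hypotheses (s0 : (0 < s)%N) (ts : (t <= s)%N).

(** The entry at equal even letters has Q^2 za 1 = a as its first argument. *)
Lemma scalar_high_l :
  eq_upto (\prod_(j <- iota 1 t) (Qv * (Q ^+ 2 * za 1 - wb j)
        * \prod_(k <- iota 2 s.-1) (za k - wb j)))
      ((\prod_(j <- iota 1 t) lform 1 (q ^- (2 * (t - t + j))))
       * \prod_(j <- iota 1 t) \prod_(k <- iota 2 s.-1) (za k - wb j)).
Proof.
rewrite big_split; apply: eq_uptoM; last exact: eq_upto_refl.
apply: eq_upto_prod => j; rewrite -zaS // subnn add0n.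
apply: eq_upto_trans (eq_uptoC _ _) _; first by rewrite invr_eq0.
by rewrite form_zw muln0 expr0 invr1; apply: eq_upto_refl.
Qed.

(** Within a row the forms of the lowest eigenvalue are those of the common
    factor, shifted by one index, and one more, which belongs to the
    denominator; the index j is reversed to match its order of factors. *)
Lemma scalar_low_l :
  eq_upto (\prod_(j <- iota 1 t) \prod_(i <- iota 1 s) (Qv * (za i - Q ^+ 2 * wb j)))
      ((\prod_(j <- iota 1 t) lform 1 (q ^+ (2 * (s - t + j))))
       * \prod_(j <- iota 1 t) \prod_(k <- iota 2 s.-1) (za k - wb j)).
Proof.
rewrite [X in _ (X * _)]prod_rev_iota -big_split.
(* the comparison factor by factor uses 0 < j <= t *)
rewrite big_seq [X in eq_upto _ X]big_seq.
suff h j : (0 < j <= t)%N -> eq_upto (\prod_(i <- iota 1 s) (Qv * (za i - Q ^+ 2 * wb j)))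
    (lform 1 (q ^+ (2 * (s - t + (t.+1 - j)))) * \prod_(k <- iota 2 s.-1) (za k - wb j)).
  elim/big_rec2: _ => [|j x y]; first exact: eq_upto_refl.
  by rewrite mem_iota => hj xy; apply: eq_uptoM => //; apply: h; lia.
move=> hj; have {1}-> : s = (s.-1 + 1)%N by lia.
rewrite iotaD big_cat /= big_seq1 mulrC; apply: eq_uptoM.
  apply: eq_upto_trans (eq_uptoC _ _) _; first by rewrite invr_eq0.
  have -> : (1 + s.-1)%N = s by lia.
  have -> : j = j.-1.+1 by lia.
  rewrite -wbS // form_zw.
  apply: eq_upto_trans (eq_upto_lform _ _) _; first by rewrite qX_neq0.
  rewrite invrK [q ^+ (2 * (_ + _))](_ : _ = q ^- (2 * j.-1) * q ^+ (2 * s)).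
    exact: eq_upto_refl.
  apply: (mulfI (qe0 (2 * j.-1))); rewrite mulrA mulfV // mul1r -exprD.
  by congr (_ ^+ _); lia.
rewrite (iota_succ 1) big_map; apply: eq_upto_prod => k; rewrite zaS // -mulrBr.
apply: eq_upto_trans (eq_uptoC _ _) _; first by rewrite invr_eq0.
by rewrite -mpolyCXn; apply: eq_uptoC.
Qed.
End Rows.

Section Columns.
Variables s t : nat.
Hypotheses (t0 : (0 < t)%N) (st : (s <= t)%N).

Lemma scalar_high_r :
  eq_upto (\prod_(i <- iota 1 s) (Qv * (Q ^+ 2 * za i - wb t)
        * \prod_(k <- iota 2 t.-1) (za i - wb (t.+1 - k))))
      ((\prod_(j <- iota 1 s) lform 1 (q ^- (2 * (t - s + j))))
       * \prod_(i <- iota 1 s) \prod_(k <- iota 2 t.-1) (za i - wb (t.+1 - k))).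
Proof.
rewrite [X in _ (X * _)]prod_rev_iota -big_split.
rewrite big_seq [X in eq_upto _ X]big_seq.
elim/big_rec2: _ => [|i x y]; first exact: eq_upto_refl.
rewrite mem_iota => hi xy; apply: eq_uptoM => //; apply: eq_uptoM; last exact: eq_upto_refl.
apply: eq_upto_trans (eq_uptoC _ _) _; first by rewrite invr_eq0.
have -> : i = i.-1.+1 by lia.
rewrite -zaS // form_zw.
apply: eq_upto_trans (eq_upto_lform _ _) _; first by rewrite qX_neq0.
rewrite invrK [q ^- (2 * (_ + _))](_ : _ = q ^- (2 * t) * q ^+ (2 * i.-1)).
  exact: eq_upto_refl.
apply: (mulfI (qe0 (2 * t))); rewrite mulrA mulfV // mul1r.
have -> : (2 * t = 2 * i.-1 + 2 * (t - s + (s.+1 - i.-1.+1)))%N by lia.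
by rewrite exprD mulfK.
Qed.

Lemma scalar_low_r :
  eq_upto (\prod_(j <- iota 1 t) \prod_(i <- iota 1 s) (Qv * (za i - Q ^+ 2 * wb j)))
      ((\prod_(j <- iota 1 s) lform 1 (q ^+ (2 * (s - s + j))))
       * \prod_(i <- iota 1 s) \prod_(k <- iota 2 t.-1) (za i - wb (t.+1 - k))).
Proof.
rewrite exchange_big -big_split; apply: eq_upto_prod => i.
have {1}-> : t = t.-1.+1 by lia.
rewrite /= big_cons; apply: eq_uptoM.
  rewrite -wbS // subnn add0n form_zw muln0 expr0 invr1.
  apply: eq_upto_trans (eq_uptoC _ _) _; first by rewrite invr_eq0.
  apply: eq_upto_trans (eq_upto_lform _ _) _; first by rewrite qX_neq0.
  by rewrite invrK mul1r; apply: eq_upto_refl.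
have -> : \prod_(k <- iota 2 t.-1) (za i - wb (t.+1 - k))
    = \prod_(k <- iota 1 t.-1) (za i - wb k).
  rewrite (iota_succ 1) big_map [RHS]prod_rev_iota; apply: eq_bigr => k _.
  by rewrite subSS prednK.
rewrite (iota_succ 1) big_map; apply: eq_upto_prod => k; rewrite -wbS //.
by apply: eq_uptoC; rewrite invr_eq0.
Qed.
End Columns.

Lemma line_prod_lform c (r : seq nat) (g : nat -> F) :
  (forall k, k \in r -> c != g k) ->
  line c (\prod_(k <- r) lform 1 (g k)) != 0.
Proof.
elim: r => [_|k r IHr h].
  by rewrite big_nil /line rmorph1 oner_neq0.
rewrite big_cons lineM mulf_neq0 //; last first.
  by apply: IHr => l lr; apply: h; rewrite inE lr orbT.
rewrite line_lform mul1r -mul_mpolyC mulf_neq0 ?pb_neq0 // mpolyC_eq0 subr_eq0.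
exact: h (mem_head _ _).
Qed.

Lemma prod_lform_neq0 (r : seq nat) (g : nat -> F) :
  \prod_(k <- r) lform 1 (g k) != 0.
Proof.
elim/big_rec: _ => [|k x _ x0]; first exact: oner_neq0.
by rewrite mulf_neq0 // lform_neq0 // oner_neq0.
Qed.

(** A linear form is prime: on the line where it vanishes D E vanishes and E
    does not, so D does. *)
Lemma prod_lform_dvd (r : seq nat) (f : nat -> F) (D E H : P) :
  (forall k, k \in r -> line (f k) E != 0) ->
  D * E = (\prod_(k <- r) lform 1 (f k)) * H ->
  exists h, D = (\prod_(k <- r) lform 1 (f k)) * h.
Proof.
elim: r D => [|k r IHr] D hE; first by rewrite big_nil; exists D; rewrite mul1r.
rewrite big_cons -mulrA => e.
have /eqP := congr1 (line (f k)) e.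
rewrite !lineM line_lform mul1r subrr scale0r mul0r mulf_eq0.
rewrite (negbTE (hE k (mem_head _ _))) orbF => /eqP lD.
have [|D1 D1E] := @lform_dvd F 1 (f k) D (oner_neq0 _); first by rewrite divr1.
have [||h hE'] := IHr D1.
- by move=> l lr; apply: hE; rewrite inE lr orbT.
- have l0 : lform 1 (f k) != 0 by rewrite lform_neq0 ?oner_neq0.
  by apply: (mulfI l0); rewrite mulrA -D1E.
by exists h; rewrite D1E hE' mulrA.
Qed.

Lemma prod_lform_homog (r : seq nat) (f : nat -> F) :
  exists d, \prod_(k <- r) lform 1 (f k) \is d.-homog.
Proof.
exists (size r); elim: r => [|k r IHr]; first by rewrite big_nil dhomog1.
rewrite big_cons -[size _]add1n; apply: dhomogM => //.
by rewrite /lform rpredB ?rpredZ // dhomogX /= mdeg1.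
Qed.

Lemma msize_dvd (D D' h : P) : D' != 0 -> D' = D * h -> (msize D <= msize D')%N.
Proof.
move=> D0 e; have : D * h != 0 by rewrite -e.
rewrite mulf_eq0 negb_or => /andP[d0 h0]; rewrite e msizeM //.
have : (0 < msize h)%N by rewrite lt0n msize_poly_eq0.
by case: (msize h) => // k _; rewrite addnS leq_addr.
Qed.

Lemma powers_differ u s t j k : (0 < j)%N -> (0 < k)%N ->
  q ^- (2 * (t - u + j)) != q ^+ (2 * (s - u + k)).
Proof.
move=> j0 k0; apply/eqP => e.
have := hq (n := (2 * (t - u + j) + 2 * (s - u + k))%N); rewrite exprD -e mulfV //.
by rewrite eqxx => /(_ _) h; have : false by apply: h; lia.
Qed.

End ScalarFactors.

(** * The action of the generators, letter by letter *)

Section Slices.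

Variables (M N : nat) (K : comNzRingType).
Local Notation I := 'I_(M + N).
Local Notation word := (mindex M N).
Local Notation tpw := (tpow M N K).

Definition mcons n (a : I) (u : word n) : word n.+1 :=
  [ffun p => if unlift ord0 p is Some p' then u p' else a].

Lemma mcons0 n a (u : word n) : mcons a u ord0 = a.
Proof. by rewrite ffunE unlift_none. Qed.

Lemma mconsS n a (u : word n) p : mcons a u (lift ord0 p) = u p.
Proof. by rewrite ffunE liftK. Qed.

Lemma mtail_cons n a (u : word n) : mtail (mcons a u) = u.
Proof. by apply/ffunP => p; rewrite ffunE mconsS. Qed.

Lemma mcons_eta n (u : word n.+1) : mcons (u ord0) (mtail u) = u.
Proof.
apply/ffunP => p; case: (unliftP ord0 p) => [p' ->|->].
  by rewrite mconsS ffunE.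
by rewrite mcons0.
Qed.

Definition slice n (a : I) (y : tpw n.+1) : tpw n := [ffun u => y (mcons a u)].

Lemma sliceE n a (y : tpw n.+1) u : slice a y u = y (mcons a u).
Proof. exact: ffunE. Qed.

Lemma sum_mcons n (f : word n.+1 -> K) :
  \sum_w f w = \sum_a \sum_(w : word n) f (mcons a w).
Proof.
rewrite pair_big /= (reindex (fun aw : I * word n => mcons aw.1 aw.2)) //=.
exists (fun w : word n.+1 => (w ord0, mtail w)) => [[a w] _|w _] /=.
  by rewrite mcons0 mtail_cons.
exact: mcons_eta.
Qed.

Lemma lin_coord n (B : 'End(tpw n)) y u :
  B y u = \sum_w y w * B (tbase K w) u.
Proof.
rewrite {1}(tpow_sum y) linear_sum sum_ffunE; apply: eq_bigr => w _.
by rewrite linearZ /= ffunZE.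
Qed.

(** B is homogeneous of parity e.  The Koszul sign of x (x) B then depends on
    the first letter only. *)
Definition has_parity n (B : 'End(tpw n)) (e : bool) :=
  forall u w, B (tbase K w) u != 0 -> odd (mpar u) (+) odd (mpar w) = e.

Lemma tcons_mcons n (x : 'M[K]_(M + N)) (B : 'End(tpw n)) e y a u :
  has_parity B e ->
  tcons x B y (mcons a u) =
  \sum_b x a b * bsign K (e && is_odd b) * B (slice b y) u.
Proof.
move=> Be; rewrite opkerE sum_mcons; apply: eq_bigr => b _.
rewrite lin_coord big_distrr /=; apply: eq_bigr => w _.
rewrite !mtail_cons !mcons0 sliceE.
have [->|B0] := eqVneq (B (tbase K w) u) 0; first by rewrite !(mulr0, mul0r).
rewrite bsign_odd oddM oddD (Be _ _ B0) parE oddb.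
ring.
Qed.

End Slices.

Section Action.

Variables (M N : nat) (F : fieldType) (q : F).
Hypothesis q0 : q != 0.
Local Notation I := 'I_(M + N).
Local Notation word := (mindex M N).
Local Notation tpw := (tpow M N F).
Local Notation Act := (@Uq_act M N F q).
Implicit Types (g : Uq_sort) (i j k : I).

Definition diag_coef g i (a : I) : F :=
  if a == i then (if g is Uq_s then qi q i else (qi q i)^-1) else 1.

Definition off_coef g i k : F :=
  if g is Uq_s then (if (i < k)%N then qi q i - (qi q i)^-1 else 0)
  else (if (k < i)%N then - (qi q k - (qi q k)^-1) else 0).

Lemma Uq_vecE g i k a b : Uq_vec q g i k a b =
  if i == k then (a == b)%:R * diag_coef g i a else off_coef g i k * ((a == i) && (b == k))%:R.
Proof.
have diag (c : F) : (c *: delta_mx i i + \sum_(l | l != i) delta_mx l l : 'M_(M + N)) a b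
    = (a == b)%:R * (if a == i then c else 1).
  rewrite !mxE summxE; case: (eqVneq a b) => [<-|ab]; last first.
    rewrite mul0r (_ : _ && _ = false) ?mulr0 ?add0r; last first.
      by apply/negP => /andP[/eqP ai /eqP bi]; rewrite ai bi eqxx in ab.
    rewrite big1 // => l _; rewrite mxE (_ : _ && _ = false) //.
    by apply/negP => /andP[/eqP ai /eqP bi]; rewrite ai bi eqxx in ab.
  rewrite mul1r andbb; have [->|ai] := eqVneq a i.
    rewrite mulr1 big1 ?addr0 // => l li; rewrite mxE andbb.
    by rewrite eq_sym (negbTE li).
  rewrite mulr0 add0r (bigD1 a) //= mxE eqxx big1 ?addr0 // => l /andP[_ la].
  by rewrite mxE andbb eq_sym (negbTE la).
rewrite /Uq_vec /diag_coef /off_coef; case: g; case: (eqVneq i k) => // _; case: ifP => _;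
  by rewrite !mxE ?mul0r ?mulNr.
Qed.

Lemma Uq_act_parity n g i j : has_parity (Act n g i j) (is_odd i (+) is_odd j).
Proof.
elim: n => [|n IHn] in i j * => u w.
  rewrite /= evZ; case: (boolP (i == j)) => [/eqP->|_]; last by rewrite mul0r eqxx.
  by rewrite /mpar !big_ord0 !addbb.
rewrite /= ev_sum => h.
have [k] : exists k, ((-1) ^+ ((par i + par k) * (par k + par j)) *:
    tcons (Uq_vec q g i k) (Act n g k j)) (tbase F w) u != 0.
  apply/existsP; apply: contraNT h; rewrite negb_exists => /forallP h.
  by rewrite big1 // => k _; have := h k; rewrite negbK => /eqP.
rewrite evZ mulf_eq0 negb_or => /andP[_].
rewrite -(mcons_eta u) (tcons_mcons _ _ _ _ (IHn k j)) => h'.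
have [b] : exists b, Uq_vec q g i k (u ord0) b * bsign F ((is_odd k (+) is_odd j) && is_odd b) *
    Act n g k j (slice b (tbase F w)) (mtail u) != 0.
  apply/existsP; apply: contraNT h'; rewrite negb_exists => /forallP h'.
  by rewrite big1 // => b _; have := h' b; rewrite negbK => /eqP.
rewrite !mulf_eq0 !negb_or => /andP[/andP[v0 _] A0].
have e : slice b (tbase F w) = (b == w ord0)%:R *: tbase F (mtail w).
  apply/ffunP => v; rewrite ffunZE !ffunE -natrM mulnb.
  suff -> : (mcons b v == w) = (b == w ord0) && (v == mtail w) by [].
  apply/eqP/andP => [<-|[/eqP-> /eqP->]]; last exact: mcons_eta.
  by rewrite mcons0 mtail_cons !eqxx.
move: A0; rewrite e linearZ /= ffunZE mulf_eq0 negb_or => /andP[bw A0].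
have {}bw : b = w ord0 by apply/eqP; apply: contraNT bw => /negPf->; apply: eqxx.
have /= := IHn k j _ _ A0.
have mp (v : word n.+1) : odd (mpar v) = is_odd (v ord0) (+) odd (mpar (mtail v)).
  rewrite /mpar big_ord_recl oddD parE oddb; congr (_ (+) odd _).
  by apply: eq_bigr => p _; rewrite ffunE.
rewrite !mp mcons_eta -bw => par'.
have par0 : is_odd (u ord0) (+) is_odd b = is_odd i (+) is_odd k.
  move: v0; rewrite Uq_vecE; case: (eqVneq i k) => [->|_].
    by case: (eqVneq (u ord0) b) => [->|_]; rewrite ?mul0r ?eqxx ?addbb.
  by case: andP => [[/eqP-> /eqP->]|_]; rewrite ?mulr0 ?eqxx.
move: par' par0; case: (is_odd (u _)); case: (is_odd b); case: (odd _); case: (odd _);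
 case: (is_odd i); case: (is_odd j); case: (is_odd k) => //.
Qed.

(** One step of a transfer matrix: in the state i, either the state is kept, or
    the letter i is read and the state jumps to some k. *)
Lemma act_cons n g i j (y : tpw n.+1) a u :
  Act n.+1 g i j y (mcons a u) =
  bsign F ((is_odd i (+) is_odd j) && is_odd a) * diag_coef g i a * Act n g i j (slice a y) u
  + (a == i)%:R * \sum_k off_coef g i k * bsign F (is_odd i && (is_odd k (+) is_odd j))
      * Act n g k j (slice k y) u.
Proof.
rewrite [Act n.+1 _ _ _]/= ev_sum (bigD1 i) //=; congr (_ + _).
  rewrite evZ (tcons_mcons _ _ _ _ (@Uq_act_parity n g i j)).
  rewrite bsign_odd oddM oddD addbb bsign0 mul1r (bigD1 a) //= big1 => [|b ba].
    by rewrite Uq_vecE !eqxx mul1r addr0 [diag_coef _ _ _ * _]mulrC.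
  by rewrite Uq_vecE eqxx eq_sym (negbTE ba) !mul0r.
rewrite [in RHS](bigD1 i) //= {1}/off_coef ltnn (_ : (if g is Uq_s then 0 else 0) = 0 :> F);
  last by case: g.
rewrite !mul0r add0r big_distrr /=; apply: eq_bigr => k ki.
rewrite evZ (tcons_mcons _ _ _ _ (@Uq_act_parity n g k j)).
rewrite (bigD1 k) //= big1 => [|b bk]; last first.
  by rewrite Uq_vecE eq_sym (negbTE ki) (negbTE bk) andbF mulr0 !mul0r.
rewrite Uq_vecE eq_sym (negbTE ki) eqxx andbT addr0 bsign_odd oddM !oddD !parE !oddb.
case: (a == i); rewrite ?mulr0 ?mul0r ?mulr1 ?mul1r ?mulr0 //.
rewrite !mulrA; congr (_ * _); rewrite [bsign _ _ * off_coef _ _ _]mulrC -mulrA -bsign_addb.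
by congr (_ * bsign _ _); case: (is_odd i); case: (is_odd k); case: (is_odd j).
Qed.

End Action.

(** * The action on two tensor factors *)

Section TwoSites.

Variables (M N : nat) (F : fieldType) (q : F).
Hypothesis q0 : q != 0.
Local Notation I := 'I_(M + N).
Variables (g : Uq_sort) (i j : I) (Y : I -> I -> I -> F).

Hypothesis Y0 : forall k a, ~~ is_odd a -> Y k a a = 0.
Hypothesis YS : forall k (a b : I), (a < b)%N ->
  Y k b a = - q * bsign F (is_odd a && is_odd b) * Y k a b.

Definition site2D a b : F :=
  bsign F ((is_odd i (+) is_odd j) && is_odd a) * diag_coef q g i a
  * (bsign F ((is_odd i (+) is_odd j) && is_odd b) * diag_coef q g i b * Y i a b).

(** The action of s_ij or t_ij on two factors is split according to the state k
    in which they are left; Y k a b is the contribution of the other factors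
    when the two letters are a and b.  Each part is antisymmetric by itself. *)
Definition site2T k a b : F :=
  (b == i)%:R * (bsign F ((is_odd i (+) is_odd j) && is_odd a) * diag_coef q g i a
     * (off_coef q g i k * bsign F (is_odd i && (is_odd k (+) is_odd j)) * Y k a k))
  + (a == i)%:R * (off_coef q g i k * bsign F (is_odd i && (is_odd k (+) is_odd j))
     * (bsign F ((is_odd k (+) is_odd j) && is_odd b) * diag_coef q g k b * Y k k b))
  + (a == i)%:R * (off_coef q g i b * bsign F (is_odd i && (is_odd b (+) is_odd j))
     * (off_coef q g b k * bsign F (is_odd b && (is_odd k (+) is_odd j)) * Y k b k)).

Ltac ordtests := rewrite /diag_coef /off_coef -?val_eqE /= ?ltnn ?eqxx;
  repeat match goal with
  | |- context [(nat_of_ord ?x < nat_of_ord ?y)%N] =>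
      first [ rewrite (_ : (x < y)%N = true); [|lia]
            | rewrite (_ : (x < y)%N = false); [|lia] ]
  | |- context [@eq_op _ (nat_of_ord ?x) (nat_of_ord ?y)] =>
      first [ rewrite (_ : (nat_of_ord x == nat_of_ord y) = true); [|lia]
            | rewrite (_ : (nat_of_ord x == nat_of_ord y) = false); [|lia] ]
  end.

Ltac orient := repeat match goal with
  | h : is_true (nat_of_ord ?a < nat_of_ord ?b)%N |- context [Y ?k ?b ?a] =>
      rewrite (YS k h)
  end.

Lemma is_odd_mono (a b : I) : (a < b)%N -> is_odd a ==> is_odd b.
Proof. by move=> h; apply/implyP => o; apply: leq_trans o (ltnW h). Qed.

Ltac fin :=
  repeat match goal with
  | h : is_true (nat_of_ord ?a < nat_of_ord ?b)%N |- _ =>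
      move: (is_odd_mono h); clear h
  end;
  rewrite ?qiE;
  repeat match goal with
  | |- context [Y ?k ?a ?a] =>
      let e := fresh "e" in
      case: (orP (orbN (is_odd a))) => e;
        [rewrite ?e; set (Y k a a) | rewrite (Y0 k e) ?(negbTE e)]
  end;
  repeat match goal with |- context [is_odd ?a] => case: (is_odd a) end;
  rewrite //= => *;
  rewrite ?bsign0 ?bsign1 /= ?bsign0 ?bsign1 ?invrK;   first [ring | by field].

Lemma site2D_diag a : ~~ is_odd a -> site2D a a = 0.
Proof. by move=> e; rewrite /site2D Y0 // !mulr0. Qed.

Lemma site2D_swap (a b : I) : (a < b)%N ->
  site2D b a = - q * bsign F (is_odd a && is_odd b) * site2D a b.
Proof. by move=> h; rewrite /site2D (YS _ h); ring. Qed.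

Lemma site2T_diag k a : ~~ is_odd a -> site2T k a a = 0.
Proof.
move=> e; rewrite /site2T; have [ai|ai] := eqVneq a i; last by rewrite !mul0r !addr0.
subst a; case: g; case: (ltngtP i k) => [h|h|/val_inj h]; subst; ordtests;
  orient; rewrite ?Y0 // ?qiE ?(negbTE e); fin.
Qed.

Lemma site2T_swap k (a b : I) : (a < b)%N ->
  site2T k b a = - q * bsign F (is_odd a && is_odd b) * site2T k a b.
Proof.
move=> h; rewrite /site2T.
have [ai|ai] := eqVneq a i; have [bi|bi] := eqVneq b i; subst.
- by rewrite ltnn in h.
- case: (ltngtP i k) => [ik|ik|/val_inj ik]; case: (ltngtP b k) => [bk|bk|/val_inj bk];
    subst; try (exfalso; lia); move: (g) => []; ordtests; orient; fin.
- case: (ltngtP i k) => [ik|ik|/val_inj ik]; case: (ltngtP a k) => [ak|ak|/val_inj ak];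
    subst; try (exfalso; lia); move: (g) => []; ordtests; orient; fin.
- by rewrite !mul0r !addr0 mulr0.
Qed.

End TwoSites.

(** * q-antisymmetric tensors form a submodule *)

Section Stability.

Variables (M N : nat) (F : fieldType) (q : F).
Hypothesis q0 : q != 0.
Local Notation I := 'I_(M + N).
Local Notation word := (mindex M N).
Local Notation tpw := (tpow M N F).
Local Notation Act := (@Uq_act M N F q).
Implicit Types (g : Uq_sort) (i j k : I).

Lemma swap_at_lift n (p p' : 'I_n) a (u : word n) :
  swap_at (lift ord0 p) (lift ord0 p') (mcons a u) = mcons a (swap_at p p' u).
Proof.
apply/ffunP => r; case: (unliftP ord0 r) => [r' ->|->]; last first.
  by rewrite swap_at_x ?mcons0 // neq_lift.
rewrite mconsS; have [->|h] := eqVneq r' p; first by rewrite !swap_at_l mconsS.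
have [->|h'] := eqVneq r' p'; first by rewrite !swap_at_r mconsS.
by rewrite !swap_at_x ?mconsS // (inj_eq lift_inj).
Qed.

Lemma swap_at_first n a b (u : word n) :
  swap_at ord0 (lift ord0 ord0) (mcons a (mcons b u)) = mcons b (mcons a u).
Proof.
apply/ffunP => r; case: (unliftP ord0 r) => [r' ->|->]; last first.
  by rewrite swap_at_l mconsS !mcons0.
case: (unliftP ord0 r') => [r'' ->|->]; last by rewrite swap_at_r mconsS !mcons0.
by rewrite swap_at_x ?mconsS // ?(inj_eq lift_inj) eq_sym neq_lift.
Qed.

Lemma qalt_slice n (x : tpw n.+1) (p p' : 'I_n) :
  qalt q (lift ord0 p) (lift ord0 p') x <-> forall a, qalt q p p' (slice a x).
Proof.
split=> [h a u|h u].
  by have := h (mcons a u); rewrite swap_at_lift !mconsS !sliceE.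
by have := h (u ord0) (mtail u); rewrite !sliceE -swap_at_lift mcons_eta !ffunE.
Qed.

Lemma qalt_first n (x : tpw n.+2) :
  qalt q ord0 (lift ord0 ord0) x <-> forall u : word n,
    (forall a, ~~ is_odd a -> x (mcons a (mcons a u)) = 0) /\
    (forall a b : I, (a < b)%N -> x (mcons b (mcons a u))
       = - q * bsign F (is_odd a && is_odd b) * x (mcons a (mcons b u))).
Proof.
split=> [h u|h v].
  split=> [a ae|a b ab].
    by have := (h (mcons a (mcons a u))).1; rewrite mconsS !mcons0; apply.
  by have := (h (mcons a (mcons b u))).2; rewrite swap_at_first mconsS !mcons0; apply.
have [h1 h2] := h (mtail (mtail v)).
have e : v = mcons (v ord0) (mcons (v (lift ord0 ord0)) (mtail (mtail v))).
  rewrite -[v (lift _ _)](_ : mtail v ord0 = _) ?mcons_eta //; exact: ffunE.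
split=> [e' o|l]; rewrite e; first by rewrite -e' h1.
by rewrite swap_at_first h2 // mconsS !mcons0.
Qed.

Lemma qalt_sum n (p p' : 'I_n) (f : I -> tpw n) :
  (forall k, qalt q p p' (f k)) -> qalt q p p' (\sum_k f k).
Proof.
by move=> h; elim/big_ind: _ => [|x y|//]; [exact: qalt0|exact: qaltD].
Qed.

Lemma slice_act n g i j (y : tpw n.+1) a :
  slice a (Act n.+1 g i j y) =
  (bsign F ((is_odd i (+) is_odd j) && is_odd a) * diag_coef q g i a) *: Act n g i j (slice a y)
  + (a == i)%:R *: \sum_k (off_coef q g i k * bsign F (is_odd i && (is_odd k (+) is_odd j)))
      *: Act n g k j (slice k y).
Proof.
apply/ffunP => u; rewrite sliceE act_cons [RHS]ffunE !ffunZE sum_ffunE.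
by congr (_ + _ * _); apply: eq_bigr => k _; rewrite ffunZE.
Qed.

(** Beyond the first factor the condition passes to the slices; for the first two
    factors it is the computation of the previous part. *)
Lemma act_qalt n g i j (x : tpw n) : qalt_on q 0 n x -> qalt_on q 0 n (Act n g i j x).
Proof.
elim: n => [|n IHn] in i j x * => hx p p' e _ _; first by case: p {e}.
case: (unliftP ord0 p') e => [p1' ->|->] //; rewrite lift0 => -[e].
case: (unliftP ord0 p) e => [p1 ->|->]; [rewrite lift0 => e|move=> e].
  have hs a : qalt_on q 0 n (slice a x).
    move=> r r' er _ _; apply: (iffLR (qalt_slice x r r')) => //.
    by apply: hx; [rewrite !lift0 er|by []|apply: ltn_ord].
  apply/qalt_slice => a; rewrite slice_act; apply: qaltD; apply: qaltZ.
    by apply: IHn.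
  apply: qalt_sum => k; apply: qaltZ; by apply: IHn.
case: n => [|n] in IHn x hx p p' p1' e *; first by case: p1' e.
have {e} -> : p1' = ord0 by apply: val_inj.
have /qalt_first hx0 : qalt q ord0 (lift ord0 ord0) x by apply: hx.
apply/qalt_first => u.
pose Y k a b := Act n g k j (slice b (slice a x)) u.
have Y0 k a : ~~ is_odd a -> Y k a a = 0.
  move=> ae; rewrite /Y (_ : slice a (slice a x) = 0) ?linear0 ?ffunE //.
  by apply/ffunP => v; rewrite !sliceE (hx0 v).1 // ffunE.
have YS k (a b : I) : (a < b)%N -> Y k b a = - q * bsign F (is_odd a && is_odd b) * Y k a b.
  move=> ab; rewrite /Y.
  have -> : slice a (slice b x) = (- q * bsign F (is_odd a && is_odd b)) *: slice b (slice a x).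
    by apply/ffunP => v; rewrite ffunZE !sliceE (hx0 v).2.
  by rewrite linearZ /= ffunZE.
have actE a b : Act n.+2 g i j x (mcons a (mcons b u)) =
    site2D q g i j Y a b + \sum_k site2T q g i j Y k a b.
  rewrite act_cons act_cons; under [X in _ + _ * X]eq_bigr => k _ do rewrite act_cons mulrDr.
  have -> : \sum_k (off_coef q g i k * bsign F (is_odd i && (is_odd k (+) is_odd j)) *
        (bsign F ((is_odd k (+) is_odd j) && is_odd b) * diag_coef q g k b
          * Act n g k j (slice b (slice k x)) u) +
      off_coef q g i k * bsign F (is_odd i && (is_odd k (+) is_odd j)) *
        ((b == k)%:R * (\sum_l off_coef q g k l * bsign F (is_odd k && (is_odd l (+) is_odd j)) *
           Act n g l j (slice l (slice k x)) u))) =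
     \sum_k off_coef q g i k * bsign F (is_odd i && (is_odd k (+) is_odd j)) *
        (bsign F ((is_odd k (+) is_odd j) && is_odd b) * diag_coef q g k b * Y k k b)
     + \sum_k off_coef q g i b * bsign F (is_odd i && (is_odd b (+) is_odd j)) *
         (off_coef q g b k * bsign F (is_odd b && (is_odd k (+) is_odd j)) * Y k b k).
    rewrite big_split; congr (_ + _); rewrite (bigD1 b) //= eqxx mul1r.
    rewrite [X in _ + X]big1 ?addr0 ?big_distrr // => k kb.
    by rewrite eq_sym (negbTE kb) mul0r mulr0.
  rewrite mulrDr -!addrA; congr (_ + _).
  rewrite /site2T !big_split /= mulrDr !big_distrr /= addrA; congr (_ + _ + _).
  by apply: eq_bigr => k _; rewrite /Y; ring.
split=> [a ae|a b ab]; rewrite !actE.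
  by rewrite site2D_diag // big1 ?addr0 // => k _; apply: site2T_diag.
rewrite mulrDr big_distrr; congr (_ + _); first exact: site2D_swap.
by apply: eq_bigr => k _; apply: site2T_swap.
Qed.

End Stability.

(** * Raising a letter *)

Section Raising.

Variables (M N : nat) (F : fieldType) (q : F).
Hypothesis q0 : q != 0.
Local Notation I := 'I_(M + N).
Local Notation word := (mindex M N).
Local Notation tpw := (tpow M N F).
Local Notation Act n i j := (@Uq_act M N F q n Uq_s i j).
Implicit Types (i j k : I).

Lemma qi_neq0 i : qi q i != 0.
Proof. by rewrite qiE; case: ifP; rewrite ?invr_eq0. Qed.

Lemma act_s_lower n i j (y : tpw n) u : (j < i)%N -> Act n i j y u = 0.
Proof.
move=> ji; elim: n => [|n IHn] in i ji y u *.
  by rewrite /= evZ -val_eqE /= (gtn_eqF ji) mul0r.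
rewrite -(mcons_eta u) act_cons IHn // mulr0 add0r big1 ?mulr0 // => k _.
rewrite /off_coef; case: ifP => [ik|_]; last by rewrite !mul0r.
by rewrite IHn ?mulr0 // (ltn_trans ji).
Qed.

(** The eigenvalue of s_jj. *)
Definition diag_weight n j (u : word n) : F := \prod_(p < n) diag_coef q Uq_s j (u p).

Lemma diag_weight_cons n j a (u : word n) :
  diag_weight j (mcons a u) = diag_coef q Uq_s j a * diag_weight j u.
Proof.
by rewrite /diag_weight big_ord_recl mcons0; congr (_ * _); apply: eq_bigr => p _;
  rewrite mconsS.
Qed.

Lemma diag_weight_neq0 n j (u : word n) : diag_weight j u != 0.
Proof.
rewrite prodf_seq_neq0; apply/allP => p _ /=; rewrite /diag_coef.
by case: ifP; rewrite ?qi_neq0 ?oner_neq0.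
Qed.

Lemma act_s_diag n j (y : tpw n) u : Act n j j y u = diag_weight j u * y u.
Proof.
elim: n => [|n IHn] in y u *.
  by rewrite /= evZ eqxx id_lfunE /diag_weight big_ord0.
rewrite -(mcons_eta u) act_cons diag_weight_cons addbb bsign0 mul1r IHn sliceE big1.
  by rewrite mulr0 addr0 mulrA.
move=> k _; rewrite /off_coef; case: ifP => [jk|_]; last by rewrite !mul0r.
by rewrite act_s_lower ?mulr0.
Qed.

Variables (k k' : I).
Hypothesis kS : k' = k.+1 :> nat.
Local Notation E n := (Act n k k').
Let lkk : (k < k')%N. Proof. by rewrite kS. Qed.
Let nkk : (k == k') = false. Proof. by rewrite -val_eqE /= (ltn_eqF lkk). Qed.

Lemma raise_cons n a (y : tpw n.+1) u :
  E n.+1 y (mcons a u) =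
  bsign F ((is_odd k (+) is_odd k') && is_odd a) * diag_coef q Uq_s k a * E n (slice a y) u
  + (a == k)%:R * ((qi q k - (qi q k)^-1) * diag_weight k' u * y (mcons k' u)).
Proof.
rewrite act_cons; congr (_ + _ * _); rewrite (bigD1 k') //= big1 => [|l lk].
  by rewrite /off_coef lkk addbb andbF bsign0 mulr1 addr0 act_s_diag sliceE mulrA.
rewrite /off_coef; case: ifP => [kl|_]; last by rewrite !mul0r.
rewrite act_s_lower ?mulr0 // kS ltn_neqAle kl andbT.
by apply: contraNneq lk => e; apply/eqP/val_inj; rewrite /= kS e.
Qed.

Definition set_letter n (u : word n) (p : 'I_n) (a : I) : word n :=
  [ffun r => if r == p then a else u r].

Lemma set_letter_cons0 n a b (u : word n) : set_letter (mcons a u) ord0 b = mcons b u.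
Proof.
apply/ffunP => r; rewrite ffunE; case: (unliftP ord0 r) => [r' ->|->].
  by rewrite eq_sym (negbTE (neq_lift _ _)) !mconsS.
by rewrite eqxx mcons0.
Qed.

Lemma set_letter_consS n a b (u : word n) p :
  set_letter (mcons a u) (lift ord0 p) b = mcons a (set_letter u p b).
Proof.
apply/ffunP => r; rewrite ffunE; case: (unliftP ord0 r) => [r' ->|->].
  by rewrite (inj_eq lift_inj) !mconsS ffunE.
by rewrite (negbTE (neq_lift _ _)) !mcons0.
Qed.

Lemma qalt_on_slice n (x : tpw n.+1) a : qalt_on q 0 n.+1 x -> qalt_on q 0 n (slice a x).
Proof.
move=> hx r r' er _ _.
suff /qalt_slice h : qalt q (lift ord0 r) (lift ord0 r') x by exact: h.
by apply: hx; [rewrite !lift0 er|by []|apply: ltn_ord].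
Qed.

Lemma raise_none n (y : tpw n) (u : word n) : (forall p, u p != k) -> E n y u = 0.
Proof.
elim: n => [|n IHn] in y u * => h; first by rewrite /= evZ nkk mul0r.
rewrite -(mcons_eta u) raise_cons (negbTE (h _)) mul0r addr0 IHn ?mulr0 // => p.
by rewrite ffunE h.
Qed.

(** Odd letters k < k' commute up to the factor q. *)
Lemma move_right n (x : tpw n.+1) (u : word n) (p : 'I_n) :
  is_odd k -> qalt_on q 0 n.+1 x -> (forall r : 'I_n, (r <= p)%N -> u r = k) ->
  x (mcons k' u) = q ^+ p.+1 * x (mcons k (set_letter u p k')).
Proof.
move=> ok; elim: n => [|n IHn] in x u p *; first by case: p.
have ok' : is_odd k' by apply: leq_trans ok (ltnW lkk).
move=> hx hu; have u0 : u ord0 = k by apply: hu.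
rewrite -(mcons_eta u) u0.
have hx0 : qalt q ord0 (lift ord0 ord0) x by apply: hx.
have /qalt_first hx1 := hx0.
rewrite (hx1 _).2 // ok ok' /= bsign1 mulrNN mulr1.
case: (unliftP ord0 p) hu => [p' ->|->] hu; last by rewrite set_letter_cons0.
rewrite set_letter_consS exprS -mulrA; congr (_ * _); rewrite -!(sliceE k x).
apply: IHn; first exact: qalt_on_slice.
by move=> r rp; rewrite ffunE; apply: hu; rewrite !lift0.
Qed.

Definition raise_coef (p : nat) : F := bsign F (is_odd k) * (q ^+ p.+1 - q ^- p.+1).

(** Raising any letter of the block of k's gives, after moving the raised letter
    to the end of the block, a power of q times the same coordinate; the powers
    add up to a q-integer. *)
Lemma raise_block n (x : tpw n) (u : word n) (p : 'I_n) :
  qalt_on q 0 n x -> is_odd k || (p == 0%N :> nat) ->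
  (forall r : 'I_n, (r <= p)%N -> u r = k) -> (forall r : 'I_n, (p < r)%N -> u r != k) ->
  E n x u = raise_coef p * diag_weight k' u * x (set_letter u p k').
Proof.
elim: n => [|n IHn] in x u p *; first by case: p.
move=> hx ok hu hv; have u0 : u ord0 = k by apply: hu.
move: hu hv; rewrite -(mcons_eta u) u0; move: (mtail u) => v {u0 u} hu hv.
rewrite raise_cons diag_weight_cons eqxx mul1r /diag_coef nkk eqxx mul1r.
case: (unliftP ord0 p) ok hu hv => [p' ->|->] ok hu hv; last first.
  rewrite raise_none => [|r]; last by have := hv (lift ord0 r) isT; rewrite mconsS.
  rewrite mulr0 add0r set_letter_cons0; congr (_ * _ * _).
  rewrite /raise_coef !expr1 qiE; case: (is_odd k); rewrite ?bsign0 ?bsign1 ?mul1r ?invrK //.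
  by rewrite mulN1r opprB.
rewrite lift0 orbF in ok; have ok' : is_odd k' by apply: leq_trans ok (ltnW lkk).
have hu' (r : 'I_n) : (r <= p')%N -> v r = k.
  by move=> h; have := hu (lift ord0 r); rewrite !lift0 mconsS; apply.
have hv' (r : 'I_n) : (p' < r)%N -> v r != k.
  by move=> h; have := hv (lift ord0 r); rewrite !lift0 mconsS; apply.
rewrite (IHn _ v p') ?ok //; last exact: qalt_on_slice.
rewrite (move_right ok hx hu') set_letter_consS sliceE.
rewrite /raise_coef qiE ok ok' lift0 /= bsign0 bsign1 invrK.
have q1 : q ^+ p'.+1 != 0 by apply: expf_neq0.
rewrite [q ^+ p'.+2]exprS invfM; move: (q ^+ p'.+1) q1 => Z Z0.
by field; rewrite q0 Z0.
Qed.

(** In a sorted word the letters k form a block, and over the smaller letters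
    before it the raising operator only acquires signs. *)
Lemma raise_sorted n (x : tpw n) (u : word n) (p : 'I_n) :
  (forall m, (0 < m)%N -> q ^+ m != 1) ->
  qalt_on q 0 n x -> u p = k -> (forall r : 'I_n, (p < r)%N -> u r != k) ->
  (forall r r' : 'I_n, (r <= r')%N -> (u r <= u r')%N) ->
  (~~ is_odd k -> forall r : 'I_n, (r < p)%N -> u r != k) ->
  exists2 c, c != 0 & E n x u = c * x (set_letter u p k').
Proof.
move=> hq; elim: n => [|n IHn] in x u p *; first by case: p.
move=> hx up hv us ue; have [u0|u0] := eqVneq (u ord0) k.
  exists (raise_coef p * diag_weight k' u); last first.
    apply: raise_block => //.
      case: (boolP (is_odd k)) => //= ok; have := ue ok ord0; rewrite u0 eqxx.
      by case: (nat_of_ord p) => // m /(_ isT).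
    move=> r rp; apply: val_inj; apply/eqP; rewrite eqn_leq /= -{1}up us //=.
    by rewrite -{1}u0 us.
  rewrite !mulf_neq0 ?diag_weight_neq0 ?bsign_neq0 //.
  have q1 : q ^+ p.+1 != 0 by apply: expf_neq0.
  rewrite subr_eq0; apply: contra (hq (p.+1 + p.+1)%N isT) => /eqP e.
  by rewrite exprD {1}e mulVf.
have [p' pp] : exists p', p = lift ord0 p'.
  case: (unliftP ord0 p) => [p' ->|e]; first by exists p'.
  by rewrite -up e eqxx in u0.
subst p; move: up hv us ue u0; rewrite -(mcons_eta u) mcons0.
move: (u ord0) (mtail u) => a v up hv us ue ak.
have [||||| c c0 cE] := IHn (slice a x) v p'.
- exact: qalt_on_slice.
- by rewrite mconsS in up.
- by move=> r h; have := hv (lift ord0 r); rewrite !lift0 mconsS; apply.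
- move=> r r' h; have := us (lift ord0 r) (lift ord0 r').
  by rewrite !lift0 !mconsS; apply.
- by move=> ok r h; have := ue ok (lift ord0 r); rewrite !lift0 mconsS; apply.
exists (bsign F ((is_odd k (+) is_odd k') && is_odd a) * c).
  by rewrite mulf_neq0 ?bsign_neq0.
by rewrite raise_cons (negbTE ak) mul0r addr0 cE set_letter_consS /diag_coef (negbTE ak) mulr1
  sliceE mulrA.
Qed.

Lemma raise_support n (x : tpw n) (u : word n) :
  E n x u != 0 -> exists2 p, u p = k & x (set_letter u p k') != 0.
Proof.
elim: n => [|n IHn] in x u *; first by rewrite /= evZ nkk mul0r eqxx.
rewrite -(mcons_eta u) raise_cons; move: (u ord0) (mtail u) => a v h.
have [e|ne] := eqVneq (E n (slice a x) v) 0; last first.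
  have [p vp xp] := IHn _ _ ne; exists (lift ord0 p); first by rewrite mconsS.
  by rewrite set_letter_consS -sliceE.
move: h; rewrite e mulr0 add0r; have [->|_] := eqVneq a k; last first.
  by rewrite mul0r eqxx.
rewrite !mulf_eq0 !negb_or => /andP[_ /andP[_ h]].
by exists ord0; rewrite ?mcons0 ?set_letter_cons0.
Qed.

End Raising.

(** * The submodule generated by the lowest weight vector *)

Section LastLetter.

Variables (M N : nat).
Hypothesis N0 : (0 < N)%N.
Local Notation I := 'I_(M + N).

Lemma last_letter_proof : ((M + N).-1 < M + N)%N.
Proof. by rewrite prednK // addn_gt0 N0 orbT. Qed.
Definition last_letter : I := Ordinal last_letter_proof.

Lemma last_letter_odd : is_odd last_letter.
Proof. rewrite /is_odd /=; lia. Qed.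

Lemma le_last_letter (a : I) : (a <= last_letter)%N.
Proof. by rewrite /= -ltnS prednK ?ltn_ord // addn_gt0 N0 orbT. Qed.

End LastLetter.

Section VplusCharacterization.

Variables (M N : nat) (F : fieldType) (q : F).
Hypothesis q0 : q != 0.
Hypothesis hq : forall n : nat, (0 < n)%N -> q ^+ n != 1.
Hypothesis N0 : (0 < N)%N.
Local Notation I := 'I_(M + N).
Local Notation word := (mindex M N).
Local Notation tpw := (tpow M N F).
Local Notation last_letter := (last_letter M N0).
Local Notation le_last_letter := (le_last_letter (M := M) N0).

Lemma Uq_step_qalt n (U : {vspace tpw n}) :
  (forall y, y \in U -> qalt_on q 0 n y) ->
  forall y, y \in Uq_step q U -> qalt_on q 0 n y.
Proof.
move=> hU y /memv_addP [y1 y1U [y2 y2S ->]] p p' e h h'.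
apply: qaltD; first exact: hU.
have /memv_sumP [f fS ->] := y2S.
elim/big_ind: _ => [|a b|k _]; [exact: qalt0|exact: qaltD|].
have /memv_addP [a /memv_imgP [a' a'U ->] [b /memv_imgP [b' b'U ->] ->]] := fS k isT.
by apply: qaltD; apply: act_qalt => //; apply: hU.
Qed.

Lemma vlowE n (u : word n) : vlow M N F n u = [forall p, u p == last_letter]%:R.
Proof. by rewrite ffunE; congr (_%:R). Qed.

Lemma vlow_qalt n : qalt_on q 0 n (vlow M N F n).
Proof.
move=> p p' e _ _ u; have zero (v : word n) r : v r != last_letter -> vlow M N F n v = 0.
  move=> vr; rewrite vlowE (_ : [forall _, _] = false) //.
  by apply/negbTE/forallP => /(_ r); rewrite (negbTE vr).
split=> [_ ue|l];
  first by apply: (zero _ p); apply: contraNneq ue => ->; exact: (last_letter_odd M N0).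
have np : u p != last_letter.
  by apply/negP => /eqP up; have := le_last_letter (u p'); rewrite leqNgt -up l.
by rewrite (zero u p) // (zero _ p') ?swap_at_r ?mulr0.
Qed.

Lemma Vplus_qalt n y : y \in Vplus M N q n -> qalt_on q 0 n y.
Proof.
rewrite /Vplus /Defs.generated; elim: (\dim _) y => [|m IHm] y /=.
  by move=> /vlineP [c ->] p p' e h h'; apply: qaltZ; apply: vlow_qalt.
exact: Uq_step_qalt.
Qed.

(** These words label a basis of V_n^+. *)
Definition admissible n (u : word n) : bool :=
  [forall r : 'I_n, forall r' : 'I_n, (r < r')%N ==>
     ((u r < u r')%N || ((u r == u r') && is_odd (u r)))].

Lemma admissibleP n (u : word n) : reflect (forall r r' : 'I_n, (r < r')%N ->
    (u r < u r')%N \/ (u r = u r' /\ is_odd (u r))) (admissible u).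
Proof.
apply: (iffP forallP) => [h r r' l|h r].
  by have /forallP/(_ r')/implyP/(_ l)/orP[|/andP[/eqP]] := h r; [left|right].
apply/forallP => r'; apply/implyP => l; have [->//|[-> ->]] := h r r' l.
by rewrite eqxx orbT.
Qed.

Lemma admissible_sorted n (u : word n) : admissible u ->
  forall r r' : 'I_n, (r <= r')%N -> (u r <= u r')%N.
Proof.
move=> /admissibleP h r r'; rewrite leq_eqVlt => /orP[/eqP/val_inj->//|l].
by have [/ltnW//|[-> _]] := h r r' l.
Qed.

Definition content n (u : word n) (a : I) : nat := (\sum_(p < n) (u p == a))%N.

Lemma content_set_letter n (u : word n) p b a :
  (content (set_letter u p b) a + (u p == a) = content u a + (b == a))%N.
Proof.
rewrite /content (bigD1 p) //= [in RHS](bigD1 p) //= ffunE eqxx.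
have -> : (\sum_(r < n | r != p) (set_letter u p b r == a) = \sum_(r < n | r != p) (u r == a))%N.
  by apply: eq_bigr => r rp; rewrite ffunE (negbTE rp).
by rewrite addnC (addnC (b == a)) addnA.
Qed.

Lemma content_inj n (u v : word n) : admissible u -> admissible v ->
  content u =1 content v -> u = v.
Proof.
move=> au av e; pose sq (w : word n) := [seq w p | p <- enum 'I_n].
have sorted_sq w : admissible w -> sorted (fun a b : I => (a <= b)%N) (sq w).
  move=> aw; rewrite sorted_map.
  apply: (@sub_sorted _ (relpre val ltn)) => [r r' /= l|].
    by apply: admissible_sorted => //; apply: ltnW.
  by rewrite -sorted_map val_enum_ord iota_ltn_sorted.
have e_sq : sq u = sq v.
  apply: (sorted_eq _ _ (sorted_sq _ au) (sorted_sq _ av)).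
  - by move=> b a c; apply: leq_trans.
  - by move=> a b /= ab; apply: val_inj; apply/eqP; rewrite eqn_leq.
  have cntE w a : count_mem a (sq w) = content w a.
    by rewrite /content count_map -sum1_count big_mkcond big_enum /=;
      apply: eq_bigr => p _ /=; case: eqP.
  by apply/allP => a _ /=; rewrite !cntE e.
have /eq_in_map h := e_sq.
by apply/ffunP => p; apply: h; rewrite mem_enum.
Qed.

Lemma sum_ltn1 n (f g : 'I_n -> nat) p : (forall r, r != p -> f r = g r) ->
  (f p < g p)%N -> (\sum_(r < n) f r < \sum_(r < n) g r)%N.
Proof.
move=> fg l; rewrite (bigD1 p) //= [X in (_ < X)%N](bigD1 p) //=.
by rewrite (eq_bigr _ fg) ltn_add2r.
Qed.

(** Raising by one the last letter which is not maximal leads to a word that is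
    again admissible, the maximal letter being odd; from a vector for that word
    the generator s_{k,k+1} produces one for u. *)
Lemma admissible_vector n (u : word n) : admissible u ->
  exists x, [/\ x \in Vplus M N q n, x u != 0
    & forall v, x v != 0 -> content v =1 content u].
Proof.
have [m] := ubnP (\sum_(p < n) (last_letter - u p))%N; elim: m => // m IHm in u *.
move=> hm au; have [/existsP [p1 up1]|] := boolP [exists p, u p != last_letter]; last first.
  rewrite negb_exists => /forallP h; exists (vlow M N F n); split.
  - exact: generated_mem.
  - rewrite vlowE (_ : [forall _, _]) ?oner_neq0 //.
    by apply/forallP => p; have := h p; rewrite negbK.
  move=> v; rewrite vlowE; case: forallP => [hv _ a|]; last by rewrite eqxx.
  apply: eq_bigr => p _; have := h p; rewrite negbK => /eqP->.
  by rewrite (eqP (hv p)).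
pose p := [arg max_(p > p1 | u p != last_letter) (p : nat)]%N.
have [up pmax] : u p != last_letter /\ forall r, u r != last_letter -> (r <= p)%N.
  by rewrite /p; case: arg_maxnP.
have after (r : 'I_n) : (p < r)%N -> u r = last_letter.
  by move=> l; apply/eqP; apply: contraLR l => /pmax; rewrite -leqNgt.
have klt : (u p < last_letter)%N.
  by rewrite ltn_neqAle le_last_letter andbT; apply: contra up => /eqP/val_inj->.
have k'P : ((u p).+1 < M + N)%N by apply: leq_ltn_trans klt (last_letter_proof M N0).
pose k' : I := Ordinal k'P; have kS : k' = (u p).+1 :> nat by [].
pose w := set_letter u p k'.
have wp : w p = k' by rewrite ffunE eqxx.
have wx r : r != p -> w r = u r by move=> h; rewrite ffunE (negbTE h).
have aw : admissible w.
  apply/admissibleP => r r' l; have [rp|rp] := eqVneq r p; have [r'p|r'p] := eqVneq r' p.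
  - by rewrite rp r'p ltnn in l.
  - rewrite rp wp wx // after -?rp //.
    have [->|ne] := eqVneq k' last_letter; first by right; rewrite last_letter_odd.
    by left; rewrite ltn_neqAle le_last_letter andbT; apply: contra ne => /eqP/val_inj->.
  - by rewrite r'p wp wx //; left; rewrite ltnS admissible_sorted // -r'p ltnW.
  by rewrite !wx //; apply: (admissibleP _ au).
have hw : (\sum_(r < n) (last_letter - w r) < m)%N.
  move: hm; rewrite ltnS; apply: leq_trans; apply: (sum_ltn1 (p := p)) => [r rp|].
    by rewrite wx.
  by rewrite wp kS; apply: ltn_sub2l.
have [x [xV xw xs]] := IHm w hw aw.
have [|||c c0 cE] := raise_sorted q0 kS hq (Vplus_qalt xV) (erefl (u p)).
- by move=> r l; rewrite after // eq_sym.
- exact: admissible_sorted.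
- move=> ue r l; have [h|[h o]] := admissibleP _ au r p l.
    by apply/negP => /eqP h'; rewrite h' ltnn in h.
  by rewrite -h o in ue.
exists (Uq_act q n Uq_s (u p) k' x); split.
- apply: subvP (generated_submodule q (vlow M N F n) Uq_s (u p) k') _ _.
  exact: memv_img.
- by rewrite cE mulf_neq0.
move=> v /(raise_support kS) [r vr xr] a.
have := content_set_letter v r k' a; rewrite (xs _ xr a) vr content_set_letter => /addIn e.
exact/esym.
Qed.

(** Different admissible words have different contents, so the vectors found for
    them only have to be normalized. *)
Lemma dual_basis n : exists d : word n -> tpw n, forall u, admissible u ->
  [/\ d u \in Vplus M N q n & forall v, admissible v -> d u v = (v == u)%:R].
Proof.
have h u : exists x : tpw n, admissible u ->
    x \in Vplus M N q n /\ forall v, admissible v -> x v = (v == u)%:R.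
  have [au|_] := boolP (admissible u); last by exists 0.
  have [x [xV xu xs]] := admissible_vector au.
  exists ((x u)^-1 *: x) => _; split; first exact: memvZ.
  move=> v av; rewrite ffunZE; have [->|ne] := eqVneq v u; first by rewrite mulVf.
  have [->|xv] := eqVneq (x v) 0; first by rewrite mulr0.
  by case/eqP: ne; apply: content_inj => //; apply: xs.
have [d dP] := fin_all_exists h; exists d => u au.
by have [] := dP u au.
Qed.

(** Removing descents, which does not affect the vanishing of a coordinate, ends
    at a sorted word; if this is not admissible it repeats an even letter. *)
Lemma qalt_sort0 n (y : tpw n) : qalt_on q 0 n y ->
  (forall u, admissible u -> y u = 0) -> forall u, y u = 0.
Proof.
move=> hy h u; have [m] := ubnP (\sum_(p < n) (n - p) * u p)%N.
elim: m => // m IHm in u *; move=> hm.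
have [/existsP[p /existsP[p' /andP[/eqP e l]]]|] :=
  boolP [exists p : 'I_n, exists p' : 'I_n, (p' == p.+1 :> nat) && (u p' < u p)%N].
  rewrite -(swap_atK p p' u); apply: (qalt_swap0 q0); first exact: hy.
  apply: IHm; move: hm; rewrite ltnS; apply: leq_trans.
  have pp : p' != p by rewrite -val_eqE /= e gtn_eqF.
  rewrite (bigD1 p) //= (bigD1 p') //= [leqRHS](bigD1 p) //= [X in (_ <= _ + X)%N](bigD1 p') //=.
  rewrite swap_at_l swap_at_r (eq_bigr (fun r : 'I_n => (n - r) * u r)%N); last first.
    by move=> r /andP[r1 r2]; rewrite swap_at_x.
  rewrite e; have -> : (n - p = (n - p.+1).+1)%N by have := ltn_ord p; lia.
  have aux a b c d S : (a < b -> a + c + (d + S) < b + d + (c + S))%N by lia.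
  by rewrite !mulSn; apply: aux.
rewrite negb_exists => /forallP sorted1.
have adj (p p' : 'I_n) : p' = p.+1 :> nat -> (u p <= u p')%N.
  move=> e; have := sorted1 p; rewrite negb_exists => /forallP/(_ p').
  by rewrite e eqxx /= -leqNgt.
have su (r r' : 'I_n) : (r <= r')%N -> (u r <= u r')%N.
  have [k] := ubnP (r' - r); elim: k => // k IHk in r r' * => hk.
  rewrite leq_eqVlt => /orP[/eqP/val_inj->//|l].
  have rn : (r.+1 < n)%N by apply: leq_ltn_trans l (ltn_ord r').
  apply: leq_trans (adj r (Ordinal rn) erefl) _; apply: IHk => //=; lia.
have [au|] := boolP (admissible u); first exact: h.
rewrite negb_forall => /existsP[r]; rewrite negb_forall => /existsP[r'].
rewrite negb_imply negb_or negb_and => /andP[l /andP[h1 h2]].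
have ee : u r = u r'.
  by apply: val_inj; apply/eqP; rewrite eqn_leq [X in _ && X]leqNgt h1 su // ltnW.
apply: (qalt_on_repeat q0 hy _ l (ltn_ord _) ee) => //.
by move: h2; rewrite ee eqxx.
Qed.

Lemma qalt_expand n (d : word n -> tpw n) (y : tpw n) :
  (forall u, admissible u ->
    [/\ d u \in Vplus M N q n & forall v, admissible v -> d u v = (v == u)%:R]) ->
  qalt_on q 0 n y -> y = \sum_(u | admissible u) y u *: d u.
Proof.
move=> hd hy; apply/eqP; rewrite -subr_eq0; apply/eqP/ffunP => u; rewrite [RHS]ffunE.
apply: (qalt_sort0 (y := y - _)) => [p p' e h h'|v av].
  rewrite -scaleN1r; apply: qaltD; first exact: hy.
  apply: qaltZ; elim/big_ind: _ => [|a b|w aw]; [exact: qalt0|exact: qaltD|].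
  by apply: qaltZ; have [dV _] := hd w aw; apply: (Vplus_qalt dV).
rewrite !ffunE sum_ffunE (bigD1 v) //= big1 => [|w /andP[aw wv]].
  by rewrite ffunZE (hd v av).2 // eqxx mulr1 addr0 subrr.
by rewrite ffunZE (hd w aw).2 // eq_sym (negbTE wv) mulr0.
Qed.

Lemma VplusP n y : reflect (qalt_on q 0 n y) (y \in Vplus M N q n).
Proof.
apply: (iffP idP) => [|hy]; first exact: Vplus_qalt.
have [d hd] := dual_basis n; rewrite (qalt_expand hd hy).
by apply: memv_suml => u au; apply: memvZ; have [] := hd u au.
Qed.

End VplusCharacterization.

(** * Highest weight vectors and tensor products of two blocks *)

Section HighestWeight.

Variables (M N : nat) (F : fieldType) (q : F).

Lemma tperm_adj_mono s (p p' i j : 'I_s) : p' = p.+1 :> nat -> (i < j)%N ->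
  (i, j) != (p, p') -> (tperm p p' i < tperm p p' j)%N.
Proof.
move=> e l ne; have ne' : ~ (i = p /\ j = p') by move=> [ip jp]; rewrite ip jp eqxx in ne.
have v (a b : 'I_s) : a != b -> nat_of_ord a <> b by move=> h /val_inj ab; rewrite ab eqxx in h.
case: (tpermP p p' i) => [ip|ip|/eqP/v ip /eqP/v ip'];
  case: (tpermP p p' j) => [jp|jp|/eqP/v jp /eqP/v jp']; subst; try lia.
by case: ne'.
Qed.

(** Apart from (p, p') the inversions of the product correspond to those of h
    through the transposition. *)
Lemma plength_swap s (h : 'S_s) (p p' : 'I_s) : p' = p.+1 :> nat ->
  (h p < h p')%N -> plength (tperm p p' * h)%g = (plength h).+1.
Proof.
move=> e l; rewrite /plength; set A := [set _ | _]; set B := [set _ | _].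
pose phi (ij : 'I_s * 'I_s) := (tperm p p' ij.1, tperm p p' ij.2).
have phiK : involutive phi by move=> [i j]; rewrite /phi /= !tpermK.
have pp : (p < p')%N by rewrite e.
have nB : phi (p, p') \notin B by rewrite inE /= tpermL tpermR ltnNge ltnW.
have nB' : (p, p') \notin B by rewrite inE /= [X in _ && X]ltnNge (ltnW l) andbF.
have memphi ij : (ij \in phi @: B) = (phi ij \in B).
  by rewrite -{1}[ij]phiK mem_imset //; apply: inv_inj.
suff -> : A = (p, p') |: phi @: B.
  by rewrite cardsU1 card_imset ?memphi ?nB //; apply: inv_inj.
apply/setP => ij; rewrite in_setU1 memphi /A inE.
case: ij => i j; have [[-> ->]|ne] := eqVneq (i, j) (p, p').
  by rewrite /= !permM tpermL tpermR pp l.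
rewrite /= !inE /= !permM; apply/andP/andP => -[h1 h2]; split=> //.
  exact: tperm_adj_mono.
rewrite -(tpermK p p' i) -(tpermK p p' j); apply: tperm_adj_mono => //.
apply/negP => /eqP [ei ej]; rewrite ei ej in h2.
by rewrite ltnNge (ltnW l) in h2.
Qed.

Lemma vhighE s (u : mindex M N s) : vhigh M N q s u =
  \sum_(g : 'S_s) (- q) ^+ plength g * [forall p, u p == g p :> nat]%:R.
Proof. by rewrite sum_ffunE; apply: eq_bigr => g _; rewrite ffunZE ffunE. Qed.

Lemma vhigh_qalt s : (s <= M)%N -> qalt_on q 0 s (vhigh M N q s).
Proof.
move=> sM p p' e _ _ u; have pp : p != p' by rewrite -val_eqE /= e ltn_eqF.
split=> [eu _|l].
  rewrite vhighE big1 // => g _; case: forallP => [h|_]; last by rewrite mulr0.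
  have /eqP h1 := h p; have /eqP h2 := h p'.
  by case/eqP: pp; apply: (@perm_inj _ g); apply: val_inj; rewrite /= -h1 -h2 eu.
rewrite !vhighE (reindex_inj (mulgI (tperm p p'))) big_distrr /=.
apply: eq_bigr => g _.
have -> : [forall r, swap_at p p' u r == (tperm p p' * g)%g r :> nat]
    = [forall r, u r == g r :> nat].
  apply/forallP/forallP => h r; last by rewrite permM ffunE h.
  by have := h (tperm p p' r); rewrite permM ffunE tpermK.
case: forallP => [h|_]; last by rewrite !mulr0.
have /eqP h1 := h p; have /eqP h2 := h p'.
rewrite plength_swap -?h1 -?h2 // exprS !mulr1 -!mulrA; congr (_ * _).
by rewrite /is_odd h1 leqNgt (leq_trans (ltn_ord _) sM) bsign0 mul1r.
Qed.

End HighestWeight.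

Section TwoBlocks.

Variables (M N s t : nat).
Local Notation I := 'I_(M + N).
Local Notation word := (mindex M N).

Definition word_cat (u : word s) (v : word t) : word (s + t) :=
  [ffun p => match split p with inl a => u a | inr b => v b end].
Definition left_word (w : word (s + t)) : word s := [ffun p => w (lshift t p)].
Definition right_word (w : word (s + t)) : word t := [ffun p => w (rshift s p)].

Lemma word_cat_l u v p : word_cat u v (lshift t p) = u p.
Proof. by rewrite ffunE; case: splitP => [a /= /val_inj ->//|b /= e]; have := ltn_ord p; lia. Qed.

Lemma word_cat_r u v p : word_cat u v (rshift s p) = v p.
Proof.
rewrite ffunE; case: splitP => [a /= e|b /= /addnI/val_inj ->//].
by have := ltn_ord a; lia.
Qed.

Lemma word2_ext (w w' : word (s + t)) : (forall p, w (lshift t p) = w' (lshift t p)) ->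
  (forall p, w (rshift s p) = w' (rshift s p)) -> w = w'.
Proof. by move=> hl hr; apply/ffunP => p; case: (splitP p) => a e;
  [have -> : p = lshift t a by apply: val_inj | have -> : p = rshift s a by apply: val_inj]. Qed.

Lemma word_cat_eta w : word_cat (left_word w) (right_word w) = w.
Proof. by apply: word2_ext => p; rewrite ?word_cat_l ?word_cat_r ffunE. Qed.
Lemma left_word_cat u v : left_word (word_cat u v) = u.
Proof. by apply/ffunP => p; rewrite ffunE word_cat_l. Qed.
Lemma right_word_cat u v : right_word (word_cat u v) = v.
Proof. by apply/ffunP => p; rewrite ffunE word_cat_r. Qed.

Let lrneq p r : lshift t p != rshift s r :> 'I_(s + t).
Proof. by rewrite eq_lrshift. Qed.

Lemma swap_at_cat_l u v (p p' : 'I_s) :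
  swap_at (lshift t p) (lshift t p') (word_cat u v) = word_cat (swap_at p p' u) v.
Proof.
apply: word2_ext => r; last by rewrite swap_at_x ?word_cat_r // eq_sym.
rewrite word_cat_l; have [->|h] := eqVneq r p; first by rewrite !swap_at_l word_cat_l.
have [->|h'] := eqVneq r p'; first by rewrite !swap_at_r word_cat_l.
by rewrite !swap_at_x ?word_cat_l // (inj_eq (@lshift_inj _ _)).
Qed.

Lemma swap_at_cat_r u v (p p' : 'I_t) :
  swap_at (rshift s p) (rshift s p') (word_cat u v) = word_cat u (swap_at p p' v).
Proof.
apply: word2_ext => r; first by rewrite swap_at_x ?word_cat_l.
rewrite word_cat_r; have [->|h] := eqVneq r p; first by rewrite !swap_at_l word_cat_r.
have [->|h'] := eqVneq r p'; first by rewrite !swap_at_r word_cat_r.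
by rewrite !swap_at_x ?word_cat_r // (inj_eq (@rshift_inj _ _)).
Qed.

Section Blocks.
Variables (K : idomainType) (Q : K).

Lemma qalt_block_l (z : tpow M N K (s + t)) : qalt_on Q 0 s z <->
  forall v, qalt_on Q 0 s [ffun u => z (word_cat u v)].
Proof.
split=> [h v p p' e _ _ u|h p p' e _ ps w].
  have := h (lshift t p) (lshift t p') e isT (ltn_ord p') (word_cat u v).
  by rewrite swap_at_cat_l !word_cat_l !ffunE.
have pl : (p < s)%N by rewrite e in ps; apply: ltnW.
have -> : p = lshift t (Ordinal pl) by apply: val_inj.
have -> : p' = lshift t (Ordinal ps) by apply: val_inj.
have := h (right_word w) (Ordinal pl) (Ordinal ps) e isT ps (left_word w).
by rewrite !ffunE -swap_at_cat_l word_cat_eta.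
Qed.

Lemma qalt_block_r (z : tpow M N K (s + t)) : qalt_on Q s (s + t) z <->
  forall u, qalt_on Q 0 t [ffun v => z (word_cat u v)].
Proof.
split=> [h u p p' e _ _ v|h p p' e ps _ w].
  have := h (rshift s p) (rshift s p') _ _ _ (word_cat u v).
  rewrite swap_at_cat_r !word_cat_r !ffunE; apply=> //=; rewrite ?e ?addnS ?leq_addr //.
  by rewrite -addnS ltn_add2l -e.
have pl : (p - s < t)%N by have := ltn_ord p; lia.
have pl' : (p' - s < t)%N by have := ltn_ord p'; lia.
have -> : p = rshift s (Ordinal pl) by apply: val_inj; rewrite /= subnKC.
have -> : p' = rshift s (Ordinal pl') by apply: val_inj; rewrite /= subnKC //; lia.
have := h (left_word w) (Ordinal pl) (Ordinal pl') _ _ _ (right_word w).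
by rewrite !ffunE -swap_at_cat_r word_cat_eta; apply=> //=; lia.
Qed.
End Blocks.

Variables (F : fieldType) (q : F).

Lemma tprod_cat (x : tpow M N F s) (y : tpow M N F t) u v :
  tprod x y (word_cat u v) = x u * y v.
Proof. by rewrite ffunE -/(left_word _) -/(right_word _) left_word_cat right_word_cat. Qed.

Lemma tprod_qalt (x : tpow M N F s) (y : tpow M N F t) :
  qalt_on q 0 s x -> qalt_on q 0 t y ->
  qalt_on q 0 s (tprod x y) /\ qalt_on q s (s + t) (tprod x y).
Proof.
move=> hx hy; split.
  apply/qalt_block_l => v.
  rewrite (_ : [ffun _ => _] = y v *: x); last first.
    by apply/ffunP => u; rewrite ffunE tprod_cat ffunZE mulrC.
  by move=> p p' e h h'; apply: qaltZ; apply: hx.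
apply/qalt_block_r => u.
rewrite (_ : [ffun _ => _] = x u *: y); last first.
  by apply/ffunP => v; rewrite ffunE tprod_cat ffunZE.
by move=> p p' e h h'; apply: qaltZ; apply: hy.
Qed.

Lemma tprodDl (x x' : tpow M N F s) (y : tpow M N F t) c :
  tprod (c *: x + x') y = c *: tprod x y + tprod x' y.
Proof. by apply/ffunP => w; rewrite !ffunE /GRing.scale /=; ring. Qed.

Lemma tprodDr (x : tpow M N F s) (y y' : tpow M N F t) c :
  tprod x (c *: y + y') = c *: tprod x y + tprod x y'.
Proof. by apply/ffunP => w; rewrite !ffunE /GRing.scale /=; ring. Qed.

Lemma tprod0l (y : tpow M N F t) : tprod (0 : tpow M N F s) y = 0.
Proof. by apply/ffunP => w; rewrite !ffunE mul0r. Qed.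
Lemma tprod0r (x : tpow M N F s) : tprod x (0 : tpow M N F t) = 0.
Proof. by apply/ffunP => w; rewrite !ffunE mulr0. Qed.

Lemma mem_tensv (U : {vspace tpow M N F s}) (W : {vspace tpow M N F t}) x y :
  x \in U -> y \in W -> tprod x y \in tensv U W.
Proof.
move=> xU yW; rewrite (coord_vbasis xU); elim/big_rec: _ => [|i x' _ IHx].
  by rewrite tprod0l mem0v.
rewrite tprodDl memvD // memvZ // (coord_vbasis yW).
elim/big_rec: _ => [|j y' _ IHy]; first by rewrite tprod0r mem0v.
rewrite tprodDr memvD // memvZ //; apply: memv_span.
by apply: allpairs_f; apply: mem_nth; rewrite size_tuple.
Qed.

Hypotheses (q0 : q != 0) (hq : forall n : nat, (0 < n)%N -> q ^+ n != 1)
  (N0 : (0 < N)%N).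

(** A tensor antisymmetric in both blocks is expanded along the dual basis, first
    in one block and then in the other. *)
Lemma Vplus2P (z : tpow M N F (s + t)) :
  z \in Vplus2 M N q s t <-> qalt_on q 0 s z /\ qalt_on q s (s + t) z.
Proof.
split=> [zV|[zl zr]].
  move: zV; rewrite /Vplus2 /tensv; set X := [seq _ | _ <- _, _ <- _] => zV.
  rewrite (@coord_span _ _ _ (in_tuple X) z zV).
  have hX w : w \in X -> qalt_on q 0 s w /\ qalt_on q s (s + t) w.
    move=> /allpairsP [[x y] [/= xU yW ->]]; apply: tprod_qalt;
      apply/(VplusP q0 hq N0); exact: vbasis_mem.
  elim/big_ind: _ => [|a b [a1 a2] [b1 b2]|i _].
  - by split=> p p' e h h'; apply: qalt0.
  - by split=> p p' e h h'; apply: qaltD; [apply: a1|apply: b1|apply: a2|apply: b2].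
  have [|h1 h2] := hX ((in_tuple X)`_i); first by apply: mem_nth.
  by split=> p p' e h h'; apply: qaltZ; [apply: h1|apply: h2].
have [d hd] := @dual_basis M N F q q0 hq N0 s; have [d' hd'] := @dual_basis M N F q q0 hq N0 t.
have -> : z = \sum_(u | admissible u) \sum_(v | admissible v)
    z (word_cat u v) *: tprod (d u) (d' v).
  apply/ffunP => w; rewrite -(word_cat_eta w); move: (left_word w) (right_word w) => u v.
  have /(qalt_expand q0 N0 hd) /(congr1 (fun f : tpow M N F s => f u)) :=
    iffLR (qalt_block_l q z) zl v.
  rewrite ffunE => ->; rewrite !sum_ffunE; apply: eq_bigr => u' au'.
  have /(qalt_expand q0 N0 hd') /(congr1 (fun f : tpow M N F t => f v)) :=
    iffLR (qalt_block_r q z) zr u'.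
  rewrite ffunE ffunZE ffunE => ->; rewrite !sum_ffunE big_distrl /=.
  by apply: eq_bigr => v' av'; rewrite !ffunZE tprod_cat ffunE; ring.
apply: memv_suml => u au; apply: memv_suml => v av; apply: memvZ.
by apply: mem_tensv; [have [] := hd u au | have [] := hd' v av].
Qed.

End TwoBlocks.

(** * Denominators *)

Lemma common_factor_cancel (K : fieldType) (e c g n d : K) :
  e != 0 -> d != 0 -> g != 0 ->
  c * (n * g) / (e * (d * g)) = c * e^-1 * (n / d).
Proof. by move=> e0 d0 g0; field; rewrite e0 d0 g0. Qed.

Section Denominators.

Variables (M N : nat) (F : fieldType) (q : F).
Hypothesis q0 : q != 0.
Hypothesis hq : forall n : nat, (0 < n)%N -> q ^+ n != 1.
Hypothesis N0 : (0 < N)%N.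
Variables s t : nat.
Local Notation P := {mpoly F[2]}.
Local Notation Q := (q%:MP : P).
Local Notation tpw := (tpow M N F (s + t)).
Local Notation W := (Vplus2 M N q s t).

Lemma bsign_mpolyC b : bsign P b = (bsign F b)%:MP.
Proof. by case: b; rewrite ?bsign0 ?bsign1 ?mpolyCN mpolyC1. Qed.

Lemma tpoly_qalt a b (x : tpw) : qalt_on q a b x -> qalt_on Q a b (tpoly x).
Proof.
move=> hx p p' e h h' u; have [h1 h2] := hx p p' e h h' u; rewrite !ffunE.
split=> [eu o|l]; first by rewrite h1.
by rewrite h2 // !mpolyCM mpolyCN bsign_mpolyC.
Qed.

Definition tcoef m (z : tpow M N P (s + t)) : tpw := [ffun w => (z w)@_m].

Lemma tcoef_qalt a b m z : qalt_on Q a b z -> qalt_on q a b (tcoef m z).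
Proof.
move=> hz p p' e h h' u; have [h1 h2] := hz p p' e h h' u; rewrite !ffunE.
split=> [eu o|l]; first by rewrite h1 // mcoeff0.
by rewrite h2 // bsign_mpolyC -mpolyCN -mpolyCM mcoeffCM.
Qed.

Lemma tpolyD c (x y : tpw) : tpoly (c *: x + y) = c%:MP *: tpoly x + tpoly y.
Proof.
apply/ffunP => w; rewrite [RHS]ffunE ffunZE !ffunE /GRing.scale /=.
by rewrite mpolyCD mpolyCM.
Qed.

Lemma op_degree_bound (A : 'End(tpow M N P (s + t))) :
  exists d, forall x w, (msize (A (tpoly x) w) <= d)%N.
Proof.
exists (\max_u \max_w msize (A (tbase P u) w)) => x w.
rewrite lin_coord; apply: (big_ind (fun p : P => (msize p <= _)%N)) => [|p p' hp hp'|u _].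
- by rewrite msize0.
- by apply: leq_trans (msizeD_le _ _) _; rewrite geq_max hp hp'.
rewrite ffunE mul_mpolyC; apply: leq_trans (msizeZ_le _ _) _.
by apply: leq_trans (leq_bigmax u); apply: (leq_bigmax (F := fun w => msize (A (tbase P u) w))).
Qed.

Section CommonFactor.

Variables (A : 'End(tpow M N P (s + t))) (G X D : P) (c : F).
Hypotheses (G0 : G != 0) (D0 : D != 0) (c0 : c != 0) (XE : X = c *: (D * G)).
Hypothesis AG : forall x : tpw, x \in W -> exists x', A (tpoly x) = G *: x'.
Hypothesis AW : forall x : tpw, x \in W ->
  qalt_on Q 0 s (A (tpoly x)) /\ qalt_on Q s (s + t) (A (tpoly x)).

(** The quotient by G is unique, hence linear in x; its coefficients satisfy the
    same antisymmetry conditions, so they remain in W. *)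
Lemma op_polynomial :
  is_op_polynomial (fun x w => tofrac D * restr_div (W := W) X A x w).
Proof.
have [d dP] := op_degree_bound A.
have exq (x : subvs_of W) : exists x', A (tpoly (vsval x)) == G *: x'.
  by have [x' e] := AG (subvsP x); exists x'; rewrite e.
pose g x := xchoose (exq x).
have gE x : A (tpoly (vsval x)) = G *: g x by apply/eqP; apply: (xchooseP (exq x)).
have gw x w : A (tpoly (vsval x)) w = G * g x w by rewrite gE ffunZE.
have g_lin a x y w : g (a *: x + y) w = a *: g x w + g y w.
  apply: (mulfI G0); rewrite -gw mulrDr -scalerAr -!gw.
  by rewrite linearP tpolyD linearP /= [LHS]ffunE ffunZE mul_mpolyC.
have gW x m : tcoef m (g x) \in W.
  have [h1 h2] := AW (subvsP x); rewrite gE in h1 h2.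
  apply: (iffRL (@Vplus2P M N s t F q q0 hq N0 _)); split; apply: tcoef_qalt;
     apply: (qalt_on_Zinv G0); assumption.
pose b (m : 'X_{1..2}) (x : subvs_of W) : subvs_of W := vsproj W (c^-1 *: tcoef m (g x)).
have b_lin m : linear (b m).
  move=> a x y; rewrite /b -linearP /=; congr (vsproj _ _).
  apply/ffunP => w; rewrite ffunZE [RHS]ffunE !ffunZE !ffunE g_lin mcoeffD mcoeffZ.
  by ring.
pose bL m := GRing.isLinear.Build _ _ _ _ (b m) (b_lin m).
pose bF m : {linear subvs_of W -> subvs_of W} := HB.pack (b m) (bL m).
exists d, (fun m => linfun (bF m)) => x w.
have X0 : X != 0 by rewrite XE -mul_mpolyC !mulf_neq0 ?mpolyC_eq0.
have fX0 : tofrac X != 0 by rewrite tofrac_eq0.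
rewrite /restr_div gw; apply: (mulfI fX0).
rewrite mulrCA mulVKf // -!tofracM; congr (tofrac _).
have -> : \sum_(m : 'X_{1..2 < d}) (vsval (linfun (bF m) x) w : F) *: 'X_[m]
    = c^-1 *: g x w.
  have sz : (msize (c^-1 *: g x w) <= d)%N.
    apply: leq_trans (msizeZ_le _ _) _; apply: leq_trans (dP (vsval x) w).
    have [->|gx0] := eqVneq (g x w) 0; first by rewrite msize0.
    by apply: (msize_dvd (h := G)); rewrite ?gw 1?mulrC // mulf_neq0.
  rewrite [RHS](mpolywE sz); apply: eq_bigr => m _; congr (_ *: _).
  have bE : vsval (b m x) = c^-1 *: tcoef m (g x).
    by apply: vsprojK; apply: memvZ; apply: gW.
  by rewrite lfunE [bF m x]/= bE ffunZE ffunE mcoeffZ.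
rewrite XE -!mul_mpolyC -[LHS]mul1r -mpolyC1 -(mulfV c0) mpolyCM; ring.
Qed.

(** At the coordinate w of A x, clearing the denominator of E / D forces D to
    divide D' E, and D is coprime to E. *)
Lemma denominator_min (r : seq nat) (f : nat -> F) (E : P) (e : F) x w (D' : P) :
  D = \prod_(k <- r) lform 1 (f k) -> (forall k, k \in r -> line (f k) E != 0) ->
  e != 0 -> x \in W -> A (tpoly x) w = e *: (E * G) ->
  clears (restr_div (W := W) X A) D' -> (msize D <= msize D')%N.
Proof.
move=> DE fE e0 xW AE [D'0 _ [d [B hB]]].
have X0 : X != 0 by rewrite XE -mul_mpolyC !mulf_neq0 ?mpolyC_eq0.
have := hB (vsproj W x) w; set p := (X in _ = tofrac X).
rewrite /restr_div vsprojK // AE => /(congr1 (fun y => tofrac X * y)).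
have fX0 : tofrac X != 0 by rewrite tofrac_eq0.
rewrite mulrCA mulVKf // -!tofracM => /eqP; rewrite tofrac_eq => /eqP h.
have [h' hD'] : exists h', D' = (\prod_(k <- r) lform 1 (f k)) * h'.
  apply: (prod_lform_dvd (E := E) (H := (e^-1 * c) *: p)) => //.
  rewrite -DE; have eG0 : e%:MP * G != 0 by rewrite mulf_neq0 // mpolyC_eq0.
  apply: (mulfI eG0); transitivity (D' * (e *: (E * G))).
    by rewrite -mul_mpolyC; ring.
  rewrite h XE -!mul_mpolyC mpolyCM.
  transitivity ((e%:MP * (e^-1)%:MP) * (c%:MP * (D * G) * p)); last by ring.
  by rewrite -mpolyCM mulfV // mpolyC1 mul1r.
by rewrite DE; apply: msize_dvd hD'.
Qed.

End CommonFactor.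

(** Each denominator is tested on the vector of the other eigenvalue: up to
    scalars A y has the coordinate D G at w', and A x the coordinate N G at w. *)
Lemma denominators (A : 'End(tpow M N P (s + t))) (G X Y : P) (r : seq nat)
    (f g : nat -> F) (x y : tpw) (w w' : mindex M N (s + t)) :
  G != 0 ->
  eq_upto X ((\prod_(k <- r) lform 1 (f k)) * G) ->
  eq_upto Y ((\prod_(k <- r) lform 1 (g k)) * G) ->
  (forall k l, k \in r -> l \in r -> f k != g l) ->
  (forall z : tpw, z \in W -> exists z', A (tpoly z) = G *: z') ->
  (forall z : tpw, z \in W ->
     qalt_on Q 0 s (A (tpoly z)) /\ qalt_on Q s (s + t) (A (tpoly z))) ->
  x \in W -> eq_upto (A (tpoly x) w) X -> y \in W -> eq_upto (A (tpoly y) w') Y ->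
  let cN := \prod_(k <- r) lform 1 (f k) in
  let cD := \prod_(k <- r) lform 1 (g k) in
  [/\ exists2 c : F, c != 0 &
        tofrac X / tofrac Y = tofrac c%:MP * (tofrac cN / tofrac cD),
      is_denominator (restr_div (W := W) X A) cN
    & is_denominator (restr_div (W := W) Y A) cD].
Proof.
move=> G0 XN YD fg AG AW xW Ax yW Ay cN cD.
have cN0 : cN != 0 by apply: prod_lform_neq0.
have cD0 : cD != 0 by apply: prod_lform_neq0.
have [c c0 XE] := XN; have [e e0 YE] := YD.
have [c' c'0 AxE] := eq_upto_trans Ax XN; have [e' e'0 AyE] := eq_upto_trans Ay YD.
split.
- exists (c / e); first by rewrite mulf_neq0 ?invr_eq0.
  rewrite XE YE -!mul_mpolyC !tofracM mpolyCM tofracM.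
  have -> : tofrac (e^-1)%:MP = (tofrac e%:MP)^-1 :> {fraction P}.
    have fe0 : tofrac (e%:MP : P) != 0 by rewrite tofrac_eq0 mpolyC_eq0.
    by apply: (mulfI fe0); rewrite -tofracM -mpolyCM mulfV // mpolyC1 tofrac1 mulfV.
  have := G0; have := cD0; have : (e%:MP : P) != 0 by rewrite mpolyC_eq0.
  rewrite -!(tofrac_eq0 (R := P)) /cN /cD.
  exact: common_factor_cancel.
- split; first split => //.
  + exact: prod_lform_homog.
  + exact: (op_polynomial G0 cN0 c0 XE AG AW).
  move=> D'; apply: (denominator_min G0 cN0 c0 XE (erefl cN) _ e'0 yW AyE).
  by move=> k kr; apply: line_prod_lform => l lr; apply: fg.
- split; first split => //.
  + exact: prod_lform_homog.
  + exact: (op_polynomial G0 cD0 e0 YE AG AW).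
  move=> D'; apply: (denominator_min G0 cD0 e0 YE (erefl cD) _ c'0 xW AxE).
  by move=> k kr; apply: line_prod_lform => l lr; rewrite eq_sym; apply: fg.
Qed.

End Denominators.

(** * The theorem *)

Section HighestWord.

Variables (M N : nat) (F : fieldType) (q : F).
Hypothesis q0 : q != 0.

Lemma id_word_proof s (sM : (s <= M)%N) (p : 'I_s) : (p < M + N)%N.
Proof. by apply: leq_trans (leq_addr _ _); apply: leq_trans sM. Qed.

Definition id_word s (sM : (s <= M)%N) : mindex M N s := [ffun p => Ordinal (id_word_proof sM p)].

Lemma vhigh_id_word s (sM : (s <= M)%N) : vhigh M N q s (id_word sM) != 0.
Proof.
rewrite vhighE (bigD1 1%g) //= big1 => [|g g1].
  rewrite (_ : [forall _, _]) ?mulr1 ?addr0 ?expf_neq0 ?oppr_eq0 //.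
  by apply/forallP => p; rewrite ffunE perm1.
rewrite (_ : [forall _, _] = false) ?mulr0 //; apply: contraNF g1 => /forallP h.
by apply/eqP/permP => p; apply: val_inj; have /eqP := h p; rewrite ffunE perm1 /= => <-.
Qed.

End HighestWord.

Lemma fused_R_denominators M N (F : fieldType) (q : F) (N0 : (0 < N)%N)
    (q0 : q != 0) (hq : forall n : nat, (0 < n)%N -> q ^+ n != 1)
    s t (hs : (1 <= s <= M)%N) (ht : (1 <= t <= M)%N) (X Y : {mpoly F[2]}) :
  Rst M N q s t (tpoly (tprod (vhigh M N q s) (vhigh M N q t)))
    = X *: tpoly (tprod (vhigh M N q s) (vhigh M N q t)) ->
  Rst M N q s t (tpoly (vlow M N F (s + t))) = Y *: tpoly (vlow M N F (s + t)) ->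
  let u := minn s t in
  let cN := \prod_(1 <= j < u.+1) (pa F - q ^- (2 * (t - u + j)) *: pb F) in
  let cD := \prod_(1 <= j < u.+1) (pa F - q ^+ (2 * (s - u + j)) *: pb F) in
  [/\ exists2 c : F, c != 0 &
        tofrac X / tofrac Y = tofrac c%:MP * (tofrac cN / tofrac cD),
      is_denominator (restr_div (W := Vplus2 M N q s t) X (Rst M N q s t)) cN
    & is_denominator (restr_div (W := Vplus2 M N q s t) Y (Rst M N q s t)) cD].
Proof.
move=> hX hY u; have [s0 sM] := andP hs; have [t0 tM] := andP ht.
set vh := tprod _ _ in hX; set vl := vlow _ _ _ _ in hY.
rewrite (cN_lform q u s t) (cD_lform q u s t).
pose wh := word_cat (id_word N sM) (id_word N tM).
pose wl : mindex M N (s + t) := [ffun _ => last_letter M N0].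
have vhW : vh \in Vplus2 M N q s t.
  by apply/(Vplus2P q0 hq N0); apply: tprod_qalt; apply: vhigh_qalt.
have vlW : vl \in Vplus2 M N q s t.
  have h := vlow_qalt q N0 (n := s + t) : qalt_on q 0 (s + t) vl.
  apply/(Vplus2P q0 hq N0); split; apply: qalt_on_sub h => //; exact: leq_addr.
have qaltR z : z \in Vplus2 M N q s t ->
    qalt_on q%:MP 0 s (tpoly z) /\ qalt_on q%:MP s (s + t) (tpoly z).
  by move=> /(Vplus2P q0 hq N0) [h1 h2]; split; apply: tpoly_qalt.
have AW z : z \in Vplus2 M N q s t ->
    qalt_on q%:MP 0 s (Rst M N q s t (tpoly z)) /\
    qalt_on q%:MP s (s + t) (Rst M N q s t (tpoly z)).
  by move=> /qaltR [h1 h2]; split; [apply: Rst_qalt_l|apply: Rst_qalt_r].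
have vh0 : vh wh != 0 by rewrite tprod_cat mulf_neq0 ?vhigh_id_word.
have vl1 : vl wl = 1.
  rewrite /vl vlowE (_ : [forall _, _]) //.
  by apply/forallP => p; rewrite ffunE.
have tpE (z : tpow M N F (s + t)) w : tpoly z w = (z w)%:MP by rewrite ffunE.
have AX : Rst M N q s t (tpoly vh) wh = X * (vh wh)%:MP by rewrite hX ffunZE tpE.
have AY : Rst M N q s t (tpoly vl) wl = Y by rewrite hY ffunZE tpE vl1 mpolyC1 mulr1.
have pX : eq_upto (Rst M N q s t (tpoly vh) wh) X.
  by rewrite AX mulrC; apply: eq_uptoC.
have pY : eq_upto (Rst M N q s t (tpoly vl) wl) Y by rewrite AY; apply: eq_upto_refl.
have YE := Rst_const_odd q0 hq s0 t0 (tpoly vl) (u := wl) (e := last_letter M N0)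
  (fun p => ffunE _ p) (last_letter_odd M N0).
rewrite AY tpE vl1 mpolyC1 mulr1 in YE.
have [vhl vhr] := qaltR _ vhW.
have vhC0 : ((vh wh)%:MP : {mpoly F[2]}) != 0 by rewrite mpolyC_eq0.
have differ k l : k \in iota 1 u -> l \in iota 1 u ->
    q ^- (2 * (t - u + k)) != q ^+ (2 * (s - u + l)).
  by rewrite !mem_iota => hk hl; apply: powers_differ => //; lia.
have [ts|st] := leqP t s.
- have ut : u = t by rewrite /u; apply/minn_idPr.
  apply: (denominators q0 hq N0 (G := \prod_(j <- iota 1 t) \prod_(k <- iota 2 s.-1)
    (za q k - wb q j)) (x := vh) (y := vl) (w := wh) (w' := wl)) => //.
  + elim/big_rec: _ => [|j p _ p0]; first exact: oner_neq0.
    by rewrite mulf_neq0 // prod_forms_neq0.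
  + have small_wh : letters_below s wh.
      move=> p; rewrite /wh -[p]splitK; case: (split p) => r /=.
        by rewrite word_cat_l ffunE /= ltn_ord.
      by rewrite word_cat_r ffunE /=; apply: leq_trans (ltn_ord r) ts.
    have := Rst_eigen_l q0 hq s0 t0 ts sM vhl small_wh.
    rewrite AX tpE => /(mulIf vhC0) ->; rewrite ut.
    exact: scalar_high_l.
  + rewrite YE ut; exact: scalar_low_l.
  + by move=> z /qaltR [h1 _]; apply: Rst_divides_l.
- have us : u = s by rewrite /u; apply/minn_idPl; apply: ltnW.
  have st' := ltnW st.
  apply: (denominators q0 hq N0 (G := \prod_(i <- iota 1 s) \prod_(k <- iota 2 t.-1)
    (za q i - wb q (t.+1 - k))) (x := vh) (y := vl) (w := wh) (w' := wl)) => //.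
  + elim/big_rec: _ => [|j p _ p0]; first exact: oner_neq0.
    by rewrite mulf_neq0 // prod_forms_neq0.
  + have small_wh : letters_below t wh.
      move=> p; rewrite /wh -[p]splitK; case: (split p) => r /=.
        by rewrite word_cat_l ffunE /=; apply: ltn_trans (ltn_ord r) st.
      by rewrite word_cat_r ffunE /= ltn_ord.
    have := Rst_eigen_r q0 hq s0 t0 st' tM vhr small_wh.
    rewrite AX tpE => /(mulIf vhC0) ->; rewrite us.
    exact: scalar_high_r.
  + rewrite YE us; exact: scalar_low_r.
  + by move=> z /qaltR [_ h2]; apply: Rst_divides_r.
Qed.

Theorem theorem4p2 (R : realType) (M N : nat) (q : R[i])
    (hM : (1 <= M)%N) (hN : (1 <= N)%N)
    (hq0 : q != 0) (hq : forall n : nat, (0 < n)%N -> q ^+ n != 1)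
    (s t : nat) (hs : (1 <= s <= M)%N) (ht : (1 <= t <= M)%N)
    (X Y : {mpoly R[i][2]})
    (hX : Rst M N q s t (tpoly (tprod (vhigh M N q s) (vhigh M N q t)))
          = X *: tpoly (tprod (vhigh M N q s) (vhigh M N q t)))
    (hY : Rst M N q s t (tpoly (vlow M N R[i] (s + t)))
          = Y *: tpoly (vlow M N R[i] (s + t))) :
  let u := minn s t in
  let cN := \prod_(1 <= j < u.+1) (pa R[i] - q ^- (2 * (t - u + j)) *: pb R[i]) in
  let cD := \prod_(1 <= j < u.+1) (pa R[i] - q ^+ (2 * (s - u + j)) *: pb R[i]) in
  [/\ exists2 c : R[i], c != 0 &
        tofrac X / tofrac Y = tofrac c%:MP * (tofrac cN / tofrac cD),
      is_denominator (restr_div (W := Vplus2 M N q s t) X (Rst M N q s t)) cN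
    & is_denominator (restr_div (W := Vplus2 M N q s t) Y (Rst M N q s t)) cD].
Proof. exact: (@fused_R_denominators M N R[i] q hN hq0 hq s t hs ht X Y hX hY). Qed.
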